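(* Assume that for each $k=1,\ldots,K$, $$\lim_{n\to\infty}\widehat{\mathcal I}_k/n=\lim_{n\to\infty}\left\{n\,\widehat{\mathrm{var}}(\widehat\mu_{1,k}-\widehat\mu_{2,k})\right\}^{-1}=\lim_{n\to\infty}\left\{n\,\mathrm{var}(\widehat\mu_{1,k}-\widehat\mu_{2,k})\right\}^{-1}=\mathcal I_k^*>0 .$$ Then the conditional permutation distribution of $$S^\tau=\left(S^\tau_{\widetilde m_1,\widetilde n_1},S^\tau_{\widetilde m_2,\widetilde n_2},\ldots,S^\tau_{\widetilde m_K,\widetilde n_K}\right)^{T}$$ given the observed data $\biguplus_{i=1}^K Z_i$ converges weakly, in probability, as $n\to\infty$, to the multivariate normal distribution $N(0_K,\Sigma)$, where $0_K$ is the $K$-dimensional zero vector and the $(i,j)$th element of $\Sigma$ is $$\Sigma_{ij}=\left(\mathcal I^*_{\min\{i,j\}}/\mathcal I^*_{\max\{i,j\}}\right)^{1/2},\qquad i,j=1,\ldots,K.$$ That is, $\rho_K\big(\mathcal L(S^\tau\mid\biguplus_{i=1}^K Z_i),N(0_K,\Sigma)\big)\to 0$ in probability, where $\rho_K$ is a distance metrizing weak convergence of probability measures on $\mathbb R^K$ (e.g. the Prohorov distance).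
   Context: **Design.** $K\ge1$ is a fixed number of stages and $n\to\infty$ is the asymptotic index. At stage $k=1,\ldots,K$ there are $m_k$ new observations in the treatment arm and $n_k$ new observations in the control arm (both depend on $n$), with fixed allocation ratio $m_k/n_k=\gamma>0$ for all $k$. Put $\widetilde m_k=\sum_{j=1}^k m_j$, $\widetilde n_k=\sum_{j=1}^k n_j$, $\widetilde m_0=\widetilde n_0=0$, $N_k=m_k+n_k$. **Data.** $X_i$, $i=1,\ldots,\widetilde m_K$, are i.i.d. with distribution $F_1$ (treatment arm) and $Y_j$, $j=1,\ldots,\widetilde n_K$, are i.i.d. with distribution $F_2$ (control arm), the two samples being independent; $F_1,F_2$ do not depend on $n$. The means $\mu_1=E(X_1)$, $\mu_2=E(Y_1)$ and variances $\sigma_1^2=\mathrm{var}(X_1)$, $\sigma_2^2=\mathrm{var}(Y_1)$ are finite. No relation between $\mu_1$ and $\mu_2$ is assumed. The new observations of stage $j$ are $$Z_j=(X_{\widetilde m_{j-1}+1},\ldots,X_{\widetilde m_j},Y_{\widetilde n_{j-1}+1},\ldots,Y_{\widetilde n_j})=(Z_{j,1},\ldots,Z_{j,N_j}),$$ and $\biguplus_{j=1}^i Z_j=(X_1,\ldots,X_{\widetilde m_i},Y_1,\ldots,Y_{\widetilde n_i})$ denotes the accumulated data. **Estimators and information.** $\widehat\mu_{1,k}=\frac1{\widetilde m_k}\sum_{i=1}^{\widetilde m_k}X_i$, $\widehat\mu_{2,k}=\frac1{\widetilde n_k}\sum_{i=1}^{\widetilde n_k}Y_i$, $\widehat\sigma^2_{1,k}=\frac1{\widetilde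 m_k-1}\sum_{i=1}^{\widetilde m_k}(X_i-\widehat\mu_{1,k})^2$, $\widehat\sigma^2_{2,k}=\frac1{\widetilde n_k-1}\sum_{i=1}^{\widetilde n_k}(Y_i-\widehat\mu_{2,k})^2$. The true variance of $\widehat\mu_{1,k}-\widehat\mu_{2,k}$ is $\mathrm{var}(\widehat\mu_{1,k}-\widehat\mu_{2,k})=\sigma_1^2/\widetilde m_k+\sigma_2^2/\widetilde n_k$; its estimate is $\widehat{\mathrm{var}}(\widehat\mu_{1,k}-\widehat\mu_{2,k})=\widehat\sigma^2_{1,k}/\widetilde m_k+\widehat\sigma^2_{2,k}/\widetilde n_k$; and $\widehat{\mathcal I}_k=\{\widehat{\mathrm{var}}(\widehat\mu_{1,k}-\widehat\mu_{2,k})\}^{-1}$ is the information at analysis $k$. Limits of random quantities are in probability, and $\mathcal I_k^*$ is a finite constant. **Stage-wise permutation.** $\tau_1,\ldots,\tau_K$ are independent random permutations, independent of the data, with $\tau_i$ uniformly distributed on the symmetric group of $\{1,\ldots,N_i\}$. The permuted stage-$k$ sample is $Z_k^{\tau_k}=(Z_{k,\tau_k(1)},\ldots,Z_{k,\tau_k(N_k)})$; its first $m_k$ entries play the role of treatment observations and its last $n_k$ entries that of control observations. Put $$\widehat\mu^\tau_{1,k}=\frac1{\widetilde m_k}\sum_{s=1}^k\sum_{i=1}^{m_s}Z_{s,\tau_s(i)},\qquad \widehat\mu^\tau_{2,k}=\frac1{\widetilde n_k}\sum_{s=1}^k\sum_{i=m_s+1}^{m_s+n_s}Z_{s,\tau_s(i)},$$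 $$\widehat\sigma^2_{1,k,\tau}=\frac1{\widetilde m_k-1}\sum_{u=1}^k\sum_{i=1}^{m_u}\left(Z_{u,\tau_u(i)}-\widehat\mu^\tau_{1,k}\right)^2,\qquad \widehat\sigma^2_{2,k,\tau}=\frac1{\widetilde n_k-1}\sum_{u=1}^k\sum_{i=m_u+1}^{m_u+n_u}\left(Z_{u,\tau_u(i)}-\widehat\mu^\tau_{2,k}\right)^2,$$ and define the permuted studentized statistic $$S^\tau_{\widetilde m_k,\widetilde n_k}=\frac{\left(\frac{\widetilde m_k\widetilde n_k}{\widetilde m_k+\widetilde n_k}\right)^{1/2}\left(\widehat\mu^\tau_{1,k}-\widehat\mu^\tau_{2,k}\right)}{\left(\frac{\widetilde n_k}{\widetilde m_k+\widetilde n_k}\widehat\sigma^2_{1,k,\tau}+\frac{\widetilde m_k}{\widetilde m_k+\widetilde n_k}\widehat\sigma^2_{2,k,\tau}\right)^{1/2}}.$$ $\mathcal L(S^\tau\mid\biguplus_{i=1}^K Z_i)$ denotes the conditional law of $S^\tau$ given the data (only the permutations are random). *)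

(* Defs.v *)
From HB Require Import structures.
From mathcomp Require Import all_boot all_order all_algebra perm.
From mathcomp Require Import all_classical all_reals all_analysis.
Import Order.TTheory GRing.Theory Num.Theory.
Import numFieldNormedType.Exports.

Set Implicit Arguments.
Unset Strict Implicit.
Unset Printing Implicit Defensive.

Local Open Scope classical_set_scope.
Local Open Scope ring_scope.

(* Stages and observations are numbered from 0: stage k : 'I_K is the
   (k+1)-st stage, and x i is the (i+1)-st observation of an arm. *)

Definition cum (K : nat) (a : 'I_K -> nat) (k : 'I_K) : nat :=
  (\sum_(j < K | (j <= k)%N) a j)%N.

Definition cum_before (K : nat) (a : 'I_K -> nat) (k : 'I_K) : nat :=
  (\sum_(j < K | (j < k)%N) a j)%N.

Definition total_size (K : nat) (a : 'I_K -> nat) : nat := (\sum_(j < K) a j)%N.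

Definition sample_mean (R : realType) (N : nat) (x : nat -> R) : R :=
  N%:R^-1 * \sum_(i < N) x i.

Definition sample_var (R : realType) (N : nat) (x : nat -> R) : R :=
  (N%:R - 1)^-1 * \sum_(i < N) (x i - sample_mean N x) ^+ 2.

Definition mean_diff (R : realType) (K : nat) (m l : 'I_K -> nat)
    (x y : nat -> R) (k : 'I_K) : R :=
  sample_mean (cum m k) x - sample_mean (cum l k) y.

Definition var_hat (R : realType) (K : nat) (m l : 'I_K -> nat)
    (x y : nat -> R) (k : 'I_K) : R :=
  sample_var (cum m k) x / (cum m k)%:R + sample_var (cum l k) y / (cum l k)%:R.

(* When var_hat vanishes this is 0 instead of +oo; either way the value stays
   away from any finite positive limit. *)
Definition info_hat (R : realType) (K : nat) (m l : 'I_K -> nat)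
    (x y : nat -> R) (k : 'I_K) : R :=
  (var_hat m l x y k)^-1.

Definition stage_data (R : realType) (K : nat) (m l : 'I_K -> nat)
    (x y : nat -> R) (k : 'I_K) (i : 'I_(m k + l k)) : R :=
  match fintype.split i with
  | inl a => x (cum_before m k + a)%N
  | inr b => y (cum_before l k + b)%N
  end.

Definition perm_treat (R : realType) (K : nat) (m l : 'I_K -> nat)
    (x y : nat -> R) (tau : forall k : 'I_K, 'S_(m k + l k))
    (s : 'I_K) (i : 'I_(m s)) : R :=
  stage_data x y (tau s (lshift (l s) i)).

Definition perm_ctrl (R : realType) (K : nat) (m l : 'I_K -> nat)
    (x y : nat -> R) (tau : forall k : 'I_K, 'S_(m k + l k))
    (s : 'I_K) (i : 'I_(l s)) : R :=
  stage_data x y (tau s (rshift (m s) i)).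

Definition cum_mean (R : realType) (K : nat) (a : 'I_K -> nat)
    (z : forall s : 'I_K, 'I_(a s) -> R) (k : 'I_K) : R :=
  (cum a k)%:R^-1 * \sum_(s < K | (s <= k)%N) \sum_(i < a s) z s i.

Definition cum_var (R : realType) (K : nat) (a : 'I_K -> nat)
    (z : forall s : 'I_K, 'I_(a s) -> R) (k : 'I_K) : R :=
  ((cum a k)%:R - 1)^-1 *
  \sum_(s < K | (s <= k)%N) \sum_(i < a s) (z s i - cum_mean z k) ^+ 2.

Definition perm_stat (R : realType) (K : nat) (m l : 'I_K -> nat)
    (x y : nat -> R) (tau : forall k : 'I_K, 'S_(m k + l k)) (k : 'I_K) : R :=
  let M : R := (cum m k)%:R in
  let L : R := (cum l k)%:R in
  let z1 := perm_treat x y tau in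
  let z2 := perm_ctrl x y tau in
  Num.sqrt (M * L / (M + L)) * (cum_mean z1 k - cum_mean z2 k) /
  Num.sqrt (L / (M + L) * cum_var z1 k + M / (M + L) * cum_var z2 k).

Definition borel_rV (R : realType) (K : nat) :=
  g_sigma_algebraType (@open 'rV[R]_K).

Definition perm_stat_vec (R : realType) (K : nat) (m l : 'I_K -> nat)
    (x y : nat -> R) (tau : forall k : 'I_K, 'S_(m k + l k)) : borel_rV R K :=
  \row_(k < K) perm_stat x y tau k.

(* Each F i is meant to be a sigma-algebra; since it then contains setT, the
   product rule over the whole of I includes the one for its subsets. *)
Definition mutually_independent (d : measure_display) (T : measurableType d)
    (R : realType) (P : probability T R) (I : finType)
    (F : I -> set (set T)) : Prop :=
  forall A : I -> set T, (forall i, F i (A i)) ->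
    P (\bigcap_i A i) = (\prod_(i : I) fine (P (A i)))%:E.

Definition observation (T : Type) (R : realType) (M L : nat)
    (X Y : nat -> T -> R) (i : 'I_M + 'I_L) : T -> R :=
  match i with inl a => X a | inr b => Y b end.

Definition data_sigma (T : Type) (R : realType) (M L : nat)
    (X Y : nat -> T -> R) : set (set T) :=
  <<s [set (observation X Y i) @^-1` B
      | i in [set: 'I_M + 'I_L] & B in (@measurable _ R)] >>.

Definition experiment_events (T : Type) (R : realType) (K : nat)
    (m l : 'I_K -> nat) (X Y : nat -> T -> R)
    (tau : forall k : 'I_K, T -> 'S_(m k + l k))
    (i : ('I_(total_size m) + 'I_(total_size l)) + 'I_K) : set (set T) :=
  match i with
  | inl z => preimage_set_system setT (observation X Y z) (@measurable _ R)
  | inr k => preimage_set_system setT (tau k) setT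
  end.

(* kappa is a regular version of the conditional law of S given the
   sub-sigma-algebra G *)
Definition is_conditional_law (d d' : measure_display) (T : measurableType d)
    (V : measurableType d') (R : realType) (P : probability T R)
    (G : set (set T)) (S : T -> V) (kappa : T -> probability V R) : Prop :=
  (forall A : set V, measurable A -> forall B : set R, measurable B ->
     G ((fun w => fine (kappa w A)) @^-1` B)) /\
  (forall (A : set V) (D : set T), measurable A -> G D ->
     (\int[P]_(w in D) kappa w A)%E = P (D `&` S @^-1` A)).

(* Convergence in probability to a constant, the n-th variable living on its
   own probability space. The outer measure makes sense of it without assuming
   measurability, and agrees with P n on measurable events. *)
Definition cvg_in_prob (R : realType) (d : nat -> measure_display)
    (T : forall n, measurableType (d n)) (P : forall n, probability (T n) R)
    (f : forall n, T n -> R) (c : R) : Prop :=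
  forall eps : R, 0 < eps ->
    mu_ext (P n) [set w | eps <= `|f n w - c|] @[n --> \oo] --> 0%E.

(* The univariate N(mu, s2), s2 >= 0; normal_prob is parameterised by the
   standard deviation and is not the Dirac mass when that is 0. *)
Definition normal_law (R : realType) (mu s2 : R) (B : set R) : \bar R :=
  if s2 == 0 then dirac mu B else normal_prob mu (Num.sqrt s2) B.

(* N(mu, Sigma), possibly degenerate: every linear functional a has the
   univariate law N(mu.a, a Sigma a^T). *)
Definition is_multivariate_normal (R : realType) (K : nat)
    (mu : 'rV[R]_K) (Sigma : 'M[R]_K)
    (N : probability (borel_rV R K) R) : Prop :=
  forall (a : 'rV[R]_K) (B : set R), measurable B ->
    N [set x : 'rV[R]_K | B ((x *m a^T) 0 0)] =
    normal_law ((mu *m a^T) 0 0) ((a *m Sigma *m a^T) 0 0) B.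

Definition weakly_converges (R : realType) (K : nat)
    (mu_ : nat -> probability (borel_rV R K) R)
    (mu : probability (borel_rV R K) R) : Prop :=
  forall f : 'rV[R]_K -> R, continuous f ->
    (exists C : R, forall x, `|f x| <= C) ->
    (\int[mu_ i]_x (f x)%:E)%E @[i --> \oo] --> (\int[mu]_x (f x)%:E)%E.

(* Measures are functions on all sets, unconstrained on non-measurable ones, so
   the separation axiom compares them on measurable sets only. *)
Definition metrizes_weak_convergence (R : realType) (K : nat)
    (rho : probability (borel_rV R K) R -> probability (borel_rV R K) R -> R) :
    Prop :=
  [/\ forall mu nu, rho mu nu = 0 <->
        (forall A : set (borel_rV R K), measurable A -> mu A = nu A),
      forall mu nu, rho mu nu = rho nu mu,
      forall mu nu xi, rho mu xi <= rho mu nu + rho nu xi &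
      forall mu_ mu,
        rho (mu_ i) mu @[i --> \oo] --> (0 : R) <-> weakly_converges mu_ mu].

Definition limit_cov (R : realType) (K : nat) (Istar : 'I_K -> R) : 'M[R]_K :=
  \matrix_(i, j) Num.sqrt (Istar (Order.min i j) / Istar (Order.max i j)).

(* Main.v *)
(** The real characteristic functions t |-> E cos (u . S + th) determine the limit.
    Write S_k = T_k / sqrt D_k, where T_k is a weighted sum over the stages s <= k
    of the contrasts b_s, the centered permutation sums of the stages, and D_k is
    the pooled variance estimate. In probability over data and permutations, D_k
    tends to the variance V of the mixture of F1 and F2 with weights proportional
    to gamma and 1, by a law of large numbers for truncated data. This reduces
    the claim to linear combinations of the b_s, where the data may be truncated.
    Swapping two uniformly chosen positions in stage s is an exchangeable pair; for
    bounded data, Stein's identity gives a differential equation for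
    x |-> avg cos (x b_s + th) with th independent of the permutation of stage s,
    whence avg cos (b_s + th) is close to exp (- var / 2) avg cos th, and the stages
    are removed one at a time. The information limits enter only through
    l_s / n -> lam_s with sum_(s <= k) lam_s = v I*_k.
    The conditional law is compared with the permutation average on the events of
    the data sigma-algebra, by Markov's inequality. Finally a ball of rho around the
    limit contains every law for which finitely many trigonometric integrals and
    finitely many tails are nearly right (Levy's theorem, proved by approximating a
    test function by Bernstein polynomials in sines). *)

Require Import Defs.
From HB Require Import structures.
From mathcomp Require Import all_boot all_order all_algebra perm.
From mathcomp Require Import all_classical all_reals all_analysis.
From mathcomp Require Import measurable_realfun.
From mathcomp Require Import ring lra.
Import Order.TTheory GRing.Theory Num.Theory.
Import numFieldNormedType.Exports.

Set Implicit Arguments.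
Unset Strict Implicit.
Unset Printing Implicit Defensive.

Local Open Scope classical_set_scope.
Local Open Scope ring_scope.

(** * Stein's method for permutation sums *)

(** No relation between the two means enters, because permuting within a stage makes both arms look
    like samples of one mixture. Its variance [pool_var], which also contains the squared difference
    of the means, appears twice: as the limit of the studentizing variance and as a factor of the
    limit variance of every contrast. It therefore cancels in [phase_exponent], together with
    [gamma]. The stages need not be comparable in size: after the first stage [lam s] may be 0, so
    sums are normalized by [n] and not by the size of the stage, and such a stage contributes no
    variance in the limit. Cosines with a free phase stand in for complex exponentials. The level of
    truncation is fixed before [n] grows, since the error terms of Stein's method are controlled for
    bounded data only; truncated data need no new centring, as the contrast weights of a stage sum
    to 0. *)

Lemma mvt_segment (R : realType) (f f' : R -> R)
    (hf : forall x : R, is_derive x 1 f (f' x)) (a b : R) :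
  exists2 c, `|c - a| <= `|b - a| & f b - f a = f' c * (b - a).
Proof.
have cont x y : {within `[x, y], continuous f}.
  apply: continuous_subspaceT => z.
  by apply: differentiable_continuous; apply/derivable1_diffP; case: (hf z).
have [ab|ba|->] := ltgtP a b; last by exists b => //; rewrite !subrr mulr0.
- have [c /andP[]] := MVT ab (fun x _ => hf x) (cont a b).
  rewrite !bnd_simp => ac cb e; exists c => //.
  by rewrite !gtr0_norm ?subr_gt0// ?lerD2r ?(ltW cb)// (lt_trans ac).
- have [c /andP[]] := MVT ba (fun x _ => hf x) (cont b a).
  rewrite !bnd_simp => bc ca e; exists c.
    by rewrite !ltr0_norm ?subr_lt0// ?lerN2 ?lerD2r ?(ltW bc)// (lt_trans bc).
  by rewrite -(opprB (f a)) e -mulrN opprB.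
Qed.

Lemma cos_lipschitz (R : realType) (a b : R) : `|cos a - cos b| <= `|a - b|.
Proof.
have [c _ ->] := mvt_segment (fun x : R => is_derive_cos x) b a.
by rewrite normrM ler_piMl// normrN sin_max.
Qed.

(** One use of the mean value theorem: the derivative in [x] of the remainder is
    [cos (u - x) - cos u], of size at most [|x|]. The price is the factor 1/2 of Taylor's
    formula. *)
Lemma sin_taylor1 (R : realType) (u e : R) :
  `|sin u - sin (u - e) - e * cos u| <= e ^+ 2.
Proof.
pose f x : R := sin u - sin (u - x) - x * cos u.
have df (x : R) : is_derive x 1 f (cos (u - x) - cos u).
  rewrite /f; apply: is_derive_eq; rewrite !scaler1 /GRing.scale /=; ring.
have [c hc] := mvt_segment df 0 e.
rewrite !subr0 in hc *; rewrite {2}/f !subr0 subrr mul0r subrr subr0 /f => ->.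
rewrite normrM -(real_normK (num_real e)) expr2 ler_wpM2r//.
rewrite (le_trans (cos_lipschitz _ _))//.
by rewrite addrAC subrr add0r normrN.
Qed.

Lemma is_derive_bigsum (R : realType) (I : Type) (r : seq I) (f : I -> R -> R)
    (f' : I -> R) (x : R) :
  (forall i, is_derive x 1 (f i) (f' i)) ->
  is_derive x 1 (fun y => \sum_(i <- r) f i y) (\sum_(i <- r) f' i).
Proof.
move=> df; elim: r => [|i r IH].
  rewrite big_nil (_ : (fun _ => _) = cst 0); first exact: is_derive_cst.
  by apply/funext => y; rewrite big_nil.
rewrite big_cons (_ : (fun _ => _) = (fun y => f i y + \sum_(i <- r) f i y)).
  exact: is_deriveD.
by apply/funext => y; rewrite big_cons.
Qed.

Section average.
Variables (R : realType) (Om : finType).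
Implicit Types F G : Om -> R.

Definition avg F : R := #|Om|%:R^-1 * \sum_t F t.

Lemma avg_ext F G : (forall t, F t = G t) -> avg F = avg G.
Proof. by move=> FG; rewrite /avg (eq_bigr _ (fun t _ => FG t)). Qed.

Lemma avgD F G : avg (fun t => F t + G t) = avg F + avg G.
Proof. by rewrite /avg big_split/= mulrDr. Qed.

Lemma avgZ c F : avg (fun t => c * F t) = c * avg F.
Proof. by rewrite /avg -mulr_sumr mulrCA. Qed.

Lemma avgN F : avg (fun t => - F t) = - avg F.
Proof. by rewrite /avg sumrN mulrN. Qed.

Lemma avgB F G : avg (fun t => F t - G t) = avg F - avg G.
Proof. by rewrite avgD avgN. Qed.

Lemma avg_sum (I : finType) (F : I -> Om -> R) :
  avg (fun t => \sum_i F i t) = \sum_i avg (F i).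
Proof. by rewrite /avg exchange_big mulr_sumr. Qed.

Lemma avg_le F G : (forall t, F t <= G t) -> avg F <= avg G.
Proof. by move=> FG; rewrite ler_wpM2l ?invr_ge0//; apply: ler_sum. Qed.

Lemma avg_ge0 F : (forall t, 0 <= F t) -> 0 <= avg F.
Proof. by move=> F0; rewrite mulr_ge0 ?invr_ge0//; apply: sumr_ge0. Qed.

Lemma norm_avg_le F : `|avg F| <= avg (fun t => `|F t|).
Proof.
rewrite /avg normrM ger0_norm ?invr_ge0// ler_wpM2l ?invr_ge0//.
exact: ler_norm_sum.
Qed.

Lemma avg_cst (c : R) : (0 < #|Om|)%N -> avg (fun=> c) = c.
Proof.
move=> Om0; rewrite /avg sumr_const -[c *+ _]mulr_natl mulKf//.
by rewrite pnatr_eq0 -lt0n.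
Qed.

Lemma avg_bij (s : Om -> Om) F : injective s -> avg (F \o s) = avg F.
Proof.
by move=> si; rewrite /avg [in RHS](reindex s)//; apply: onW_bij; apply: injF_bij.
Qed.

End average.

(** The swap increments, summed over all ordered pairs, are proportional to the sum itself: the
    linear regression property of an exchangeable pair. *)
Lemma sum_pair_diff (R : realType) (N : nat) (a y : 'I_N -> R) :
  \sum_i a i = 0 ->
  \sum_i \sum_j (a i - a j) * (y i - y j) = 2 * N%:R * \sum_i a i * y i.
Proof.
move=> a0.
have -> : \sum_i \sum_j (a i - a j) * (y i - y j) =
   \sum_i \sum_(j < N) (a i * y i) - \sum_i \sum_j (a i * y j) -
   \sum_i \sum_j (a j * y i) + \sum_(i < N) \sum_j (a j * y j).
  rewrite -!sumrB -big_split/=; apply: eq_bigr => i _.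
  by rewrite -!sumrB -big_split/=; apply: eq_bigr => j _; ring.
have -> : \sum_i \sum_j a i * y j = 0.
  by under eq_bigr do rewrite -mulr_sumr; rewrite -mulr_suml a0 mul0r.
have -> : \sum_i \sum_j a j * y i = 0.
  by under eq_bigr do rewrite -mulr_suml a0 mul0r; rewrite big1.
under eq_bigr do rewrite sumr_const card_ord -mulr_natl.
by rewrite -mulr_sumr sumr_const card_ord -mulr_natl; ring.
Qed.

Section swap_family.
Variables (R : realType) (N : nat) (Om : finType).
Variables (p : Om -> 'S_N) (sw : 'I_N -> 'I_N -> Om -> Om).
Hypothesis sw_inv : forall i j, involutive (sw i j).
Hypothesis Om_gt0 : (0 < #|Om|)%N.
Hypothesis p_sw : forall i j t k, p (sw i j t) k = p t (tperm i j k).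

Lemma sw_inj i j : injective (sw i j).
Proof. exact: inv_inj. Qed.

(** [Om] is kept abstract: later it is the set of permutations of all stages at once, with [p]
    reading off one stage and [sw] acting on that stage alone, so that averages over [Om] may also
    involve the other stages. *)
Definition permsum (a z : 'I_N -> R) (t : Om) : R := \sum_i a i * z (p t i).

Definition swapdiff (a z : 'I_N -> R) (t : Om) (i j : 'I_N) : R :=
  (a i - a j) * (z (p t i) - z (p t j)).

Lemma permsum_sw a z i j t :
  permsum a z (sw i j t) = permsum a z t - swapdiff a z t i j.
Proof.
rewrite /permsum /swapdiff.
under eq_bigr do rewrite p_sw.
rewrite (reindex_inj (@perm_inj _ (tperm i j))) /=.
under eq_bigr do rewrite tpermK.
apply/eqP; rewrite eq_sym subr_eq addrC -subr_eq eq_sym -sumrB; apply/eqP.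
have E k : a k * z (p t k) - a (tperm i j k) * z (p t k) =
  (if k == i then (a i - a j) * z (p t i) else 0) +
  (if k == j then (a j - a i) * z (p t j) else 0).
  case: tpermP => [->|->|/eqP/negPf -> /eqP/negPf ->].
  - by rewrite eqxx; case: eqP => [<-|_]; ring.
  - by rewrite eqxx; case: eqP => [->|_]; ring.
  - by rewrite subrr addr0.
under eq_bigr do rewrite E.
rewrite big_split/= -!big_mkcond/= !big_pred1_eq; ring.
Qed.

Lemma swapdiff_sw a z i j t : swapdiff a z (sw i j t) i j = - swapdiff a z t i j.
Proof. by rewrite /swapdiff !p_sw tpermL tpermR; ring. Qed.

(** The swap preserves the uniform law and changes the sign of [swapdiff], so averaging a term with
    its swapped copy produces the difference of [G] with a factor 2; summing [swapdiff] over all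
    pairs produces [2 * N%:R * permsum], whence the factor 4. The second argument of [G], on which
    swaps have no effect, will carry a phase. *)
Lemma stein_identity (a z : 'I_N -> R) (G : R -> Om -> R)
    (GI : forall i j x t, G x (sw i j t) = G x t) : \sum_i a i = 0 ->
  4 * N%:R * avg (fun t => permsum a z t * G (permsum a z t) t) =
  avg (fun t => \sum_i \sum_j swapdiff a z t i j *
     (G (permsum a z t) t - G (permsum a z t - swapdiff a z t i j) t)).
Proof.
move=> a0; rewrite avg_sum.
have E i j : 2 * avg (fun t => swapdiff a z t i j * G (permsum a z t) t) =
    avg (fun t => swapdiff a z t i j *
     (G (permsum a z t) t - G (permsum a z t - swapdiff a z t i j) t)).
  rewrite mulrDl mul1r -[X in _ + X](avg_bij _ (@sw_inj i j)) -avgD.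
  by apply: avg_ext => t /=; rewrite swapdiff_sw permsum_sw GI; ring.
under [RHS]eq_bigr => i _.
  rewrite avg_sum; under eq_bigr do rewrite -E.
  rewrite -mulr_sumr -avg_sum; over.
rewrite -mulr_sumr -avg_sum -!avgZ; apply: avg_ext => t.
under [in RHS]eq_bigr do rewrite -mulr_suml.
by rewrite -mulr_suml /swapdiff (sum_pair_diff (fun i => z (p t i)) a0) /permsum; ring.
Qed.

(** By invariance under swaps the mean does not depend on the position [i], and the sum over all
    positions is constant because [p t] is a permutation. *)
Lemma avg_coord (f : 'I_N -> R) i :
  avg (fun t => f (p t i)) = N%:R^-1 * \sum_k f k.
Proof.
have E j : avg (fun t => f (p t j)) = avg (fun t => f (p t i)).
  by rewrite -[LHS](avg_bij _ (@sw_inj i j)); apply: avg_ext => t /=; rewrite p_sw tpermR.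
have N0 : N%:R != 0 :> R by rewrite pnatr_eq0; case: (N) i {E} => // -[].
apply: (mulfI N0); rewrite mulVKf//.
rewrite (_ : _ * _ = \sum_j avg (fun t => f (p t j))); last first.
  by under eq_bigr do rewrite E; rewrite sumr_const card_ord mulr_natl.
rewrite -avg_sum -[RHS](avg_cst _ Om_gt0); apply: avg_ext => t.
by rewrite [RHS](reindex_inj (@perm_inj _ (p t))).
Qed.

(** Stein's identity for the identity function, with [(x - y) ^+ 2 <= 2 * x ^+ 2 + 2 * y ^+ 2]. The
    bound exceeds the exact variance, but it is expressed by the raw sum of squares of the data. *)
Lemma avg_permsum_sqr (a z : 'I_N -> R) : \sum_i a i = 0 ->
  avg (fun t => permsum a z t ^+ 2) <=
  2 * (\sum_i a i ^+ 2) * (N%:R^-1 * \sum_k z k ^+ 2).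
Proof.
move=> a0; have [N0|N0] := posnP N.
  rewrite (@avg_ext _ _ _ (fun=> 0)) ?avg_cst//; last first.
    move=> t; rewrite /permsum big1 ?expr0n// => -[i iN].
    by exfalso; move: iN; rewrite N0.
  by rewrite !mulr_ge0 ?invr_ge0//; apply: sumr_ge0 => *; apply: sqr_ge0.
have Np : 0 < N%:R :> R by rewrite ltr0n.
have := @stein_identity a z (fun x _ => x) (fun _ _ _ _ => erefl) a0.
set q := N%:R^-1 * _ => E.
have : avg (fun t => \sum_i \sum_j swapdiff a z t i j *
     (permsum a z t - (permsum a z t - swapdiff a z t i j))) <=
   \sum_i \sum_j (a i - a j) ^+ 2 * (4 * q).
  rewrite avg_sum; apply: ler_sum => i _; rewrite avg_sum; apply: ler_sum => j _.
  have -> : 4 * q = 2 * avg (fun t => z (p t i) ^+ 2) +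
                    2 * avg (fun t => z (p t j) ^+ 2).
    by rewrite !(avg_coord (fun k => z k ^+ 2)) /q; ring.
  rewrite -!avgZ -avgD -avgZ; apply: avg_le => t.
  rewrite subKr /swapdiff; set x := z _; set y := z _.
  rewrite -expr2 exprMn ler_wpM2l ?sqr_ge0// -subr_ge0.
  by rewrite (_ : _ - _ = (x + y) ^+ 2) ?sqr_ge0//; ring.
rewrite -E (_ : \sum_i \sum_j _ = 8 * N%:R * q * \sum_i a i ^+ 2); last first.
  have -> : \sum_i \sum_j (a i - a j) ^+ 2 * (4 * q) =
      (4 * q) * \sum_i \sum_j (a i - a j) * (a i - a j).
    by rewrite mulr_sumr; apply: eq_bigr => i _; rewrite mulr_sumr; apply: eq_bigr => j _; ring.
  rewrite sum_pair_diff//; under eq_bigr do rewrite -expr2; ring.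
rewrite -subr_ge0 => H; rewrite -subr_ge0.
rewrite -(@pmulr_rge0 _ (4 * N%:R)) ?mulr_gt0//; apply: le_trans H _.
rewrite (_ : avg (fun t => permsum a z t * _) = avg (fun t => permsum a z t ^+ 2)).
  by rewrite le_eqVlt; apply/orP; left; apply/eqP; ring.
by apply: avg_ext => t; rewrite expr2.
Qed.

(* Stein's method with the exchangeable pair that swaps two uniformly chosen
   positions: the derivative of phi x = avg (cos (x * permsum + th)) is
   - s * x * phi x up to the right-hand side, hence expR (s * x ^+ 2 / 2) * phi x
   hardly moves between x = 0 and x = 1. *)
Lemma permsum_clt (a z : 'I_N -> R) (th : Om -> R) (s : R) :
  (forall i j t, th (sw i j t) = th t) -> \sum_i a i = 0 -> 0 <= s -> (0 < N)%N ->
  `|avg (fun t => cos (permsum a z t + th t)) -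
     expR (- (s / 2)) * avg (fun t => cos (th t))| <=
  avg (fun t => `|(4 * N%:R)^-1 * (\sum_i \sum_j swapdiff a z t i j ^+ 2) - s| +
     (4 * N%:R)^-1 * \sum_i \sum_j `|swapdiff a z t i j| ^+ 3).
Proof.
move=> thI a0 s0 N0; set E := avg (fun t => `|_| + _).
have Np : 0 < N%:R :> R by rewrite ltr0n.
have E0 : 0 <= E.
  apply: avg_ge0 => t; rewrite addr_ge0// mulr_ge0 ?invr_ge0 ?mulr_ge0//.
  by apply: sumr_ge0 => i _; apply: sumr_ge0 => j _; rewrite exprn_ge0.
pose B := permsum a z.
pose phi x := avg (fun t => cos (x * B t + th t)).
pose dphi x := - avg (fun t => B t * sin (x * B t + th t)).
have dphiP (x : R) : is_derive x 1 phi (dphi x).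
  rewrite /phi /dphi /avg -mulrN -sumrN.
  apply: is_deriveZ; apply: is_derive_bigsum => t.
  by apply: is_derive_eq; rewrite !scaler1 /GRing.scale/=; ring.
have bound (x : R) : `|x| <= 1 -> `|dphi x + s * x * phi x| <= E.
  move=> x1.
  have := @stein_identity a z (fun y t => sin (x * y + th t)) _ a0.
  move=> /(_ (fun i j y t => congr1 (fun u => sin (x * y + u)) (thI i j t))) S.
  have -> : dphi x + s * x * phi x = (4 * N%:R)^-1 * (s * x * 4 * N%:R * phi x -
      4 * N%:R * avg (fun t => B t * sin (x * B t + th t))).
    by rewrite /dphi; field; rewrite gt_eqF.
  rewrite S /phi -!avgZ -avgB -avgZ (le_trans (norm_avg_le _))//.
  apply: avg_le => t; rewrite -/(B t).
  set d := swapdiff a z t; set c := cos (x * B t + th t).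
  (* The increment of the sine is replaced by its linear part. That part gives [x * c] times the sum
     of squares, which is compared with [s]; the remainder is quadratic in [d i j] and becomes cubic
     after multiplication by [d i j]. *)
  rewrite (_ : _ * _ = - (x * c * ((4 * N%:R)^-1 * (\sum_i \sum_j d i j ^+ 2) - s)) -
    (4 * N%:R)^-1 * \sum_i \sum_j d i j * (sin (x * B t + th t) -
       sin (x * (B t - d i j) + th t) - x * d i j * c)); last first.
    have -> : \sum_i \sum_j d i j * (sin (x * B t + th t) -
       sin (x * (B t - d i j) + th t) - x * d i j * c) =
      \sum_i \sum_j d i j * (sin (x * B t + th t) -
       sin (x * (B t - d i j) + th t)) - x * c * \sum_i \sum_j d i j ^+ 2.
      rewrite [x * c * _]mulr_sumr -sumrB; apply: eq_bigr => i _.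
      rewrite [x * c * _]mulr_sumr -sumrB; apply: eq_bigr => j _; ring.
    by field; rewrite gt_eqF.
  rewrite (le_trans (ler_normB _ _))// normrN lerD//.
    rewrite normrM ler_piMl// normrM -[leRHS]mulr1.
    by rewrite ler_pM// cos_max.
  rewrite normrM ger0_norm ?invr_ge0 ?mulr_ge0// ler_wpM2l ?invr_ge0 ?mulr_ge0//.
  rewrite (le_trans (ler_norm_sum _ _ _))//; apply: ler_sum => i _.
  rewrite (le_trans (ler_norm_sum _ _ _))//; apply: ler_sum => j _.
  rewrite normrM exprS ler_wpM2l// real_normK ?num_real//.
  have := sin_taylor1 (x * B t + th t) (x * d i j).
  rewrite (_ : x * B t + th t - x * d i j = x * (B t - d i j) + th t); last by ring.
  move=> /le_trans; apply; rewrite exprMn ler_piMl ?sqr_ge0//.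
  by rewrite -real_normK ?num_real// expr_le1.
pose h x := expR (s * x ^+ 2 / 2) * phi x.
pose dh x := expR (s * x ^+ 2 / 2) * (dphi x + s * x * phi x).
have dhP (x : R) : is_derive x 1 h (dh x).
  have := dphiP x => ?; rewrite /h; apply: is_derive_eq.
  by rewrite !scaler1 /dh /GRing.scale/=; field.
have [c] := mvt_segment dhP 0 1.
rewrite !subr0 normr1 mulr1 => c1 e.
rewrite (_ : _ - _ = expR (- (s / 2)) * (h 1 - h 0)); last first.
  have -> : h 1 = expR (s / 2) * avg (fun t => cos (permsum a z t + th t)).
    by rewrite /h expr1n mulr1; congr (_ * _); apply: avg_ext => t; rewrite mul1r.
  have -> : h 0 = avg (fun t => cos (th t)).
    rewrite /h expr0n/= mulr0 mul0r expR0 mul1r.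
    by apply: avg_ext => t; rewrite mul0r add0r.
  rewrite mulrBr [X in _ = X - _]mulrA (_ : expR _ * expR _ = 1) ?mul1r//.
  by rewrite -expRD addNr expR0.
rewrite e /dh normrM ger0_norm ?expR_ge0// normrM [`|expR _|]ger0_norm ?expR_ge0//.
rewrite mulrA -expRD (le_trans (ler_wpM2l (expR_ge0 _) (bound _ c1)))//.
rewrite ler_piMl// -[leRHS]expR0 ler_expR addrC subr_le0 ler_pM2r ?invr_gt0// ler_piMr//.
by rewrite -real_normK ?num_real// expr_le1.
Qed.

End swap_family.

(** * The characteristic function of a normal law *)

Section normal_density_integral.
Variables (R : realType) (m s : R).
Local Notation mu := lebesgue_measure.

Lemma integral_normal_prob (f : R -> \bar R) :
  (normal_prob m s).-integrable setT f ->
  (\int[normal_prob m s]_x f x = \int[mu]_x (f x * (normal_pdf m s x)%:E))%E.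
Proof.
move=> fi; have mf := measurable_int _ fi.
rewrite -(Radon_Nikodym_change_of_variables (normal_prob_dominates m s))//=.
apply: ae_eq_integral => //.
- apply: emeasurable_funM => //; apply: (measurable_int mu) => //=.
  by apply: Radon_Nikodym_integrable; exact: normal_prob_dominates.
- apply: emeasurable_funM => //=; apply/measurableT_comp => //=.
  exact: measurable_normal_pdf.
- apply: ae_eqe_mul2l => /=.
  rewrite Radon_NikodymE//=; first exact: normal_prob_dominates.
  move=> dom; case: cid => /= h [h1 h2 h3].
  apply: integral_ae_eq => //=.
  + by apply/measurableT_comp => //; exact: measurable_normal_pdf.
  + by move=> E _ mE; rewrite -h3.
Qed.

End normal_density_integral.

Section normal_cf.
Variables (R : realType) (s : R).
Hypothesis s0 : s != 0.
Local Notation mu := (@lebesgue_measure R).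
Local Notation phi := (normal_pdf 0 s).

Let phiE x : phi x = normal_peak s * expR (- x ^+ 2 / (s ^+ 2 *+ 2)).
Proof. by rewrite normal_pdfE// /normal_fun subr0. Qed.

Let s2_gt0 : 0 < s ^+ 2.
Proof. by rewrite exprn_even_gt0. Qed.

Let is_derive_phi (x : R) : is_derive x 1 phi (- x / s ^+ 2 * phi x).
Proof.
rewrite phiE (_ : phi = fun x => normal_peak s * expR (- x ^+ 2 / (s ^+ 2 *+ 2))).
  apply: is_derive_eq; rewrite !scaler1 /GRing.scale/=; field.
  by [].
by apply/funext => y; rewrite phiE.
Qed.

(** The factor [|x|] is absorbed by doubling the variance: with [u = |x| / |s|], the bound [u <= 2 *
    (1 + u ^+ 2 / 4) <= 2 * expR (u ^+ 2 / 4)] leaves a multiple of the density with parameter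
    [Num.sqrt 2 * s]. *)
Lemma integrable_normr_normal_pdf : mu.-integrable setT (fun x => (`|x| * phi x)%:E).
Proof.
pose s' := Num.sqrt 2 * s.
have s'0 : s' != 0 by rewrite mulf_neq0// gt_eqF// sqrtr_gt0.
pose C := 2 * `|s| * normal_peak s / normal_peak s'.
have i' : mu.-integrable setT (fun x => (C%:E * (normal_pdf 0 s' x)%:E)%E).
  by apply: integrableZl => //; exact: integrable_normal_pdf.
apply: (le_integrable _ _ _ i') => //.
  apply/measurable_EFinP/measurable_funM; last exact: measurable_normal_pdf.
  exact: normr_measurable.
move=> x _; rewrite /= lee_fin normrM normr_id; apply: le_trans (ler_norm _).
rewrite (ger0_norm (normal_pdf_ge0 _ _ _)) phiE normal_pdfE// /normal_fun subr0 /C.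
rewrite [leRHS]mulrA divfK ?gt_eqF ?normal_peak_gt0// mulrCA [leRHS]mulrAC [leRHS]mulrC.
rewrite ler_wpM2l ?normal_peak_ge0//.
set y := x ^+ 2 / (s ^+ 2 *+ 4).
have -> : - x ^+ 2 / (s' ^+ 2 *+ 2) = - y.
  by rewrite /y /s' exprMn sqr_sqrtr//; field.
have -> : - x ^+ 2 / (s ^+ 2 *+ 2) = - y - y.
  by rewrite /y; field.
rewrite expRD mulrA ler_wpM2r ?expR_ge0//.
rewrite -ler_pdivlMr ?expR_gt0// -expRN opprK.
apply: (@le_trans _ _ (2 * `|s| * (1 + y))); last first.
  by rewrite ler_wpM2l ?mulr_ge0// expR_ge1Dx.
have -> : y = (`|x| / `|s|) ^+ 2 / 4.
  by rewrite /y exprMn exprVn !real_normK ?num_real//; field.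
have sp : 0 < `|s| by rewrite normr_gt0.
rewrite {1}(_ : `|x| = `|s| * (`|x| / `|s|)); last by field; rewrite gt_eqF.
rewrite (mulrC 2) -mulrA ler_wpM2l// -subr_ge0; set u := `|x| / `|s|.
rewrite (_ : _ - _ = ((u - 1) ^+ 2 + 3) / 2); last by field.
by rewrite divr_ge0// addr_ge0// sqr_ge0.
Qed.

Let integrable_phi : mu.-integrable setT (fun x => (phi x)%:E).
Proof. exact: integrable_normal_pdf. Qed.

Let integrableM (g : R -> R) (h : R -> R) : measurable_fun setT g ->
  (forall x, `|g x| <= 1) ->
  mu.-integrable setT (EFin \o h) -> mu.-integrable setT (fun x => (g x * h x)%:E).
Proof.
move=> mg g1 ih; apply: (le_integrable _ _ _ ih) => //.
  apply/measurable_EFinP/measurable_funM => //.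
  by apply/measurable_EFinP; exact: measurable_int ih.
by move=> x _; rewrite /= lee_fin normrM ler_piMl.
Qed.

Let measurable_trig (f : R -> R) t th : continuous f ->
  measurable_fun setT (fun x : R => f (t * x + th)).
Proof.
move=> cf; apply: measurableT_comp; first exact: continuous_measurable_fun.
by apply: measurable_funD => //; exact: measurable_funM.
Qed.

Let phi_cvg0 (a : R) : a ^+ 2 = 1 -> phi (a * n.+1%:R) @[n --> \oo] --> 0.
Proof.
move=> a2; pose c := s ^+ 2 *+ 2 : R.
have c0 : 0 < c by rewrite mulrn_wgt0.
pose u n : R := normal_peak s * c * harmonic n.
have u0 : u n @[n --> \oo] --> 0.
  rewrite -[X in _ --> X](mulr0 (normal_peak s * c)).
  by apply: cvgMr; exact: cvg_harmonic.
apply: (squeeze_cvgr _ (cvg_cst 0) u0); near=> n.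
rewrite normal_pdf_ge0/= phiE /u -mulrA ler_wpM2l ?normal_peak_ge0//.
rewrite exprMn a2 mul1r mulNr expRN -/c /harmonic/= -[leRHS]invf_div lef_pV2 ?posrE ?expR_gt0 ?divr_gt0//.
apply: le_trans (expR_ge1Dx _); apply: (@le_trans _ _ (n.+1%:R ^+ 2 / c)); last by rewrite lerDr.
by rewrite ler_pM2r ?invr_gt0// expr2 ler_peMr// ler1n.
Unshelve. all: end_near. Qed.

Let integrable_xsin t th : mu.-integrable setT (fun x => (x * sin (t * x + th) * phi x)%:E).
Proof.
apply: (le_integrable _ _ _ integrable_normr_normal_pdf) => //.
    apply/measurable_EFinP/measurable_funM; last exact: measurable_normal_pdf.
    by apply: measurable_funM => //; apply: measurable_trig; exact: continuous_sin.
  move=> x _; rewrite /= lee_fin !normrM normr_id ler_wpM2r// ler_piMr//.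
  exact: sin_max.
Qed.

(** The derivative [dH] of [sin (t * x + th) * phi x] has integral zero over the line: over
    symmetric intervals the integral is a difference of boundary values, which vanish with the
    density, and dominated convergence extends this to the line. *)
Lemma normal_integration_by_parts (t th : R) :
  \int[mu]_x (x * sin (t * x + th) * phi x) =
  s ^+ 2 * t * \int[mu]_x (cos (t * x + th) * phi x).
Proof.
have ic : mu.-integrable setT (fun x => (cos (t * x + th) * phi x)%:E).
  apply: integrableM => //; first by apply: measurable_trig; exact: continuous_cos.
  by move=> x; exact: cos_max.
have is_ := integrable_xsin t th.
pose H x := sin (t * x + th) * phi x.
pose dH x := t * (cos (t * x + th) * phi x) - (s ^+ 2)^-1 * (x * sin (t * x + th) * phi x).
have dHP (x : R) : is_derive x 1 H (dH x).
  have := is_derive_phi x => ?.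
  by rewrite /H; apply: is_derive_eq; rewrite !scaler1 /dH /GRing.scale/=; field.
have cdH : continuous dH.
  move=> x; apply: cvgB; apply: cvgMr; apply: cvgM.
  - apply: continuous_comp; last exact: continuous_cos.
    by apply: cvgD; [apply: cvgMr; exact: cvg_id|exact: cvg_cst].
  - exact: continuous_normal_pdf.
  - apply: cvgM; first exact: cvg_id.
    apply: continuous_comp; last exact: continuous_sin.
    by apply: cvgD; [apply: cvgMr; exact: cvg_id|exact: cvg_cst].
  - exact: continuous_normal_pdf.
have idH : mu.-integrable setT (EFin \o dH).
  rewrite /comp /dH; under eq_fun do rewrite EFinB !EFinM.
  by apply: integrableB => //; apply: integrableZl.
have mdH : measurable_fun setT dH by exact: continuous_measurable_fun.
have E0 : (\int[mu]_x (dH x)%:E = 0)%E.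
  pose f_ n := (EFin \o dH) \_ `[- n.+1%:R, n.+1%:R]%classic.
  have D1 n : measurable_fun setT (f_ n).
    apply/(measurable_restrictT _ _).1 => //.
    by apply: measurable_funTS; apply/measurable_EFinP.
  have D2 : measurable_fun setT (EFin \o dH) by apply/measurable_EFinP.
  have D3 (x : measurableTypeR R) : setT x -> f_ ^~ x @ \oo --> (EFin \o dH) x.
    move=> _; apply: cvg_near_cst; near=> n.
    rewrite /f_ patchE mem_set//= in_itv/= -ler_norml.
    apply: le_trans (_ : n%:R <= _); last by rewrite ler_nat.
    by near: n; exact: nbhs_infty_ger.
  have D4 : mu.-integrable setT (abse \o (EFin \o dH)).
    by apply: integrable_abse.
  have D5 (x : measurableTypeR R) n : setT x -> (`|f_ n x| <= (abse \o (EFin \o dH)) x)%E.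
    move=> _; rewrite /f_ patchE; case: ifP => //= _.
    by rewrite normr0 lee_fin.
  have [_ _ C] := @dominated_convergence _ (measurableTypeR R) R mu setT measurableT f_
    (EFin \o dH) (abse \o (EFin \o dH)) D1 D2 (aeW mu D3) D4 (aeW mu D5).
  apply: (cvg_unique _ C) => //=.
  rewrite (_ : (fun n => _) = fun n => (H n.+1%:R - H (- n.+1%:R))%:E); last first.
    apply/funext => n; rewrite /f_ -integral_mkcond EFinB.
    apply: continuous_FTC2 => //.
    - by rewrite -subr_gt0 opprK addr_gt0.
    - exact: continuous_subspaceT.
    - split.
      + by move=> x _; case: (dHP x).
      + apply: cvg_at_right_filter; apply: differentiable_continuous.
        by apply/derivable1_diffP; case: (dHP (- n.+1%:R)).
      + apply: cvg_at_left_filter; apply: differentiable_continuous.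
        by apply/derivable1_diffP; case: (dHP n.+1%:R).
    - by move=> x _; rewrite derive1E; case: (dHP x).
  apply: cvg_EFin; first exact: nearW.
  have Hb a : a ^+ 2 = 1 -> H (a * n.+1%:R) @[n --> \oo] --> 0.
    move=> a2; apply: norm_cvg0.
    apply: (squeeze_cvgr _ (cvg_cst 0) (phi_cvg0 a2)); near=> n.
    rewrite normr_ge0/= /H normrM (ger0_norm (normal_pdf_ge0 _ _ _)).
    by rewrite ler_piMl ?normal_pdf_ge0// sin_max.
  rewrite -[X in _ --> X](subrr 0); apply: cvgB.
    by have := Hb 1 (expr1n _ _); under eq_fun do rewrite mul1r.
  have n1 : (- 1) ^+ 2 = 1 :> R by rewrite sqrrN expr1n.
  by have := Hb (-1) n1; under eq_fun do rewrite mulN1r.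
suff : t * \int[mu]_x (cos (t * x + th) * phi x) -
    (s ^+ 2)^-1 * \int[mu]_x (x * sin (t * x + th) * phi x) = 0.
  move/eqP; rewrite subr_eq0 => /eqP e.
  by rewrite -mulrA e mulVKf// sqrf_eq0.
rewrite -!RintegralZl// -RintegralB//.
- by rewrite /Rintegral -[LHS]/(fine (\int[mu]_x (dH x)%:E)) E0.
- by rewrite /comp; under eq_fun do rewrite EFinM; apply: integrableZl.
- by rewrite /comp; under eq_fun do rewrite EFinM; apply: integrableZl.
Unshelve. all: end_near. Qed.

(** Differentiation under the integral and integration by parts give [- s ^+ 2 * u * c u] as
    derivative of [c] at [u], so [expR ((s * u) ^+ 2 / 2) * c u] is constant. *)
Lemma normal_cf (t th : R) :
  \int[normal_prob 0 s]_x cos (t * x + th) = expR (- (s * t) ^+ 2 / 2) * cos th.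
Proof.
pose c t := \int[mu]_x (cos (t * x + th) * phi x).
have dc (u : R) : is_derive u 1 c (- (s ^+ 2 * u * c u)).
  pose f u x := cos (u * x + th) * phi x.
  have df (v x : R) : is_derive v 1 (f ^~ x) (- (x * sin (v * x + th) * phi x)).
    by rewrite /f; apply: is_derive_eq; rewrite !scaler1 /GRing.scale/=; ring.
  have intf v : mu.-integrable setT (EFin \o f v).
    apply: integrableM => //; first by apply: measurable_trig; exact: continuous_cos.
    by move=> x; exact: cos_max.
  have uI : u \in `]u - 1, u + 1[ by rewrite in_itv/= ltrBlDr ltrDl ltr01.
  have d1 v x : (partial1of2 f) v x = - (x * sin (v * x + th) * phi x).
    by rewrite partial1of2E; case: (df v x).
  have der v x : v \in `]u - 1, u + 1[ -> setT x -> derivable (f ^~ x) v 1.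
    by move=> _ _; case: (df v x).
  have bnd v x : v \in `]u - 1, u + 1[ -> setT x -> `|(partial1of2 f) v x| <= `|x| * phi x.
    move=> _ _; rewrite d1 normrN !normrM (ger0_norm (normal_pdf_ge0 _ _ _)).
    by rewrite ler_wpM2r ?normal_pdf_ge0// ler_piMr// sin_max.
  have ge0 x : 0 <= `|x| * phi x by rewrite mulr_ge0// normal_pdf_ge0.
  apply: DeriveDef.
    exact: (@derivable_under_integral _ _ _ mu f setT measurableT u (u - 1) (u + 1)
      uI (fun v _ => intf v) der _ ge0 integrable_normr_normal_pdf bnd).
  rewrite -derive1E (@differentiation_under_integral _ _ _ mu f setT measurableT u (u - 1) (u + 1)
      uI (fun v _ => intf v) der _ ge0 integrable_normr_normal_pdf bnd).
  rewrite -normal_integration_by_parts.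
  under eq_Rintegral do rewrite d1.
  rewrite -[RHS]mulN1r -RintegralZl//; last exact: integrable_xsin.
  by apply: eq_Rintegral => x _; rewrite mulN1r.
pose h (u : R) := expR ((s * u) ^+ 2 / 2) * c u.
have dh (u : R) : is_derive u 1 h 0.
  by have := dc u => ?; rewrite /h; apply: is_derive_eq; rewrite !scaler1 /GRing.scale/=; field.
have [r _] := mvt_segment dh 0 t.
rewrite mul0r => /eqP; rewrite subr_eq0 => /eqP.
rewrite /h mulr0 expr0n/= mul0r expR0 mul1r => ht.
have c0 : c 0 = cos th.
  rewrite /c; under eq_Rintegral do rewrite mul0r add0r.
  by rewrite RintegralZl// /Rintegral integral_normal_pdf mulr1.
transitivity (c t); last first.
  by rewrite -c0 -ht mulrA mulNr -expRD addNr expR0 mul1r.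
rewrite /Rintegral integral_normal_prob.
  by rewrite /c /Rintegral; congr fine; apply: eq_integral => x _; rewrite EFinM.
apply: measurable_bounded_integrable => //.
- by apply: le_lt_trans (probability_le1 (normal_prob 0 s) _) _; rewrite ?ltry.
- by apply: measurable_trig; exact: continuous_cos.
- exists 1; split => // M M1 x _; apply: le_trans (ltW M1); exact: cos_max.
Qed.

End normal_cf.

(** * Bernstein polynomials *)

Section borel_rV_measurability.
Variables (R : realType) (K : nat).

Lemma continuous_measurable_rV (f : 'rV[R]_K -> R) : continuous f ->
  measurable_fun [set: borel_rV R K] f.
Proof.
move=> /continuousP cf; apply: (measurability _ (RGenOInfty.measurableE R)) => //.
move=> _ [_ [r ->] <-]; rewrite setTI; apply: sub_gen_smallest.
by apply: cf; exact: interval_open.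
Qed.

Lemma continuous_coord_rV (k : 'I_K) : continuous (fun x : 'rV[R]_K => x 0 k).
Proof. by move=> x; apply: coord_continuous. Qed.

(** An explicit countable base. A rational point within [n.+1%:R^-1 < e / 2] of [x] in each
    coordinate gives a box that contains [x] and lies in the ball of radius [e]. Countability is
    what reduces measurability of a vector to that of its coordinates. *)
Lemma open_rV_boxes (U : set 'rV[R]_K) : open U ->
  U = \bigcup_(q in [set q : {ffun 'I_K -> rat} * nat |
      [set x : 'rV[R]_K | forall k, `|x 0 k - ratr (q.1 k)| < q.2.+1%:R^-1] `<=` U])
    [set x : 'rV[R]_K | forall k, `|x 0 k - ratr (q.1 k)| < q.2.+1%:R^-1].
Proof.
move=> oU; apply/seteqP; split => [x Ux|x [q /= qU xq]]; last exact: qU.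
have /nbhs_ballP[e /= e0 xeU] : nbhs x U by apply: open_nbhs_nbhs.
have [n ne] : exists n, n.+1%:R^-1 < e / 2.
  by have [n _ /(_ n (leqnn _))] := near_infty_natSinv_lt (PosNum (divr_gt0 e0 (ltr0n _ 2))); exists n.
have n0 : 0 < n.+1%:R^-1 :> R by rewrite invr_gt0.
have H k : exists q : rat, `|x 0 k - ratr q| < n.+1%:R^-1.
  have B0 : ball (x 0 k) n.+1%:R^-1 !=set0 by exists (x 0 k); exact: ballxx.
  have [y [/= xy [q _ qy]]] := dense_rat B0 (ball_open (x 0 k) n.+1%:R^-1).
  by exists q; rewrite qy.
have {H}[f Hf] := choice H.
exists ([ffun k => f k], n) => /=; last by move=> k; rewrite ffunE.
move=> y /= yq; apply: xeU; split => // i k; rewrite (ord1 i) /ball/=.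
have := yq k; rewrite ffunE; have := Hf k.
set a := x 0 k; set b := y 0 k; set c := ratr _ => h1 h2.
rewrite (_ : a - b = (a - c) - (b - c)); last by ring.
rewrite (le_lt_trans (ler_normB _ _))// (splitr e) ltrD// (lt_trans _ ne)//.
Qed.

Lemma measurable_rV d (T : measurableType d) (f : T -> borel_rV R K) :
  (forall k, measurable_fun setT (fun t => (f t : 'rV[R]_K) 0 k)) -> measurable_fun setT f.
Proof.
move=> mf; apply: (@measurability _ _ T (borel_rV R K) setT f (@open 'rV[R]_K) erefl) => _ [U oU <-]; rewrite setTI.
rewrite (open_rV_boxes oU) preimage_bigcup.
rewrite bigcup_mkcond; apply: countable_bigcupT_measurable => // q.
case: ifPn => _ //.
rewrite (_ : _ @^-1` _ = \bigcap_(k in setT) [set t | `|f t 0 k - ratr (q.1 k)| < q.2.+1%:R^-1]).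
  apply: fin_bigcap_measurable => // k _.
  have -> : [set t | `|f t 0 k - ratr (q.1 k)| < q.2.+1%:R^-1] =
      (fun t => f t 0 k) @^-1` ball (ratr (q.1 k) : R) q.2.+1%:R^-1.
    by apply/seteqP; split => t /=; rewrite /ball/= distrC.
  rewrite -[_ @^-1` _]setTI; apply: mf => //.
  exact: measurable_ball.
by apply/seteqP; split => [t H k _|t H k]; [exact: H|exact: H].
Qed.

End borel_rV_measurability.

(** * Bernstein approximation on the unit cube *)

Section bernstein.
Variable R : realType.

(* the expectation of h under the binomial law with parameters n and x *)
Fixpoint binom_mean (x : R) (n : nat) (h : nat -> R) : R :=
  if n is n'.+1 then x * binom_mean x n' (h \o succn) + (1 - x) * binom_mean x n' h
  else h 0%N.

Lemma binom_mean_ext x n h1 h2 : (forall j, (j <= n)%N -> h1 j = h2 j) ->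
  binom_mean x n h1 = binom_mean x n h2.
Proof.
elim: n h1 h2 => [|n IH] h1 h2 H /=; first exact: H.
by congr (_ * _ + _ * _); apply: IH => j jn; apply: H; rewrite ?ltnS// leqW.
Qed.

Lemma binom_meanD x n h1 h2 :
  binom_mean x n (fun j => h1 j + h2 j) = binom_mean x n h1 + binom_mean x n h2.
Proof. by elim: n h1 h2 => [|n IH] h1 h2 //=; rewrite /comp !IH; ring. Qed.

Lemma binom_meanZ x n c h :
  binom_mean x n (fun j => c * h j) = c * binom_mean x n h.
Proof. by elim: n h => [|n IH] h //=; rewrite /comp !IH; ring. Qed.

Lemma binom_mean_ge0 x n h : 0 <= x <= 1 -> (forall j, 0 <= h j) ->
  0 <= binom_mean x n h.
Proof.
move=> /andP[x0 x1]; elim: n h => [|n IH] h h0 //=.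
by rewrite addr_ge0// mulr_ge0 ?subr_ge0// IH// => j /=.
Qed.

Lemma binom_mean_cst x n c : binom_mean x n (fun=> c) = c.
Proof. by elim: n => [|n IH] //=; rewrite /comp !IH; ring. Qed.

Lemma binom_mean_id x n : binom_mean x n (fun j => j%:R) = n%:R * x.
Proof.
elim: n => [|n IH] /=; first by rewrite mul0r.
rewrite (@binom_mean_ext _ _ _ (fun j => 1 + j%:R)); last by move=> j _; rewrite /= -natr1 addrC.
by rewrite binom_meanD binom_mean_cst IH -natr1; ring.
Qed.

Lemma binom_mean_sqr x n :
  binom_mean x n (fun j => j%:R ^+ 2) = n%:R * x * (1 - x) + (n%:R * x) ^+ 2.
Proof.
elim: n => [|n IH] /=; first by ring.
rewrite (@binom_mean_ext _ _ _ (fun j => 1 + (2 * j%:R + j%:R ^+ 2))); last first.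
  by move=> j _; rewrite /= -natr1; ring.
by rewrite !(binom_meanD, binom_meanZ) binom_mean_cst IH binom_mean_id -natr1; ring.
Qed.

(** The binomial probability of [j], obtained as the mean of an indicator instead of from binomial
    coefficients. In this form, membership in an algebra of functions follows by induction on [n],
    as in [trig_poly_approx]. *)
Definition binom_weight (n j : nat) (x : R) : R := binom_mean x n (fun i => (i == j)%:R).

Lemma binom_weight_sum n x (h : nat -> R) :
  \sum_(j < n.+1) binom_weight n j x * h j = binom_mean x n h.
Proof.
transitivity (\sum_(j < n.+1) binom_mean x n (fun i => h j * (i == j :> nat)%:R)).
  by apply: eq_bigr => j _; rewrite binom_meanZ mulrC.
have -> (r : seq 'I_n.+1) : \sum_(j <- r) binom_mean x n (fun i => h j * (i == j :> nat)%:R) =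
   binom_mean x n (fun i => \sum_(j <- r) h j * (i == j :> nat)%:R).
  elim: r => [|j r IH].
    by rewrite big_nil -[LHS](binom_mean_cst x n); apply: binom_mean_ext => i _; rewrite big_nil.
  rewrite big_cons IH -binom_meanD; apply: binom_mean_ext => i _.
  by rewrite big_cons.
apply: binom_mean_ext => i iN.
rewrite (bigD1 (Ordinal (iN : (i < n.+1)%N)))//= eqxx mulr1 big1 ?addr0// => j.
by rewrite -val_eqE/= eq_sym => /negPf ->; rewrite mulr0.
Qed.

Lemma binom_weight_ge0 n j x : 0 <= x <= 1 -> 0 <= binom_weight n j x.
Proof. by move=> x01; apply: binom_mean_ge0. Qed.

Lemma binom_weight_var n x : (0 < n)%N -> 0 <= x <= 1 ->
  \sum_(j < n.+1) binom_weight n j x * (j%:R / n%:R - x) ^+ 2 <= n%:R^-1.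
Proof.
move=> n0 /andP[x0 x1]; have np : n%:R != 0 :> R by rewrite pnatr_eq0 -lt0n.
rewrite (binom_weight_sum n x (fun j => (j%:R / n%:R - x) ^+ 2)).
rewrite (@binom_mean_ext _ _ _ (fun j => n%:R^-2 * j%:R ^+ 2 +
    (- (2 * x / n%:R) * j%:R + x ^+ 2))); last by move=> j _; field.
rewrite !(binom_meanD, binom_meanZ) binom_mean_cst binom_mean_sqr binom_mean_id.
rewrite (_ : _ + _ = n%:R^-1 * (x * (1 - x))); last by field.
by rewrite ler_piMr// mulr_ile1// ?subr_ge0// gerBl.
Qed.

Variable K : nat.
Implicit Types (g : 'rV[R]_K -> R) (x : 'rV[R]_K).

Definition bernstein_node n (i : {ffun 'I_K -> 'I_n.+1}) : 'rV[R]_K :=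
  \row_k ((i k)%:R / n%:R).

Definition bernstein_weight n (i : {ffun 'I_K -> 'I_n.+1}) x : R :=
  \prod_k binom_weight n (i k) (x 0 k).

Definition bernstein n g x : R :=
  \sum_(i : {ffun 'I_K -> 'I_n.+1}) bernstein_weight i x * g (bernstein_node i).

Definition unit_cube : set 'rV[R]_K := [set x | forall k, 0 <= x 0 k <= 1].

Lemma bernstein_weight_ge0 n (i : {ffun 'I_K -> 'I_n.+1}) x :
  unit_cube x -> 0 <= bernstein_weight i x.
Proof. by move=> x01; apply: prodr_ge0 => k _; apply: binom_weight_ge0. Qed.

Lemma bernstein_weight_sum1 n x :
  \sum_(i : {ffun 'I_K -> 'I_n.+1}) bernstein_weight i x = 1.
Proof.
rewrite -(bigA_distr_bigA (fun k (j : 'I_n.+1) => binom_weight n j (x 0 k)))/=.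
rewrite big1// => k _; under eq_bigr do rewrite -[binom_weight _ _ _]mulr1.
by rewrite (binom_weight_sum n _ (fun=> 1)) binom_mean_cst.
Qed.

Lemma bernstein_weight_var n x (k : 'I_K) : (0 < n)%N -> unit_cube x ->
  \sum_(i : {ffun 'I_K -> 'I_n.+1})
     bernstein_weight i x * ((i k)%:R / n%:R - x 0 k) ^+ 2 <= n%:R^-1.
Proof.
move=> n0 x01.
pose F k' (j : 'I_n.+1) : R := binom_weight n j (x 0 k') *
  (if k' == k then (j%:R / n%:R - x 0 k) ^+ 2 else 1).
rewrite (eq_bigr (fun i : {ffun 'I_K -> 'I_n.+1} => \prod_k' F k' (i k'))); last first.
  move=> i _; rewrite /F big_split/=; congr (_ * _).
  by rewrite (bigD1 k)//= eqxx big1 ?mulr1// => k' /negPf ->.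
rewrite -bigA_distr_bigA (bigD1 k)//= [X in _ * X]big1 ?mulr1; last first.
  move=> k' /negPf k'k; rewrite /F k'k.
  by rewrite (binom_weight_sum n _ (fun=> 1)) binom_mean_cst.
by rewrite /F eqxx; apply: binom_weight_var.
Qed.

Lemma compact_unit_cube : compact unit_cube.
Proof.
rewrite (_ : unit_cube = [set v : 'rV[R]_K | forall i, `[0, 1]%classic (v 0 i)]).
  by apply: (@rV_compact R K (fun=> `[0, 1]%classic)) => _; exact: segment_compact.
by apply/seteqP; split => x /= H i; have := H i; rewrite in_itv.
Qed.

(** Compactness in the form of near coverings, applied to the filter of small positive [del]. *)
Lemma unif_continuous_cube g : continuous g ->
  forall e : R, 0 < e -> exists2 del : R, 0 < del & forall x (y : 'rV[R]_K), unit_cube x ->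
    (forall k, `|x 0 k - y 0 k| < del) -> `|g x - g y| < e.
Proof.
move=> cg e e0.
have /compact_near_coveringP := compact_unit_cube.
pose P (del : R) x := forall y : 'rV[R]_K, (forall k, `|x 0 k - y 0 k| < del) -> `|g x - g y| < e.
move=> /(_ _ (0^'+) P _)[]; last first.
  move=> del /= del0 H; exists (del / 2); first by rewrite divr_gt0.
  move=> x y x01 xy; apply: (H (del / 2)) => //.
    by rewrite /= sub0r normrN gtr0_norm ?divr_gt0// ltr_pdivrMr// mulr_natr mulr2n ltrDl.
  by rewrite /= divr_gt0.
move=> x _; have /cvgrPdist_lt/(_ _ (divr_gt0 e0 (ltr0n _ 2))) := cg x.
move=> /nbhs_ballP[r /= r0 xr].
exists (ball x (r / 2), [set del | del < r / 2]) => /=.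
  split; first by apply: nbhsx_ballx; rewrite divr_gt0.
  by exists (r / 2) => /=; rewrite ?divr_gt0// => del /=; rewrite sub0r normrN => /ltr_normlW.
move=> [x' del] /= [[_ xx'] dr] y x'y.
have h1 : `|g x - g x'| < e / 2.
  apply: xr; split => // i k; apply: le_ball (xx' i k).
  by rewrite ler_pdivrMr// mulr_natr mulr2n lerDl ltW.
have h2 : `|g x - g y| < e / 2.
  apply: xr; split => // i k; rewrite (splitr r); apply: ball_triangle (xx' i k) _.
  by rewrite (ord1 i); apply: lt_trans (x'y k) dr.
rewrite (_ : g x' - g y = (g x - g y) - (g x - g x')); last by ring.
by rewrite (le_lt_trans (ler_normB _ _))// (splitr e) ltrD.
Qed.

(** Bernstein's probabilistic argument. Nodes with all coordinates within [del] of [x] contribute at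
    most [e / 2]. For the others the trivial bound [2 * C] is multiplied by the sum of squared
    deviations over [del ^+ 2], which is at least 1 and whose weighted mean is at most
    [K%:R / (n%:R * del ^+ 2)]. *)
Lemma bernstein_approx g C : continuous g -> (forall x, `|g x| <= C) ->
  forall e : R, 0 < e -> exists n, forall x, unit_cube x -> `|bernstein n g x - g x| <= e.
Proof.
move=> cg gC e e0.
have [del d0 gdel] := unif_continuous_cube cg (divr_gt0 e0 (ltr0n _ 2)).
have C0 : 0 <= C by apply: le_trans (gC 0).
pose A : R := 2 * C / del ^+ 2 * K%:R.
have [n n0 nA] : exists2 n, (0 < n)%N & A * n%:R^-1 <= e / 2.
  have [n An] : exists n, A / (e / 2) < n%:R.
    by exists (Num.truncn (A / (e / 2))).+1; exact: truncnS_gt.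
  exists n.+1 => //; rewrite ler_pdivrMr// -ler_pdivrMl ?divr_gt0// mulrC.
  by rewrite (le_trans (ltW An))// ler_nat.
exists n => x x01.
have -> : bernstein n g x - g x = \sum_(i : {ffun 'I_K -> 'I_n.+1})
    bernstein_weight i x * (g (bernstein_node i) - g x).
  rewrite /bernstein -[in LHS](mul1r (g x)) -(bernstein_weight_sum1 n x) mulr_suml -sumrB.
  by apply: eq_bigr => i _; rewrite mulrBr.
apply: le_trans (ler_norm_sum _ _ _) _.
apply: (@le_trans _ _ (\sum_(i : {ffun 'I_K -> 'I_n.+1}) (bernstein_weight i x * (e / 2) +
   2 * C / del ^+ 2 * \sum_k bernstein_weight i x * ((i k)%:R / n%:R - x 0 k) ^+ 2))).
  apply: ler_sum => i _; have w0 := bernstein_weight_ge0 i x01.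
  rewrite normrM (ger0_norm w0) -mulr_sumr [2 * _ / _ * (_ * _)]mulrCA -mulrDr ler_wpM2l//.
  have [H|] := pselect (forall k, `|x 0 k - bernstein_node i 0 k| < del).
    rewrite distrC (le_trans (ltW (gdel _ _ x01 H)))// lerDl.
    by rewrite !mulr_ge0 ?invr_ge0 ?exprn_ge0 ?(ltW d0)//; apply: sumr_ge0 => k _; rewrite sqr_ge0.
  move=> /existsNP[k /negP]; rewrite -leNgt /bernstein_node mxE distrC => dk.
  rewrite (@le_trans _ _ (2 * C))//.
    by rewrite (le_trans (ler_normB _ _))// mulrDl mul1r lerD.
  rewrite -[leLHS]add0r lerD// ?divr_ge0 ?(ltW e0)// mulrAC -mulrA.
  rewrite ler_peMr ?mulr_ge0//.
  rewrite ler_pdivlMr ?exprn_gt0// mul1r (bigD1 k)//=.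
  rewrite (@le_trans _ _ (((i k)%:R / n%:R - x 0 k) ^+ 2))//.
    by rewrite -[leRHS]real_normK ?num_real// ler_sqr ?nnegrE// ltW.
  by rewrite lerDl; apply: sumr_ge0 => k' _; rewrite sqr_ge0.
rewrite big_split/= -mulr_suml bernstein_weight_sum1 mul1r -mulr_sumr exchange_big/=.
rewrite [leRHS]splitr lerD2l (le_trans _ nA)// /A -!mulrA.
rewrite !ler_wpM2l ?invr_ge0 ?exprn_ge0 ?(ltW d0)//.
apply: le_trans (ler_sum _ (fun k _ => bernstein_weight_var k n0 x01)) _.
by rewrite sumr_const card_ord mulr_natl.
Qed.

End bernstein.

(** * Levy's continuity theorem *)

Section continuous_algebra.
Variables (T : topologicalType) (R : realType).
Implicit Types f g : T -> R.

Lemma continuous_addf f g : continuous f -> continuous g -> continuous (fun x => f x + g x).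
Proof. by move=> cf cg x; apply: cvgD; [exact: cf|exact: cg]. Qed.

Lemma continuous_mulf f g : continuous f -> continuous g -> continuous (fun x => f x * g x).
Proof. by move=> cf cg x; apply: cvgM; [exact: cf|exact: cg]. Qed.

Lemma continuous_normf f : continuous f -> continuous (fun x => `|f x|).
Proof. by move=> cf x; apply: cvg_norm; exact: cf. Qed.

Lemma continuous_maxf f g : continuous f -> continuous g ->
  continuous (fun x => Num.max (f x) (g x)).
Proof.
move=> cf cg; rewrite (_ : (fun _ => _) = fun x => 2^-1 * (f x + g x + `|f x + (-1) * g x|)).
  apply: continuous_mulf; first by move=> x; exact: cvg_cst.
  apply: continuous_addf; first exact: continuous_addf.
  apply: continuous_normf; apply: continuous_addf => //.
  by apply: continuous_mulf => //; move=> x; exact: cvg_cst.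
by apply/funext => x; rewrite maxr_absE mulN1r mulrC.
Qed.

Lemma continuous_minf f g : continuous f -> continuous g ->
  continuous (fun x => Num.min (f x) (g x)).
Proof.
move=> cf cg; rewrite (_ : (fun _ => _) = fun x => f x + g x + (-1) * Num.max (f x) (g x)).
  apply: continuous_addf; first exact: continuous_addf.
  by apply: continuous_mulf; [move=> x; exact: cvg_cst|exact: continuous_maxf].
by apply/funext => x; rewrite mulN1r -(addr_max_min (f x)) addrAC subrr add0r.
Qed.

Lemma continuous_sumf (I : Type) (r : seq I) (F : I -> T -> R) :
  (forall i, continuous (F i)) -> continuous (fun x => \sum_(i <- r) F i x).
Proof.
move=> cF; elim: r => [|i r IH].
  rewrite (_ : (fun _ => _) = cst 0); first by move=> x; exact: cvg_cst.
  by apply/funext => x; rewrite big_nil.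
rewrite (_ : (fun _ => _) = fun x => F i x + \sum_(j <- r) F j x).
  exact: continuous_addf.
by apply/funext => x; rewrite big_cons.
Qed.

End continuous_algebra.

Lemma continuous_row (T : topologicalType) (R : realType) (K : nat) (F : 'I_K -> T -> R) :
  (forall k, continuous (F k)) -> continuous (fun x => \row_k F k x : 'rV[R]_K).
Proof.
move=> cF x; apply/cvg_ballP => e e0.
have H k : \forall y \near x, ball (F k x) e (F k y).
  by have /cvg_ballP/(_ _ e0) := cF k x.
have /filter_forall Hall := H.
by apply: filterS Hall => y Hy; split => // i k; rewrite !mxE.
Qed.

Section bounded_integrals.
Variables (R : realType) (d : measure_display) (T : measurableType d).
Variable mu : probability T R.

Lemma bounded_integrable (f : T -> R) (C : R) : measurable_fun setT f ->
  (forall x, `|f x| <= C) -> mu.-integrable setT (EFin \o f).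
Proof.
move=> mf fC; apply: measurable_bounded_integrable => //.
  by apply: le_lt_trans (probability_le1 mu _) _; rewrite ?ltry.
by exists C; split; [exact: num_real|move=> M CM x _; exact: le_trans (fC x) (ltW CM)].
Qed.

Lemma Rintegral_cst_prob (c : R) : \int[mu]_x c = c.
Proof. by rewrite Rintegral_cst// [X in fine X](probability_setT mu) mulr1. Qed.

Lemma integral_EFin_Rintegral (f : T -> R) : mu.-integrable setT (EFin \o f) ->
  (\int[mu]_x (f x)%:E = (\int[mu]_x f x)%:E)%E.
Proof. by move=> fi; rewrite /Rintegral fineK//; exact: integrable_fin_num fi. Qed.

Lemma Rintegral_close (f g : T -> R) (C e : R) (A : set T) :
  measurable_fun setT f -> measurable_fun setT g -> measurable A ->
  (forall x, `|f x| <= C) -> (forall x, `|g x| <= C) ->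
  (forall x, ~ A x -> `|f x - g x| <= e) -> 0 <= e ->
  `|\int[mu]_x f x - \int[mu]_x g x| <= e + 2 * C * fine (mu A).
Proof.
move=> mf mg mA fC gC fg e0.
have C0 : 0 <= C by apply: le_trans (fC point).
have fi := bounded_integrable mf fC; have gi := bounded_integrable mg gC.
rewrite -RintegralB//.
have mfg : measurable_fun setT (fun x => f x - g x) by exact: measurable_funB.
have fgi : mu.-integrable setT (EFin \o (fun x => f x - g x)).
  apply: (@bounded_integrable _ (C + C)) => // x.
  by rewrite (le_trans (ler_normB _ _))// lerD.
apply: le_trans (le_normr_Rintegral _ _) _ => //.
have mi : measurable_fun setT (\1_A : T -> R) by exact: measurable_indic.
have bi x : `|\1_A x| <= 1 :> R by rewrite indicE; case: (_ \in _); rewrite ?normr1 ?normr0.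
have ii := bounded_integrable mi bi.
have ici : mu.-integrable setT (EFin \o (fun=> e)).
  by apply: (@bounded_integrable _ `|e|).
have izi : mu.-integrable setT (EFin \o (fun x => 2 * C * \1_A x)).
  apply: (@bounded_integrable _ (2 * C)); first exact: measurable_funM.
  by move=> x; rewrite normrM ger0_norm ?mulr_ge0// ler_piMr// mulr_ge0.
have -> : e + 2 * C * fine (mu A) = \int[mu]_x (e + 2 * C * \1_A x).
  rewrite RintegralD// RintegralZl// Rintegral_cst_prob; congr (_ + _ * _).
  by rewrite /Rintegral integral_indic// setIT.
apply: le_Rintegral => //.
- apply: (@bounded_integrable _ (C + C)); first exact: measurableT_comp.
  by move=> x; rewrite normr_id (le_trans (ler_normB _ _))// lerD.
- apply: (@bounded_integrable _ (e + 2 * C)).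
    by apply: measurable_funD => //; exact: measurable_funM.
  move=> x; rewrite (le_trans (ler_normD _ _))// (ger0_norm e0) lerD2l.
  by rewrite normrM ger0_norm ?mulr_ge0// ler_piMr// mulr_ge0.
move=> x _; rewrite indicE; case: (boolP (x \in A)) => [xA|].
  rewrite mulr1 -[leLHS]add0r lerD// mulrDl mul1r.
  by rewrite (le_trans (ler_normB _ _))// lerD.
by rewrite notin_setE => /fg; rewrite mulr0 addr0.
Qed.

End bounded_integrals.

Section trigonometric_polynomials.
Variables (R : realType) (K : nat).
Implicit Types (x : 'rV[R]_K) (f g : 'rV[R]_K -> R).

(** The three components are a common denominator, integer frequencies and a number of quarter
    turns, which make sines available as cosines. Their type is countable, so all phases can be
    enumerated by [phase_of]. *)
Definition phase (q : nat * {ffun 'I_K -> int} * int) x : R :=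
  (\sum_k (q.1.2 k)%:~R * x 0 k) / q.1.1%:R + q.2%:~R * (pi / 2).

Definition trig_poly (j : nat) f := exists s : seq (R * ({ffun 'I_K -> int} * int)),
  forall x, f x = \sum_(p <- s) p.1 * cos (phase (j, p.2.1, p.2.2) x).

Lemma trig_poly_ext j f g : (forall x, f x = g x) -> trig_poly j f -> trig_poly j g.
Proof. by move=> fg [s fs]; exists s => x; rewrite -fg. Qed.

Lemma trig_polyD j f g : trig_poly j f -> trig_poly j g ->
  trig_poly j (fun x => f x + g x).
Proof. by move=> [s fs] [t gt]; exists (s ++ t) => x; rewrite big_cat fs gt. Qed.

Lemma trig_polyZ j c f : trig_poly j f -> trig_poly j (fun x => c * f x).
Proof.
move=> [s fs]; exists [seq (c * p.1, p.2) | p <- s] => x.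
by rewrite big_map fs mulr_sumr; apply: eq_bigr => p _; rewrite mulrA.
Qed.

Lemma trig_poly_cst j c : trig_poly j (fun=> c).
Proof.
exists [:: (c, ([ffun=> 0], 0))] => x; rewrite big_seq1 /phase/= big1 ?mul0r ?addr0 ?cos0 ?mulr1//.
by move=> k _; rewrite ffunE mul0r.
Qed.

(** The product formula for cosines: frequencies are added and subtracted, and so stay integers over
    the common denominator [j]. *)
Lemma trig_polyM j f g : trig_poly j f -> trig_poly j g ->
  trig_poly j (fun x => f x * g x).
Proof.
move=> [s fs] [t gt].
pose ad (u v : {ffun 'I_K -> int} * int) := ([ffun k => u.1 k + v.1 k], u.2 + v.2).
pose su (u v : {ffun 'I_K -> int} * int) := ([ffun k => u.1 k - v.1 k], u.2 - v.2).
exists ([seq (p.1 * q.1 / 2, ad p.2 q.2) | p <- s, q <- t] ++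
        [seq (p.1 * q.1 / 2, su p.2 q.2) | p <- s, q <- t]) => x.
rewrite big_cat !big_allpairs_dep/= fs gt mulr_suml -big_split/=.
apply: eq_bigr => p _; rewrite mulr_sumr -big_split/=; apply: eq_bigr => q _.
have -> : phase (j, (ad p.2 q.2).1, (ad p.2 q.2).2) x =
    phase (j, p.2.1, p.2.2) x + phase (j, q.2.1, q.2.2) x.
  rewrite /phase/= intrD (_ : \sum_k _ = \sum_k (p.2.1 k)%:~R * x 0 k + \sum_k (q.2.1 k)%:~R * x 0 k).
    by ring.
  by rewrite -big_split; apply: eq_bigr => k _; rewrite ffunE intrD mulrDl.
have -> : phase (j, (su p.2 q.2).1, (su p.2 q.2).2) x =
    phase (j, p.2.1, p.2.2) x - phase (j, q.2.1, q.2.2) x.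
  rewrite /phase/= intrB (_ : \sum_k _ = \sum_k (p.2.1 k)%:~R * x 0 k - \sum_k (q.2.1 k)%:~R * x 0 k).
    by ring.
  by rewrite -sumrB; apply: eq_bigr => k _; rewrite ffunE intrB mulrBl.
by rewrite cosD cosB; field.
Qed.

Lemma trig_poly_sin j k : trig_poly j (fun x => sin (x 0 k / j%:R)).
Proof.
exists [:: (1, ([ffun k' => (k' == k)%:Z], - 1))] => x.
rewrite big_seq1 /phase/= mul1r mulN1r cosB cos_pihalf mulr0 add0r sin_pihalf mulr1.
congr (sin (_ / _)); rewrite (bigD1 k)//= ffunE eqxx mul1r big1 ?addr0// => k' /negPf k'k.
by rewrite ffunE k'k mul0r.
Qed.

Lemma trig_poly_sum j (I : Type) (r : seq I) (F : I -> 'rV[R]_K -> R) :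
  (forall i, trig_poly j (F i)) -> trig_poly j (fun x => \sum_(i <- r) F i x).
Proof.
move=> H; elim: r => [|i r IH].
  by apply: trig_poly_ext (trig_poly_cst j 0) => x; rewrite big_nil.
by apply: trig_poly_ext (trig_polyD (H i) IH) => x; rewrite big_cons.
Qed.

Lemma trig_poly_prod j (I : Type) (r : seq I) (F : I -> 'rV[R]_K -> R) :
  (forall i, trig_poly j (F i)) -> trig_poly j (fun x => \prod_(i <- r) F i x).
Proof.
move=> H; elim: r => [|i r IH].
  by apply: trig_poly_ext (trig_poly_cst j 1) => x; rewrite big_nil.
by apply: trig_poly_ext (trig_polyM (H i) IH) => x; rewrite big_cons.
Qed.

Lemma continuous_phase q : continuous (phase q).
Proof.
apply: continuous_addf; last exact: cst_continuous.
rewrite (_ : (fun _ => _) = fun x => q.1.1%:R^-1 * \sum_k (q.1.2 k)%:~R * x 0 k).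
  apply: continuous_mulf; first exact: cst_continuous.
  apply: continuous_sumf => k; apply: continuous_mulf; first exact: cst_continuous.
  exact: continuous_coord_rV.
by apply/funext => x; rewrite mulrC.
Qed.

Lemma continuous_cos_phase q : continuous (fun x => cos (phase q x)).
Proof.
move=> x; apply: continuous_comp; first exact: continuous_phase.
exact: continuous_cos.
Qed.

Lemma trig_poly_continuous j f : trig_poly j f -> continuous f.
Proof.
move=> [s fs]; have -> := funext fs; apply: continuous_sumf => p.
by apply: continuous_mulf; [exact: cst_continuous|exact: continuous_cos_phase].
Qed.

Lemma integrable_cos_phase (mu : probability (borel_rV R K) R) q :
  mu.-integrable setT (EFin \o (fun x => cos (phase q x))).
Proof.
apply: (@bounded_integrable _ _ _ _ _ 1).
  by apply: continuous_measurable_rV; exact: continuous_cos_phase.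
by move=> x; exact: cos_max.
Qed.

Lemma trig_poly_Rintegral_cvg j f (mu_ : nat -> probability (borel_rV R K) R)
    (N : probability (borel_rV R K) R) :
  (forall q, \int[mu_ i]_x cos (phase q x) @[i --> \oo] --> \int[N]_x cos (phase q x)) ->
  trig_poly j f -> \int[mu_ i]_x f x @[i --> \oo] --> \int[N]_x f x.
Proof.
move=> H [s fs]; have -> := funext fs.
suff E (mu : probability (borel_rV R K) R) :
    mu.-integrable setT (EFin \o (fun x => \sum_(p <- s) p.1 * cos (phase (j, p.2.1, p.2.2) x))) /\
    \int[mu]_x (\sum_(p <- s) p.1 * cos (phase (j, p.2.1, p.2.2) x)) =
    \sum_(p <- s) p.1 * \int[mu]_x cos (phase (j, p.2.1, p.2.2) x).
  rewrite (E N).2; under eq_fun do rewrite (E _).2.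
  elim: (s) => [|p r IH].
    rewrite big_nil (_ : (fun i => _) = cst 0); first exact: cvg_cst.
    by apply/funext => i; rewrite big_nil.
  rewrite big_cons (_ : (fun i => _) = fun i =>
      p.1 * \int[mu_ i]_x cos (phase (j, p.2.1, p.2.2) x) +
      \sum_(p <- r) p.1 * \int[mu_ i]_x cos (phase (j, p.2.1, p.2.2) x)).
    by apply: cvgD IH; apply: cvgMr; exact: H.
  by apply/funext => i; rewrite big_cons.
have iZ c q : mu.-integrable setT (EFin \o (fun x => c * cos (phase q x))).
  by rewrite /comp; under eq_fun do rewrite EFinM; apply: integrableZl => //; exact: integrable_cos_phase.
elim: (s) => [|p r [IH1 IH2]].
  under eq_fun do rewrite big_nil; split.
    by apply: (@bounded_integrable _ _ _ _ _ 0) => // x; rewrite normr0.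
  by rewrite big_nil Rintegral_cst_prob.
under eq_fun do rewrite big_cons; split.
  by rewrite /comp; under eq_fun do rewrite EFinD; apply: integrableD => //; exact: iZ.
rewrite (RintegralD measurableT (iZ _ _) IH1).
by rewrite big_cons IH2 RintegralZl//; exact: integrable_cos_phase.
Qed.

End trigonometric_polynomials.

Section levy.
Variables (R : realType) (K : nat).
Implicit Types (x : 'rV[R]_K).

Definition box_tail (j : nat) : set (borel_rV R K) :=
  [set x : 'rV[R]_K | exists k, j%:R < `|x 0 k|].

Lemma measurable_box_tail j : measurable (box_tail j).
Proof.
rewrite (_ : box_tail j = \bigcup_(k in setT) [set x : 'rV[R]_K | j%:R < `|x 0 k|]); last first.
  by apply/seteqP; split => [x [k xk]|x [k _ xk]]; exists k.
apply: fin_bigcup_measurable => // k _.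
have := @continuous_measurable_rV R K (fun x => `|x 0 k|).
have cn : continuous (fun x => `|x 0 k|).
  move=> x; apply: continuous_comp; first exact: continuous_coord_rV.
  exact: norm_continuous.
move=> /(_ cn measurableT `]j%:R, +oo[%classic (measurable_itv _)).
by rewrite setTI; congr measurable; apply/seteqP; split => x /=; rewrite in_itv/= andbT.
Qed.

Lemma box_tail_decr i j : (i <= j)%N -> box_tail j `<=` box_tail i.
Proof. by move=> ij x [k xk]; exists k; rewrite (le_lt_trans _ xk)// ler_nat. Qed.

Lemma box_tail_cvg0 (N : probability (borel_rV R K) R) (e : R) : 0 < e ->
  exists j, fine (N (box_tail j)) <= e.
Proof.
move=> e0.
have B0 : \bigcap_j box_tail j = set0.
  apply/seteqP; split => // x H.
  pose M := \sum_k `|(x : 'rV[R]_K) 0 k|.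
  have [k] := H (Num.truncn M).+1 I.
  apply/negP; rewrite -leNgt (@le_trans _ _ M)//; last exact/ltW/truncnS_gt.
  by rewrite /M (bigD1 k)//= lerDl; apply: sumr_ge0.
have H0 : (N (box_tail 0) < +oo)%E.
  by apply: le_lt_trans (probability_le1 N (measurable_box_tail 0)) _; rewrite ltry.
have := nonincreasing_cvg_mu H0 measurable_box_tail _ _.
rewrite B0 measure0 => /(_ measurable0 (fun i j ij => introT (subsetPset _ _) (box_tail_decr ij))).
move=> /fine_cvgP[_ /cvgrPdist_le/(_ _ e0)[j _ /(_ j (leqnn _))]].
rewrite /= sub0r normrN => h; exists j; exact: le_trans (ler_norm _) h.
Qed.

(* sin (x_k / (2 j)) determines x_k on the box |x_k| <= j, where f is therefore
   a continuous function of these sines; its Bernstein polynomials are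
   trigonometric polynomials in x that keep the bound of f on the whole space. *)
Lemma trig_poly_approx (f : 'rV[R]_K -> R) (C : R) (j : nat) (e : R) : (0 < j)%N ->
  continuous f -> (forall x, `|f x| <= C) -> 0 < e ->
  exists2 p, trig_poly (2 * j)%N p & (forall x, `|p x| <= C) /\
    forall x, ~ box_tail j x -> `|p x - f x| <= e.
Proof.
move=> j0 cf fC e0.
have h1 := pihalf_ge1 R.
have itv1 (y : R) : - 1 <= y <= 1 -> y \in `[- (pi / 2), pi / 2].
  by rewrite in_itv/= => /andP[a b]; apply/andP; split; lra.
have itvp : pi / 2 \in `[- (pi / 2), (pi / 2 : R)] by rewrite in_itv/=; apply/andP; split; lra.
have s1 : 0 < sin (2^-1 : R) < 1.
  have a : sin 0 < sin (2^-1 : R) by rewrite ltr_sin ?itv1//; lra.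
  have b : sin (2^-1 : R) < sin (pi / 2) by rewrite ltr_sin ?itvp ?itv1//; lra.
  by rewrite sin0 in a; rewrite sin_pihalf in b; rewrite a b.
(* On the box the sines are at most [sin 2^-1] in absolute value, because [x 0 k / (2 * j)%N%:R] is
   at most 1/2 there. Clamping at this level keeps the argument of [asin] strictly between -1 and 1,
   where [asin] is continuous, and changes nothing on the box. *)
pose cl (y : R) := Num.min (Num.max y (- sin 2^-1)) (sin 2^-1).
have clb y : - 1 < cl y < 1.
  have /andP[a b] := s1; rewrite /cl gt_min lt_min lt_max b orbT andbT.
  by apply/andP; split; [apply/orP; right; lra|lra].
pose inv (s : R) := (2 * j)%N%:R * asin (cl (2 * s - 1)).
have cinv : continuous inv.
  apply: continuous_mulf; first exact: cst_continuous.
  move=> s; apply: continuous_comp; last exact: continuous_asin.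
  apply: (@continuous_minf R R (fun s => Num.max (2 * s - 1) (- sin 2^-1)) (cst (sin 2^-1))); last exact: cst_continuous.
  apply: continuous_maxf; last exact: cst_continuous.
  apply: continuous_addf; last exact: cst_continuous.
  by apply: continuous_mulf; [exact: cst_continuous|move=> ?; exact: cvg_id].
pose g (s : 'rV[R]_K) : R := f (\row_k inv (s 0 k)).
have cg : continuous g.
  move=> s; apply: (@continuous_comp _ _ _ (fun s : 'rV[R]_K => \row_k inv (s 0 k)) f); last exact: cf.
  apply: (@continuous_row _ _ _ (fun k (s : 'rV[R]_K) => inv (s 0 k))) => k {}s.
  apply: (@continuous_comp _ _ _ (fun s : 'rV[R]_K => s 0 k) inv); last exact: cinv.
  exact: continuous_coord_rV.
have gC s : `|g s| <= C by exact: fC.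
have [n Hn] := bernstein_approx cg gC e0.
pose S (x : 'rV[R]_K) : 'rV[R]_K := \row_k ((1 + sin (x 0 k / (2 * j)%N%:R)) / 2).
have S01 x : unit_cube (S x).
  by move=> k; rewrite mxE; have := sin_geN1 (x 0 k / (2 * j)%N%:R); have := sin_le1 (x 0 k / (2 * j)%N%:R); lra.
exists (fun x => bernstein n g (S x)).
  apply: trig_poly_sum => i; apply: trig_polyM; last exact: trig_poly_cst.
  apply: trig_poly_prod => k; rewrite /binom_weight.
  (* The indicator is generalized because the recursion of [binom_mean] modifies it. *)
  move: (fun i0 : nat => _) => h.
  elim: n {i Hn} h => [|n IH] h /=; first exact: trig_poly_cst.
  have tS : trig_poly (2 * j)%N (fun x => S x 0 k).
    have t := trig_polyZ 2^-1 (trig_polyD (trig_poly_cst _ _ 1) (trig_poly_sin R (2 * j)%N k)).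
    by apply: (trig_poly_ext _ t) => x; rewrite mxE mulrC.
  apply: trig_polyD; apply: trig_polyM => //.
  apply: (trig_poly_ext _ (trig_polyD (trig_poly_cst _ _ 1) (trig_polyZ (-1) tS))) => x.
  by rewrite mulN1r.
split=> x.
  rewrite -[leRHS]mul1r -(bernstein_weight_sum1 n (S x)) mulr_suml.
  apply: le_trans (ler_norm_sum _ _ _) _; apply: ler_sum => i _.
  have w0 := bernstein_weight_ge0 i (S01 x).
  by rewrite normrM (ger0_norm w0) ler_wpM2l.
move=> xt; have <- : g (S x) = f x; last exact: Hn.
congr f; apply/rowP => k; rewrite !mxE /inv.
have xk : `|x 0 k| <= j%:R by rewrite leNgt; apply/negP => xk; apply: xt; exists k.
have jp : 0 < j%:R :> R by rewrite ltr0n.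
pose y := x 0 k / (2 * j)%N%:R.
have yb : - 2^-1 <= y <= 2^-1.
  rewrite -ler_norml /y normrM normfV (ger0_norm (ler0n _ _)) natrM.
  by rewrite ler_pdivrMr ?mulr_gt0// mulrA mulVf ?mul1r.
have -> : 2 * ((1 + sin (x 0 k / (2 * j)%N%:R)) / 2) - 1 = sin y by rewrite /y; field.
have -> : cl (sin y) = sin y.
  have /andP[y1 y2] := yb.
  have a1 : sin y <= sin 2^-1 by rewrite leNgt ltr_sin ?itv1 -?leNgt//; apply/andP; split; lra.
  have a2 : - sin 2^-1 <= sin y by rewrite -sinN leNgt ltr_sin ?itv1 -?leNgt//; apply/andP; split; lra.
  by rewrite /cl (max_l a2) (min_l a1).
rewrite sinK; first by rewrite /y mulrC divfK// natrM mulf_neq0// ?gt_eqF.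
by have /andP[y1 y2] := yb; apply: itv1; apply/andP; split; lra.
Qed.

(** Tightness is a hypothesis, so no behaviour of the characteristic functions near 0 has to be
    analysed. The approximating trigonometric polynomial obeys the bound [C] everywhere; hence under
    any law its integral differs from that of [f] by at most the error on the box plus [2 * C] times
    the tail. *)
Lemma levy_continuity (mu_ : nat -> probability (borel_rV R K) R)
    (N : probability (borel_rV R K) R) :
  (forall q, \int[mu_ i]_x cos (phase q x) @[i --> \oo] --> \int[N]_x cos (phase q x)) ->
  (forall e : R, 0 < e -> exists j, \forall i \near \oo, fine (mu_ i (box_tail j)) <= e) ->
  weakly_converges mu_ N.
Proof.
move=> Hcos Htail f cf [C fC].
have mf : measurable_fun [set: borel_rV R K] f by exact: continuous_measurable_rV.
have fi (mu : probability (borel_rV R K) R) := bounded_integrable mu mf fC.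
under eq_fun do rewrite integral_EFin_Rintegral//; rewrite integral_EFin_Rintegral//.
apply: cvg_EFin; first exact: nearW.
have C0 : 0 <= C by apply: le_trans (fC 0).
apply/cvgrPdist_le => e e0; rewrite /comp/=.
(* Two replacements of [f] by [p], each costing [e' + 2 * C * e'], and one comparison of the
   integrals of [p], costing [e'], add up to [e]. *)
pose e' := e / (3 + 4 * C).
have D0 : 0 < 3 + 4 * C by rewrite ltr_wpDr ?mulr_ge0.
have e'0 : 0 < e' by rewrite divr_gt0.
have [j1 Hj1] := Htail _ e'0; have [j2 Hj2] := box_tail_cvg0 N e'0.
pose j := (maxn j1 j2).+1.
have tail_le (mu : probability (borel_rV R K) R) i : (i <= j)%N ->
    fine (mu (box_tail i)) <= e' -> fine (mu (box_tail j)) <= e'.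
  move=> ij; apply: le_trans; rewrite fine_le ?fin_num_measure//.
  - exact: measurable_box_tail.
  - exact: measurable_box_tail.
  - by apply: le_measure; rewrite ?inE; [exact: measurable_box_tail..|exact: box_tail_decr].
have [p tp [pC pf]] := @trig_poly_approx f C j e' isT cf fC e'0.
have mp : measurable_fun [set: borel_rV R K] p.
  apply: continuous_measurable_rV; exact: (trig_poly_continuous tp).
have close (mu : probability (borel_rV R K) R) : fine (mu (box_tail j)) <= e' ->
    `|\int[mu]_x p x - \int[mu]_x f x| <= e' + 2 * C * e'.
  move=> mue; apply: le_trans (Rintegral_close mu mp mf (measurable_box_tail j) pC fC pf (ltW e'0)) _.
  by rewrite lerD2l ler_wpM2l ?mulr_ge0.
have cN := close N (tail_le N j2 (leqW (leq_maxr _ _)) Hj2).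
have /cvgrPdist_le/(_ _ e'0) Hp := trig_poly_Rintegral_cvg Hcos tp.
near=> i.
have ci : `|\int[mu_ i]_x p x - \int[mu_ i]_x f x| <= e' + 2 * C * e'.
  apply: close; apply: (@tail_le _ j1); first by rewrite leqW// leq_maxl.
  by near: i.
have hp : `|\int[N]_x p x - \int[mu_ i]_x p x| <= e' by near: i.
have -> : e = (e' + 2 * C * e') + e' + (e' + 2 * C * e') by rewrite /e'; field; rewrite gt_eqF.
move: cN ci hp; rewrite !ler_norml; lra.
Unshelve. all: end_near. Qed.

End levy.

(** * Neighbourhoods in a metric for weak convergence *)

Section pushforward.
Variables (R : realType) (d d' : measure_display).
Variables (T : measurableType d) (T' : measurableType d').

Lemma pushforward_probability (P : probability T R) (f : T -> T') :
  measurable_fun setT f ->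
  exists2 Q : probability T' R, (forall A, Q A = P (f @^-1` A)) &
    forall (g : T' -> R) C, measurable_fun setT g -> (forall x, `|g x| <= C) ->
      \int[Q]_x g x = \int[P]_x g (f x).
Proof.
move=> mf; pose X : {mfun T >-> T'} := HB.pack f (isMeasurableFun.Build _ _ _ _ f mf).
exists (distribution P X) => // g C mg gC.
rewrite /Rintegral; congr fine.
rewrite (@integral_pushforward _ _ _ _ _ X _ P setT (fun x => (g x)%:E))//.
- exact/measurable_EFinP.
- apply: (@bounded_integrable _ _ _ _ (g \o f) C) => //.
    exact: measurableT_comp.
  by move=> x; exact: gC.
Qed.

End pushforward.

Section metrization.
Variables (R : realType) (K : nat).
Variable rho : probability (borel_rV R K) R -> probability (borel_rV R K) R -> R.
Hypothesis hrho : metrizes_weak_convergence rho.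

Definition phase_of (i : nat) : nat * {ffun 'I_K -> int} * int :=
  odflt (0%N, [ffun=> 0], 0) (unpickle i).

(* Weak convergence to N only involves countably many cosines and tails: if no r
   worked, a counterexample for each r would give a sequence converging weakly to
   N, by Levy's continuity theorem, while staying at distance eps from N. *)
Lemma rho_ball (N : probability (borel_rV R K) R) (tl : nat -> R) (eps : R) :
  (forall e, 0 < e -> exists j, tl j <= e) -> 0 < eps ->
  exists r : nat, forall mu : probability (borel_rV R K) R,
    (forall i, (i < r)%N -> `|\int[mu]_x cos (phase (phase_of i) x) -
        \int[N]_x cos (phase (phase_of i) x)| <= r.+1%:R^-1) ->
    (forall j, (j < r)%N -> fine (mu (box_tail j)) <= tl j + r.+1%:R^-1) ->
    rho mu N < eps.
Proof.
move=> Htl eps0; apply: contrapT => /forallNP H.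
have {}H r : exists mu : probability (borel_rV R K) R,
    [/\ forall i, (i < r)%N -> `|\int[mu]_x cos (phase (phase_of i) x) -
        \int[N]_x cos (phase (phase_of i) x)| <= r.+1%:R^-1,
     forall j, (j < r)%N -> fine (mu (box_tail j)) <= tl j + r.+1%:R^-1 &
     eps <= rho mu N].
  have /existsNP[mu /not_implyP[h1 /not_implyP[h2 /negP h3]]] := H r.
  by exists mu; split => //; rewrite leNgt.
have [mu_ Hmu] := choice H.
have : weakly_converges mu_ N.
  apply: levy_continuity.
    move=> q; apply/cvgrPdist_le => e e0.
    near=> i; rewrite distrC.
    have /= := (let: And3 h _ _ := Hmu i in h) (pickle q).
    rewrite /phase_of pickleK /= => h.
    apply: le_trans (h _) _; first by near: i; exact: nbhs_infty_gt.
    by apply: ltW; near: i; exact: (near_infty_natSinv_lt (PosNum e0)).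
  move=> e e0; have e2 : 0 < e / 2 by rewrite divr_gt0.
  have [j tj] := Htl _ e2; exists j; near=> i.
  have [_ h _] := Hmu i.
  rewrite (splitr e) (le_trans (h j _))//; first by near: i; exact: nbhs_infty_gt.
  by rewrite lerD//; apply: ltW; near: i; exact: (near_infty_natSinv_lt (PosNum e2)).
move=> /(let: And4 _ _ _ h := hrho in h mu_ N).2 /cvgrPdist_lt/(_ _ eps0)[i _ /(_ i (leqnn _))] /=.
have [_ _ h] := Hmu i.
rewrite sub0r normrN => /ltr_normlW; by rewrite ltNge h.
Unshelve. all: end_near. Qed.

End metrization.

(** * A law on the line is determined by its characteristic function *)

Section cf_uniqueness.
Variable R : realType.

(** The line is embedded as row vectors of length 1, and [levy_continuity] for a constant sequence
    shows that the two laws integrate bounded continuous functions equally. Ramps then give the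
    half-lines, a generating family closed under intersection. *)
Lemma cf_unique (P Q : probability R R) :
  (forall t th : R, \int[P]_x cos (t * x + th) = \int[Q]_x cos (t * x + th)) ->
  forall B, measurable B -> P B = Q B.
Proof.
move=> cfE.
pose c (x : R) : borel_rV R 1 := \row_(k < 1) x.
have mc : measurable_fun setT c.
  by apply: measurable_rV => k; rewrite (_ : (fun _ => _) = id)//; apply/funext => x; rewrite mxE.
have [P' P'E P'I] := pushforward_probability P mc.
have [Q' Q'E Q'I] := pushforward_probability Q mc.
have bcE (f : R -> R) (C : R) : continuous f -> (forall x, `|f x| <= C) ->
    \int[P]_x f x = \int[Q]_x f x.
  move=> cf fC; pose g (x : 'rV[R]_1) := f (x 0 0).
  have cg : continuous g.
    move=> x; apply: (@continuous_comp _ _ _ (fun x : 'rV[R]_1 => x 0 0) f); last exact: cf.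
    exact: continuous_coord_rV.
  have mg := continuous_measurable_rV cg.
  have gC x : `|g x| <= C by exact: fC.
  have : weakly_converges (fun=> P') Q'.
    apply: levy_continuity.
      move=> q; rewrite (_ : \int[Q']_x _ = \int[P']_x cos (phase q x)); first exact: cvg_cst.
      have mq : measurable_fun [set: borel_rV R 1] (fun x => cos (phase q x)).
        by apply: continuous_measurable_rV; exact: continuous_cos_phase.
      rewrite (P'I _ 1 mq) ?(Q'I _ 1 mq)//; try by move=> x; exact: cos_max.
      have phE x : phase q (c x) = (q.1.2 0)%:~R / q.1.1%:R * x + q.2%:~R * (pi / 2).
        by rewrite /phase big_ord1 /c mxE; ring.
      under eq_Rintegral do rewrite phE; rewrite -cfE.
      by apply: eq_Rintegral => x _; rewrite phE.
    by move=> e e0; have [j hj] := box_tail_cvg0 P' e0; exists j; near=> i.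
  move=> /(_ g cg (ex_intro _ C gC)).
  have iP := bounded_integrable P' mg gC; have iQ := bounded_integrable Q' mg gC.
  rewrite !integral_EFin_Rintegral// => /(cvg_unique _ (cvg_cst _)) H.
  have : \int[P']_x g x = \int[Q']_x g x by apply/EFin_inj; apply: H.
  rewrite (P'I _ _ mg gC) (Q'I _ _ mg gC) /g /c.
  under eq_Rintegral do rewrite mxE.
  by move=> ->; apply: eq_Rintegral => x _; rewrite mxE.
have tailE (a : R) : P `]a, +oo[%classic = Q `]a, +oo[%classic.
  (* Ramps that rise from 0 at [a] with slope [n%:R] up to the level 1; at each point they
     eventually equal the indicator of the half-line. *)
  pose g n (x : R) := Num.min 1 (n%:R * Num.max 0 (x - a)).
  have cg n : continuous (g n).
    apply: continuous_minf; first by move=> ?; exact: cvg_cst.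
    apply: continuous_mulf; first by move=> ?; exact: cvg_cst.
    apply: continuous_maxf; first by move=> ?; exact: cvg_cst.
    by apply: (@continuous_addf R R id (cst (- a))) => ?; [exact: cvg_id|exact: cvg_cst].
  have g01 n x : 0 <= g n x <= 1.
    by rewrite /g le_min ler01 ge_min lexx/= andbT mulr_ge0// le_max lexx.
  have mg n : measurable_fun setT (g n) by exact: continuous_measurable_fun.
  have gC n x : `|g n x| <= 1 by rewrite ler_norml; have := g01 n x; lra.
  have lim (mu : probability R R) : (\int[mu]_x g n x)%:E @[n --> \oo] --> mu `]a, +oo[%classic.
    have i1 : mu.-integrable setT (EFin \o (fun=> 1 : R)).
      by apply: (@bounded_integrable _ _ _ _ _ 1) => // x; rewrite normr1.
    pose f : R -> R := \1_(`]a, +oo[%classic).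
    have D1 n : measurable_fun setT (EFin \o g n) by apply/measurable_EFinP.
    have D2 : measurable_fun setT (EFin \o f) by apply/measurable_EFinP; exact: measurable_indic.
    have D3 x : setT x -> (EFin \o g n) x @[n --> \oo] --> (EFin \o f) x.
      move=> _; apply: cvg_near_cst; rewrite (_ : (EFin \o f) x = (f x)%:E)// /f indicE.
      have [xa|xa] := leP x a.
        apply: nearW => n; rewrite memNset/=; last by rewrite in_itv/= andbT; apply/negP; rewrite -leNgt.
        by rewrite /g max_l ?subr_le0// mulr0 min_r.
      near=> n; rewrite mem_set/=; last by rewrite in_itv/= andbT.
      rewrite /g max_r ?subr_ge0 ?ltW// min_l//.
      rewrite -ler_pdivrMr ?subr_gt0//; near: n; exact: nbhs_infty_ger.
    have D5 x n : setT x -> (`|(EFin \o g n) x| <= (EFin \o (fun=> 1%R)) x)%E.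
      by move=> _; rewrite /= lee_fin.
    have [_ _ C] := @dominated_convergence _ _ _ mu setT measurableT (fun n => EFin \o g n)
      (EFin \o f) _ D1 D2 (aeW mu D3) i1 (aeW mu D5).
    have e1 : (\int[mu]_x (EFin \o f) x)%E = mu `]a, +oo[%classic.
      by rewrite integral_indic// setIT.
    have e2 : (fun n => (\int[mu]_x g n x)%:E) = fun n => (\int[mu]_x (EFin \o g n) x)%E.
      apply/funext => n; rewrite -integral_EFin_Rintegral//.
      exact: (bounded_integrable mu (mg n) (gC n)).
    by rewrite e2 -e1; exact: C.
  have := lim P; under eq_fun do rewrite (bcE _ 1 (cg _) (gC _)).
  by move=> /(cvg_unique _ (lim Q)) ->.
pose g n : set R := `](- n%:R), +oo[%classic.
have H1 : @measurable _ R = <<s (@RGenOInfty.G R) >> by exact: RGenOInfty.measurableE.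
have H2 : setI_closed (@RGenOInfty.G R).
  move=> _ _ [x ->] [y ->]; exists (Num.max x y).
  by apply/seteqP; split => z /=; rewrite !in_itv/= !andbT gt_max => /andP.
have H3 n : @RGenOInfty.G R (g n) by exists (- n%:R).
have H4 : \bigcup_n g n = setT.
  apply/seteqP; split => // x _; exists (Num.truncn `|x|).+1 => //=.
  by rewrite /g/= in_itv/= andbT ltrNl; apply: le_lt_trans (truncnS_gt _); rewrite -normrN ler_norm.
have H5 A : @RGenOInfty.G R A -> P A = Q A by move=> [x ->].
have H6 n : (P (g n) < +oo)%E.
  by apply: le_lt_trans (probability_le1 P _) _; rewrite ?ltry//; exact: measurable_itv.
have H := @measure_unique _ R R _ g H1 H2 H3 H4 P Q H5 H6.
exact: H.
Unshelve. all: end_near. Qed.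

End cf_uniqueness.

(** * Gaussian vectors *)

Lemma measurable_cos_affine (R : realType) (t th : R) :
  measurable_fun setT (fun x : R => cos (t * x + th)).
Proof.
apply: measurableT_comp; first by apply: continuous_measurable_fun; exact: continuous_cos.
by apply: measurable_funD => //; exact: measurable_funM.
Qed.

Section gaussian_vector.
Variables (R : realType) (K : nat).
Implicit Types (u e x : 'rV[R]_K).

Definition dot u x : R := \sum_k u 0 k * x 0 k.

Lemma continuous_dot u : continuous (dot u).
Proof.
apply: continuous_sumf => k; apply: continuous_mulf; first exact: cst_continuous.
exact: continuous_coord_rV.
Qed.

Lemma dotDZ u x (g : R) e : dot u (x + g *: e) = dot u x + g * dot u e.
Proof.
rewrite /dot mulr_sumr -big_split/=; apply: eq_bigr => k _.
by rewrite !mxE; ring.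
Qed.

Lemma dotZl (t : R) u x : dot (t *: u) x = t * dot u x.
Proof. by rewrite /dot mulr_sumr; apply: eq_bigr => k _; rewrite !mxE mulrA. Qed.

Lemma continuous_cos_dot u (th : R) : continuous (fun x => cos (dot u x + th)).
Proof.
move=> x; apply: (@continuous_comp _ _ _ (fun x => dot u x + th) cos); last exact: continuous_cos.
by apply: continuous_addf; [exact: continuous_dot|exact: cst_continuous].
Qed.

(** The law is that of a sum of independent standard normal multiples of the vectors in [es]; one
    vector is added at a time, by a product with [normal_prob 0 1] and Fubini's theorem. No density
    occurs, so the covariance may be singular; the empty list gives the Dirac mass at 0. *)
Lemma gaussian_vector_exists (es : seq 'rV[R]_K) :
  exists N : probability (borel_rV R K) R, forall u (th : R),
    \int[N]_x cos (dot u x + th) =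
    expR (- (\sum_(e <- es) dot u e ^+ 2) / 2) * cos th.
Proof.
elim: es => [|e es [N HN]].
  exists (dirac ((0 : 'rV[R]_K) : borel_rV R K)) => u th.
  rewrite big_nil oppr0 mul0r expR0 mul1r /Rintegral integral_dirac//.
    rewrite diracT mul1e/= (_ : dot u 0 = 0) ?add0r//.
    by rewrite /dot big1// => k _; rewrite mxE mulr0.
  apply/measurable_EFinP; apply: continuous_measurable_rV; exact: continuous_cos_dot.
pose G := normal_prob (0 : R) 1.
pose f (p : borel_rV R K * measurableTypeR R) : borel_rV R K := (p.1 : 'rV[R]_K) + (p.2 : R) *: e.
have mf : measurable_fun setT f.
  apply: measurable_rV => k.
  rewrite (_ : (fun _ => _) = fun p : borel_rV R K * measurableTypeR R =>
      (p.1 : 'rV[R]_K) 0 k + (p.2 : R) * e 0 k); last first.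
    by apply/funext => p; rewrite !mxE.
  apply: measurable_funD.
    apply: (measurableT_comp (continuous_measurable_rV (@continuous_coord_rV R K k))).
    exact: measurable_fst.
  by apply: measurable_funM => //; exact: measurable_snd.
have [Q _ QI] := pushforward_probability (N \x G)%E mf.
exists Q => u th.
have mc : measurable_fun [set: borel_rV R K] (fun x => cos (dot u x + th)).
  by apply: continuous_measurable_rV; exact: continuous_cos_dot.
have c1 x : `|cos (dot u x + th)| <= 1 by exact: cos_max.
rewrite (QI _ 1 mc c1) /f.
under eq_Rintegral do rewrite dotDZ.
pose h (p : borel_rV R K * measurableTypeR R) : R := cos (dot u p.1 + p.2 * dot u e + th).
have mh : measurable_fun setT h.
  rewrite (_ : h = (fun x => cos (dot u x + th)) \o f); first exact: measurableT_comp.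
  by apply/funext => p; rewrite /h/= dotDZ.
have ih : (N \x G)%E.-integrable setT (EFin \o h).
  by apply: (@bounded_integrable _ _ _ _ h 1) => // p; exact: cos_max.
rewrite -[LHS]/(fine (\int[(N \x G)%E]_p (EFin \o h) p)%E) -integral12_prod_meas1//.
have -> : fubini_F G (EFin \o h) =
    fun x => (expR (- dot u e ^+ 2 / 2) * cos (dot u x + th))%:E.
  apply/funext => x; rewrite /fubini_F/= /h/=.
  rewrite integral_EFin_Rintegral.
    congr EFin; under eq_Rintegral do rewrite addrAC addrC mulrC.
    by rewrite normal_cf// ?mul1r// oner_neq0.
  apply: (@bounded_integrable _ _ _ _ _ 1).
    exact: (measurableT_comp mh (measurable_pair1 x)).
  by move=> y; exact: cos_max.
rewrite -/(Rintegral _ _ _) RintegralZl//; last exact: (bounded_integrable N mc c1).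
by rewrite HN mulrA -expRD big_cons; congr (expR _ * _); ring.
Qed.

(** A linear functional pushes [N] to a law on the line whose cosine integrals are those of the
    centred normal law of variance [s], and [cf_unique] identifies it. The case [s = 0] is compared
    with a Dirac mass, as in [normal_law]. *)
Lemma gaussian_vector_normal (es : seq 'rV[R]_K) (Sigma : 'M[R]_K)
    (N : probability (borel_rV R K) R) :
  (forall u (th : R), \int[N]_x cos (dot u x + th) =
    expR (- (\sum_(e <- es) dot u e ^+ 2) / 2) * cos th) ->
  (forall u, (u *m Sigma *m u^T) 0 0 = \sum_(e <- es) dot u e ^+ 2) ->
  is_multivariate_normal 0 Sigma N.
Proof.
move=> HN HS a B mB; rewrite HS mul0mx mxE.
set s := \sum_(e <- es) _.
have s0 : 0 <= s by apply: sumr_ge0 => e _; exact: sqr_ge0.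
have mp : measurable_fun [set: borel_rV R K] (dot a).
  by apply: continuous_measurable_rV; exact: continuous_dot.
have [P PE PI] := pushforward_probability N mp.
have -> : [set x : 'rV[R]_K | B ((x *m a^T) 0 0)] = dot a @^-1` B.
  have dotE (x : 'rV[R]_K) : (x *m a^T) 0 0 = dot a x.
    by rewrite mxE; apply: eq_bigr => k _; rewrite mxE mulrC.
  by apply/seteqP; split => x /=; rewrite dotE.
rewrite -PE.
have cfP t th : \int[P]_x cos (t * x + th) = expR (- (s * t ^+ 2) / 2) * cos th.
  rewrite (PI _ 1); last by move=> x; exact: cos_max.
    under eq_Rintegral do rewrite -dotZl.
    rewrite HN (_ : \sum_(e <- es) _ = s * t ^+ 2)// mulrC /s mulr_sumr.
    by apply: eq_bigr => e _; rewrite dotZl exprMn.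
  exact: measurable_cos_affine.
rewrite /normal_law; have [s00|sn0] := eqVneq s 0.
  pose D0 : probability R R := dirac (0 : R).
  rewrite -[RHS]/(D0 B); apply: cf_unique => // t th; rewrite cfP s00 mul0r oppr0 mul0r expR0 mul1r.
  rewrite /Rintegral integral_dirac//; first by rewrite diracT mul1e/= mulr0 add0r.
  by apply/measurable_EFinP; exact: measurable_cos_affine.
(* [normal_prob] is a measure on [measurableTypeR R]; its image under the identity is a law on [R],
   the type for which [cf_unique] is stated. *)
pose idR (x : measurableTypeR R) : R := x.
have mid : measurable_fun setT idR by move=> _ C mC; rewrite setTI; exact: mC.
have [Q QE QI] := pushforward_probability (normal_prob 0 (Num.sqrt s)) mid.
rewrite -[RHS]/(normal_prob 0 (Num.sqrt s) (idR @^-1` B)) -QE.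
apply: cf_unique => // t th; rewrite cfP (QI _ 1); last by move=> x; exact: cos_max.
  rewrite normal_cf; first by rewrite exprMn sqr_sqrtr.
  by rewrite gt_eqF// sqrtr_gt0 lt_neqAle eq_sym sn0.
exact: measurable_cos_affine.
Qed.

End gaussian_vector.

(** * The conditional law given the data *)

Section measurability.
Variables (R : realType) (d : measure_display) (T : measurableType d).

Lemma measurable_sumf (I : Type) (r : seq I) (Q : pred I) (F : I -> T -> R) :
  (forall i, measurable_fun setT (F i)) ->
  measurable_fun setT (fun w => \sum_(i <- r | Q i) F i w).
Proof.
move=> mF; elim: r => [|i r IH].
  by rewrite (_ : (fun _ => _) = cst 0)//; apply/funext => w; rewrite big_nil.
rewrite (_ : (fun _ => _) = fun w => (if Q i then F i w else 0) + \sum_(j <- r | Q j) F j w).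
  by apply: measurable_funD => //; case: (Q i).
by apply/funext => w; rewrite big_cons; case: ifP; rewrite ?add0r.
Qed.

(** The function is rewritten as a real power of [Num.max 0 (f w)]. Where [f w <= 0] the two agree
    by default values: the square root and its inverse are 0, and so is 0 raised to the power
    -1/2. *)
Lemma measurable_inv_sqrt (f : T -> R) : measurable_fun setT f ->
  measurable_fun setT (fun w => (Num.sqrt (f w))^-1).
Proof.
move=> mf; rewrite (_ : (fun _ => _) = fun w => (Num.max 0 (f w)) `^ (- 2^-1)).
  apply: (measurableT_comp (measurable_powR (- 2^-1))).
  by apply: measurable_maxr.
apply/funext => w; have [f0|f0] := leP (f w) 0.
  by rewrite ler0_sqrtr// invr0 powR0// oppr_eq0 invr_eq0.
by rewrite powRN powR12_sqrt// ltW.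
Qed.

Lemma Rintegral_sum (mu : {measure set T -> \bar R}) (D : set T) (I : Type) (r : seq I)
    (F : I -> T -> R) : measurable D -> (forall i, mu.-integrable D (EFin \o F i)) ->
  mu.-integrable D (EFin \o (fun w => \sum_(i <- r) F i w)) /\
  \int[mu]_(w in D) \sum_(i <- r) F i w = \sum_(i <- r) \int[mu]_(w in D) F i w.
Proof.
move=> mD iF; elim: r => [|i r [IH1 IH2]].
  under eq_fun do rewrite big_nil; split; first exact: integrable0.
  by rewrite big_nil Rintegral_cst// mul0r.
under eq_fun do rewrite big_cons; split.
  by rewrite /comp; under eq_fun do rewrite EFinD; apply: integrableD => //; exact: iF.
by rewrite (RintegralD mD (iF i) IH1) big_cons IH2.
Qed.

End measurability.

Section conditional_law.
Variables (R : realType) (K : nat) (m l : 'I_K -> nat).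
Variables (d : measure_display) (T : measurableType d) (P : probability T R).
Variables (X Y : nat -> {RV P >-> R}) (tau : forall k : 'I_K, T -> 'S_(m k + l k)).

Local Notation M := (total_size m).
Local Notation L := (total_size l).
Local Notation obs := (@observation T R M L X Y).

Hypothesis htau_meas : forall k s, measurable (tau k @^-1` [set s]).
Hypothesis htau_unif : forall k s,
  P (tau k @^-1` [set s]) = (((m k + l k)`!)%:R^-1)%:E.
Hypothesis hindep : mutually_independent P (experiment_events X Y tau).

Definition Om : finType := {dffun forall k : 'I_K, 'S_(m k + l k)}.

Lemma Om_gt0 : (0 < #|Om|)%N.
Proof. by apply/card_gt0P; exists [ffun k => 1%g]. Qed.

Definition obs_gen : set (set T) :=
  [set (obs i) @^-1` B | i in [set: 'I_M + 'I_L] & B in (@measurable _ R)].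

(** The set [T] with the sigma-algebra of the data in place of its own, so that measurability with
    respect to the data can be stated as [measurable_fun [set: dataT]]. *)
Definition dataT := g_sigma_algebraType obs_gen.

Lemma data_sigmaE (D : set T) : data_sigma M L X Y D = @measurable _ dataT D.
Proof. by []. Qed.

Lemma measurable_obs i : measurable_fun setT (obs i).
Proof. by case: i => i /=. Qed.

Lemma measurable_obs_data i : measurable_fun [set: dataT] (obs i).
Proof.
by move=> _ B mB; rewrite setTI; apply: sub_sigma_algebra; exists i => //; exists B.
Qed.

Lemma data_measurable (D : set T) : data_sigma M L X Y D -> measurable D.
Proof.
apply: smallest_sub; first exact: sigma_algebra_measurable.
by move=> _ [i _ [B mB <-]]; rewrite -[_ @^-1` _]setTI; apply: measurable_obs.
Qed.

Definition tau_event (t : Om) : set T := [set w | forall k, tau k w = t k].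

Lemma tau_eventE t : tau_event t = \bigcap_(k in setT) (tau k @^-1` [set t k]).
Proof. by apply/seteqP; split => [w H k _|w H k]; [exact: H|exact: H]. Qed.

Lemma measurable_tau_event t : measurable (tau_event t).
Proof. by rewrite tau_eventE; apply: fin_bigcap_measurable => // k _; exact: htau_meas. Qed.

Lemma card_Om : #|Om| = (\prod_k (m k + l k)`!)%N.
Proof.
rewrite card_dep_ffun foldrE big_image/=; apply: eq_bigr => k _.
by rewrite -card_Sn; apply: eq_card => s; rewrite !inE.
Qed.

(** Both sides are finite measures of [D], and by mutual independence they agree on the
    intersections of one event per observation. These sets form a family closed under intersection
    that generates the data sigma-algebra. *)
Lemma data_tau_indep (D : set T) (t : Om) : data_sigma M L X Y D ->
  P (D `&` tau_event t) = ((#|Om|%:R^-1)%:E * P D)%E.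
Proof.
move=> GD.
pose Pi := [set \bigcap_(i in [set: 'I_M + 'I_L]) obs i @^-1` (B i) |
   B in [set B : 'I_M + 'I_L -> set R | forall i, measurable (B i)]].
have base E : Pi E -> P (E `&` tau_event t) = ((#|Om|%:R^-1)%:E * P E)%E.
  move=> [B mB <-].
  (* With [b] true the permutations are prescribed, with [b] false they are free. The second case is
     the product rule for the observations alone, and the two products differ by the uniform
     probabilities of the [t k]. *)
  pose A (b : bool) (i : ('I_M + 'I_L) + 'I_K) : set T := match i with
    | inl z => obs z @^-1` B z | inr k => if b then tau k @^-1` [set t k] else setT end.
  have EA b : forall i, experiment_events X Y tau i (A b i).
    move=> [z|k] /=.
      by exists (B z) => //; rewrite setTI.
    case: b; [exists [set t k] => //|exists setT => //]; by rewrite setTI ?preimage_setT.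
  have h1 := hindep (EA true); have h2 := hindep (EA false).
  have e1 : \bigcap_i A true i = (\bigcap_(i in [set: 'I_M + 'I_L]) obs i @^-1` B i) `&` tau_event t.
    rewrite tau_eventE; apply/seteqP; split => [w H|w [H1 H2] [z|k] _].
    - by split=> [z _|k _]; [exact: (H (inl z) I)|exact: (H (inr k) I)].
    - exact: H1.
    - exact: H2.
  have e2 : \bigcap_i A false i = \bigcap_(i in [set: 'I_M + 'I_L]) obs i @^-1` B i.
    apply/seteqP; split => [w H z _|w H [z|k] _ //]; first exact: (H (inl z) I).
    exact: H.
  rewrite -{1}e1 -e2 h1 h2 !big_sumType/= -EFinM; congr EFin.
  under [X in _ * X = _]eq_bigr do rewrite htau_unif /=.
  under [X in _ = _ * (_ * X)]eq_bigr do rewrite [P _]probability_setT /=.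
  rewrite [X in _ = _ * (_ * X)]big1// mulr1 mulrC; congr (_ * _).
  by rewrite prodfV card_Om natr_prod.
have tnn : (0 <= (#|Om|%:R^-1 : R)) by rewrite invr_ge0.
pose m1 := mrestr P (measurable_tau_event t).
pose m2 := mscale (NngNum tnn) P.
have Pi_gen : obs_gen `<=` Pi.
  move=> _ [i _ [B mB <-]]; exists (fun j => if j == i then B else setT).
    by move=> j; case: ifP.
  apply/seteqP; split => w /=; first by move=> /(_ i I); rewrite eqxx.
  by move=> Bw j _; case: eqP => // ->.
have Pi_meas : Pi `<=` data_sigma M L X Y.
  move=> _ [B mB <-]; rewrite data_sigmaE; apply: fin_bigcap_measurable => // i _.
  by rewrite -[_ @^-1` _]setTI; apply: measurable_obs_data => //; exact: mB.
have PiT : Pi setT.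
  exists (fun=> setT) => //.
  by apply/seteqP; split.
have PiI : setI_closed Pi.
  move=> _ _ [B mB <-] [C mC <-]; exists (fun i => B i `&` C i).
    by move=> i; exact: measurableI.
  apply/seteqP; split => w /=.
    by move=> H; split => i _; have [] := H i I.
  by move=> [H1 H2] i _; split; [exact: H1|exact: H2].
have Pm : Pi `<=` @measurable _ T by move=> E /Pi_meas; exact: data_measurable.
suff : m1 D = m2 D by rewrite /m1 /m2 /mrestr /mscale/=.
apply: (g_sigma_algebra_measure_unique Pi Pm (fun=> setT)) => //.
- by apply/seteqP; split => // w _; exists 0%N.
- by move=> k; rewrite -[X in (X < _)%E]/(P (setT `&` tau_event t)) setTI; apply: le_lt_trans (probability_le1 P _) _; rewrite ?ltry//; exact: measurable_tau_event.
- move: D GD; apply: sub_smallest2r; first exact: smallest_sigma_algebra.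
  exact: Pi_gen.
Qed.

Lemma cum_before_lt (a : 'I_K -> nat) (k : 'I_K) (i : nat) :
  (i < a k)%N -> (cum_before a k + i < total_size a)%N.
Proof.
move=> ik; rewrite /cum_before /total_size [X in (_ < X)%N](bigID (fun j : 'I_K => (j < k)%N))/=.
by rewrite ltn_add2l (bigD1 k) ?ltnn//= (leq_trans ik)// leq_addr.
Qed.

Lemma measurable_stage_data (k : 'I_K) i :
  measurable_fun [set: dataT] (fun w => stage_data (X ^~ w) (Y ^~ w) (k := k) (i : 'I_(m k + l k))).
Proof.
rewrite /stage_data; case: (fintype.split i) => a.
  exact: (measurable_obs_data (inl (Ordinal (cum_before_lt (ltn_ord a))))).
exact: (measurable_obs_data (inr (Ordinal (cum_before_lt (ltn_ord a))))).
Qed.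

Definition St (t : Om) (w : T) : borel_rV R K :=
  perm_stat_vec (X ^~ w) (Y ^~ w) (fun k => t k).

Lemma measurable_St t : measurable_fun [set: dataT] (St t).
Proof.
have mmean (a : 'I_K -> nat) (z : T -> forall s : 'I_K, 'I_(a s) -> R) k :
    (forall s i, measurable_fun [set: dataT] (fun w => z w s i)) ->
    measurable_fun [set: dataT] (fun w => cum_mean (z w) k).
  move=> mz; apply: measurable_funM => //.
  by apply: measurable_sumf => s; apply: measurable_sumf => i.
have mvar (a : 'I_K -> nat) (z : T -> forall s : 'I_K, 'I_(a s) -> R) k :
    (forall s i, measurable_fun [set: dataT] (fun w => z w s i)) ->
    measurable_fun [set: dataT] (fun w => cum_var (z w) k).
  move=> mz; apply: measurable_funM => //.
  apply: measurable_sumf => s; apply: measurable_sumf => i.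
  by apply: measurable_funX; apply: measurable_funB => //; exact: mmean.
have m1 s (i : 'I_(m s)) : measurable_fun [set: dataT]
    (fun w => perm_treat (X ^~ w) (Y ^~ w) (fun k => t k) i).
  exact: measurable_stage_data.
have m2 s (i : 'I_(l s)) : measurable_fun [set: dataT]
    (fun w => perm_ctrl (X ^~ w) (Y ^~ w) (fun k => t k) i).
  exact: measurable_stage_data.
apply: measurable_rV => k.
rewrite (_ : (fun _ => _) = fun w => perm_stat (X ^~ w) (Y ^~ w) (fun k => t k) k); last first.
  by apply/funext => w; rewrite mxE.
apply: measurable_funM.
  by apply: measurable_funM => //; apply: measurable_funB; exact: mmean.
by apply: measurable_inv_sqrt; apply: measurable_funD; apply: measurable_funM => //; exact: mvar.
Qed.

Variable kappa : T -> probability (borel_rV R K) R.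
Hypothesis hkappa : is_conditional_law P (data_sigma M L X Y)
  (fun w => perm_stat_vec (X ^~ w) (Y ^~ w) (fun k => tau k w)) kappa.

Lemma partition_tau (E : set T) : measurable E ->
  fine (P E) = \sum_t fine (P (E `&` tau_event t)).
Proof.
move=> mE; pose h t w : R := \1_(E `&` tau_event t) w.
have mEt t : measurable (E `&` tau_event t) by apply: measurableI => //; exact: measurable_tau_event.
have E1 : P E = (\sum_(t : Om) P (E `&` tau_event t))%E.
  rewrite -[in LHS](setIT E) -(integral_indic P measurableT mE).
  rewrite (eq_integral (fun w => (\sum_(t : Om) (\1_(E `&` tau_event t) w)%:E)%E)); last first.
    move=> w _; pose t0 : Om := [ffun k => tau k w].
    have t0w : tau_event t0 w by move=> k; rewrite ffunE.
    rewrite (bigD1 t0)//= big1; last first.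
      move=> t /eqP tt0; rewrite indicE memNset// => -[_ tw].
      by apply: tt0; apply/ffunP => k; rewrite ffunE tw.
    rewrite adde0 !indicE; congr (_%:R%:E).
    by rewrite in_setI (mem_set t0w) andbT.
  rewrite ge0_integral_sum//; last by move=> t; apply/measurable_EFinP; exact: measurable_indic.
  by apply: eq_bigr => t _; rewrite integral_indic// setIT.
by rewrite E1 -sum_fine// => t _; exact: fin_num_measure.
Qed.

(** The event is split according to the value [t] of the permutations. On each piece the statistic
    equals [St t], whose event belongs to the data sigma-algebra, and independence gives the factor
    [#|Om|%:R^-1]. *)
Lemma conditional_measure (A : set (borel_rV R K)) (D : set T) :
  measurable A -> data_sigma M L X Y D ->
  \int[P]_(w in D) fine (kappa w A) =
  avg (fun t => fine (P (D `&` St t @^-1` A))).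
Proof.
move=> mA GD; have [k1 k2] := hkappa.
have mD := data_measurable GD.
have -> : \int[P]_(w in D) fine (kappa w A) = fine (\int[P]_(w in D) kappa w A)%E.
  rewrite /Rintegral; congr fine; apply: eq_integral => w _.
  by rewrite fineK// fin_num_measure.
set S := (fun w => perm_stat_vec _ _ _) in k2 *.
have GDt t : data_sigma M L X Y (D `&` St t @^-1` A).
  rewrite data_sigmaE; apply: measurableI => //.
  by rewrite -[_ @^-1` _]setTI; apply: measurable_St.
have DSt t : (D `&` S @^-1` A) `&` tau_event t = (D `&` St t @^-1` A) `&` tau_event t.
  apply/seteqP; split => w /= [[Dw Aw] tw]; do 2 split => //;
  move: Aw; rewrite /S /St (_ : (fun k => tau k w) = (fun k => t k))//;
  by apply: functional_extensionality_dep.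
have mS : measurable (D `&` S @^-1` A).
  have -> : D `&` S @^-1` A = \bigcup_(t in [set: Om]) ((D `&` St t @^-1` A) `&` tau_event t).
    apply/seteqP; split => [w H|w [t _]]; last by rewrite -DSt => -[].
    exists [ffun k => tau k w] => //; rewrite -DSt; split => //.
    by move=> k; rewrite ffunE.
  apply: fin_bigcup_measurable => // t _; apply: measurableI; last exact: measurable_tau_event.
  exact: data_measurable.
rewrite k2// partition_tau// /avg mulr_sumr; apply: eq_bigr => t _.
by rewrite DSt data_tau_indep// fineM ?fin_num_measure//; exact: data_measurable.
Qed.

Lemma measurable_kappa (A : set (borel_rV R K)) : measurable A ->
  measurable_fun [set: dataT] (fun w => fine (kappa w A)).
Proof. by move=> mA _ B mB; rewrite setTI; exact: hkappa.1. Qed.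

Lemma measurable_data_fun (f : T -> R) : measurable_fun [set: dataT] f ->
  measurable_fun [set: T] f.
Proof.
by move=> mf _ B mB; rewrite setTI; apply: data_measurable; rewrite -[_ @^-1` _]setTI; exact: mf.
Qed.

(** The defining property of a conditional law concerns sets, so integrals of [h] are reached
    through finite combinations of indicators: the range of [h] is cut into slices of width [del],
    and its values are rounded down. *)
Lemma simple_approx (h : borel_rV R K -> R) (C del : R) : measurable_fun setT h ->
  (forall x, `|h x| <= C) -> 0 < del ->
  exists (N : nat) (a : 'I_N -> R) (A : 'I_N -> set (borel_rV R K)),
    (forall v, measurable (A v)) /\
    forall x, `|h x - \sum_v a v * \1_(A v) x| <= del.
Proof.
move=> mh hC d0; have C0 : 0 <= C by apply: le_trans (hC point).
pose N := (Num.truncn (2 * C / del)).+1.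
pose A (v : 'I_N) : set (borel_rV R K) := h @^-1` `[v%:R * del - C, v.+1%:R * del - C[.
exists N, (fun v => v%:R * del - C), A; split=> [v|x].
  by rewrite -[A v]setTI; apply: mh => //; exact: measurable_itv.
have /andP[h1 h2] : - C <= h x <= C by rewrite -ler_norml.
have y0 : 0 <= (h x + C) / del by rewrite divr_ge0 ?(ltW d0)//; lra.
pose v := Num.truncn ((h x + C) / del).
have /andP[v1 v2] : v%:R <= (h x + C) / del < v.+1%:R by exact: truncn_itv.
have vN : (v < N)%N by rewrite ltnS; apply: le_truncn; rewrite ler_pM2r ?invr_gt0//; lra.
rewrite ler_pdivlMr// in v1; rewrite ltr_pdivrMr// in v2.
rewrite (bigD1 (Ordinal vN))//= big1 => [|u uv]; last first.
  rewrite indicE memNset ?mulr0// /A/= in_itv/= => /andP[u1 u2].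
  move/eqP: uv; apply; apply: val_inj => /=.
  apply/eqP; rewrite eqn_leq -ltnS -[(v <= u)%N]ltnS -!(ltr_nat R).
  by apply/andP; split; rewrite -(ltr_pM2r d0); lra.
rewrite indicE mem_set; last by rewrite /A/= in_itv/=; apply/andP; split; lra.
rewrite mulr1 addr0 ler_norml; move: v2; rewrite -natr1 mulrDl mul1r => v2.
by apply/andP; split; lra.
Qed.

(* The event on the left belongs to the data sigma-algebra, over whose sets the
   integral of h against kappa has the same mean as the average of h over the
   permutations, because these are independent of the data. *)
Lemma conditional_bound (h : borel_rV R K -> R) (C c b eps : R) (g : T -> R) :
  measurable_fun setT h -> (forall x, `|h x| <= C) -> 0 < eps ->
  measurable_fun setT g -> (forall w, 0 <= g w) ->
  (\int[P]_w (g w)%:E <= b%:E)%E ->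
  (forall w, avg (fun t => h (St t w)) <= c + g w) ->
  (mu_ext P [set w | (c + eps <= \int[kappa w]_x h x)%R] <= (4 * b / eps)%:E)%E.
Proof.
move=> mh hC e0 mg g0 gb hg.
(* A simple function replaces [h] under [kappa] and over the permutations, each time at a cost of
   [del]. The threshold of [D] lies [2 * del] below [c + eps], which absorbs the first cost, and
   [2 * del] above [c]; the second cost then leaves [del * fine (P D) <= b]. *)
pose del := eps / 4; have d0 : 0 < del by rewrite divr_gt0.
have [N [a [A [mA hA]]]] := simple_approx mh hC d0.
pose H w := \sum_v a v * fine (kappa w (A v)).
have mHd : measurable_fun [set: dataT] H.
  by apply: measurable_sumf => v; apply: measurable_funM => //; exact: measurable_kappa.
have mH := measurable_data_fun mHd.
have bH w : `|H w| <= \sum_v `|a v|.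
  apply: le_trans (ler_norm_sum _ _ _) _; apply: ler_sum => v _.
  rewrite normrM ler_piMr// ger0_norm ?fine_ge0//.
  by rewrite -lee_fin fineK ?fin_num_measure// probability_le1.
pose hs (x : borel_rV R K) : R := \sum_v a v * \1_(A v) x.
have mhs : measurable_fun setT hs.
  by apply: measurable_sumf => v; apply: measurable_funM => //; exact: measurable_indic.
have hsC x : `|hs x| <= \sum_v `|a v|.
  apply: le_trans (ler_norm_sum _ _ _) _; apply: ler_sum => v _.
  by rewrite normrM ler_piMr// indicE; case: (_ \in _); rewrite ?normr1 ?normr0.
have HE w : H w = \int[kappa w]_x hs x.
  rewrite /H /hs; elim: (index_enum _) => [|v r IH].
    by rewrite big_nil; under eq_Rintegral do rewrite big_nil; rewrite Rintegral_cst_prob.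
  under eq_Rintegral do rewrite big_cons.
  have mi u : measurable_fun setT (fun x : borel_rV R K => a u * \1_(A u) x).
    by apply: measurable_funM => //; exact: measurable_indic.
  have bi u (x : borel_rV R K) : `|a u * \1_(A u) x| <= `|a u|.
    by rewrite normrM ler_piMr// indicE; case: (_ \in _); rewrite ?normr1 ?normr0.
  rewrite RintegralD//; last 2 first.
  - exact: (bounded_integrable (kappa w) (mi v) (bi v)).
  - apply: (@bounded_integrable _ _ _ (kappa w) _ (\sum_(v <- r) `|a v|)).
      exact: measurable_sumf.
    by move=> x; apply: le_trans (ler_norm_sum _ _ _) _; apply: ler_sum => u _.
  rewrite big_cons IH RintegralZl//; last first.
    apply: (@bounded_integrable _ _ _ (kappa w) _ 1); first exact: measurable_indic.
    by move=> x; rewrite indicE; case: (_ \in _); rewrite ?normr1 ?normr0.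
  by rewrite /Rintegral integral_indic// setIT.
have Hh w : `|\int[kappa w]_x h x - H w| <= del.
  have := @Rintegral_close _ _ _ (kappa w) h hs (C + \sum_v `|a v|) del set0 mh mhs measurable0.
  rewrite HE measure0 mulr0 addr0; apply => //; last exact: ltW.
  - by move=> x; rewrite (le_trans (hC x))// lerDl sumr_ge0.
  - by move=> x; rewrite (le_trans (hsC x))// lerDr; apply: le_trans (hC x).
pose D := [set w | c + 2 * del < H w].
have GD : data_sigma M L X Y D.
  rewrite data_sigmaE (_ : D = setT `&` H @^-1` `]c + 2 * del, +oo[%classic); first exact: mHd.
  by rewrite setTI; apply/seteqP; split => w /=; rewrite in_itv/= andbT.
have mD := data_measurable GD.
apply: (@le_trans _ _ (P D)).
  rewrite -(measurable_mu_extE P mD); apply: le_mu_ext => w /= hw.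
  by have := Hh w; rewrite ler_norml /D/= => /andP[_]; rewrite /del; move: hw; lra.
have PD : P D = (fine (P D))%:E by rewrite fineK// fin_num_measure.
rewrite PD lee_fin.
have gi : P.-integrable setT (EFin \o g).
  apply/integrableP; split; first exact/measurable_EFinP.
  rewrite (eq_integral (fun w => (g w)%:E)); first by apply: le_lt_trans gb _; rewrite ltry.
  by move=> w _; rewrite /= ger0_norm.
have iDS (f : T -> R) : P.-integrable setT (EFin \o f) -> P.-integrable D (EFin \o f).
  by apply: integrableS.
have ib (f : T -> R) B : measurable_fun setT f -> (forall w, `|f w| <= B) -> P.-integrable D (EFin \o f).
  by move=> mf fB; apply: iDS; exact: bounded_integrable fB.
have mhSt t : measurable_fun setT (fun w => hs (St t w)).
  apply: measurable_data_fun; apply: (measurableT_comp mhs); exact: measurable_St.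
have mAt v t : measurable (St t @^-1` A v).
  by apply: data_measurable; rewrite -[_ @^-1` _]setTI; apply: measurable_St.
have i1 v t : P.-integrable D (EFin \o (fun w => \1_(A v) (St t w) : R)).
  apply: (ib _ 1); last by move=> w; rewrite indicE; case: (_ \in _); rewrite ?normr1 ?normr0.
  rewrite (_ : (fun w => _) = \1_(St t @^-1` A v)).
    exact/measurable_indic/mAt.
  by apply/funext => w; rewrite !indicE.
have iZ (f : T -> R) (x : R) : P.-integrable D (EFin \o f) -> P.-integrable D (EFin \o (fun w => x * f w)).
  by move=> fi; rewrite /comp; under eq_fun do rewrite EFinM; exact: integrableZl.
have ik v : P.-integrable D (EFin \o (fun w => fine (kappa w (A v)))).
  apply: (ib _ 1); first by apply: measurable_data_fun; exact: measurable_kappa.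
  move=> w; rewrite ger0_norm ?fine_ge0//.
  by rewrite -lee_fin fineK ?fin_num_measure// probability_le1.
have ihs t : P.-integrable D (EFin \o (fun w => hs (St t w))).
  by apply: (ib _ _ _ (fun w => hsC (St t w))).
have Hint : \int[P]_(w in D) H w = \int[P]_(w in D) avg (fun t => hs (St t w)).
  rewrite /avg RintegralZl//; last exact: (Rintegral_sum _ mD ihs).1.
  rewrite (Rintegral_sum _ mD ihs).2 (Rintegral_sum _ mD (fun v => iZ _ (a v) (ik v))).2.
  under eq_bigr do rewrite RintegralZl// conditional_measure// -avgZ.
  rewrite -avg_sum /avg; congr (_ * _); apply: eq_bigr => t _.
  rewrite (Rintegral_sum _ mD (fun v => iZ _ (a v) (i1 v t))).2.
  apply: eq_bigr => v _; rewrite RintegralZl//; congr (_ * _).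
  rewrite /Rintegral (eq_integral (fun w => (\1_(St t @^-1` A v) w)%:E)).
    by rewrite integral_indic// setIC.
  by move=> w _; rewrite !indicE.
have iavg : P.-integrable D (EFin \o (fun w => avg (fun t => hs (St t w)))).
  by apply: iZ; exact: (Rintegral_sum _ mD ihs).1.
have icst (x : R) : P.-integrable D (EFin \o (fun=> x)) by apply: (ib _ `|x|).
have gb' : \int[P]_(w in D) g w <= b.
  rewrite -lee_fin /Rintegral fineK; last exact: (integrable_fin_num mD (iDS _ gi)).
  apply: le_trans gb; apply: ge0_subset_integral => //; first exact/measurable_EFinP.
  by move=> w _; rewrite lee_fin.
have key : (c + 2 * del) * fine (P D) <= (c + del) * fine (P D) + b.
  rewrite -(Rintegral_cst P mD).
  apply: (@le_trans _ _ (\int[P]_(w in D) H w)).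
    apply: le_Rintegral => //; first by apply: (ib _ _ mH bH).
    by move=> w /ltW.
  rewrite Hint; apply: (@le_trans _ _ (\int[P]_(w in D) (c + del + g w))).
    apply: le_Rintegral => //.
      by rewrite /comp; under eq_fun do rewrite EFinD; apply: integrableD => //; [exact: (icst (c + del))|exact: iDS].
    move=> w _; rewrite addrAC; apply: (@le_trans _ _ (avg (fun t => h (St t w)) + del)).
      rewrite -[X in _ + X](avg_cst del Om_gt0) -avgD; apply: avg_le => t.
      by have := hA (St t w); rewrite ler_norml => /andP[+ _]; rewrite /hs; lra.
    by rewrite lerD2r.
  by rewrite RintegralD//; [rewrite Rintegral_cst// lerD2l|exact: iDS].
rewrite ler_pdivlMr//; move: key; rewrite /del; lra.
Qed.

End conditional_law.

(** * Sums of independent variables *)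

Section law_transfer.
Variables (R : realType) (d d' : measure_display).
Variables (T : measurableType d) (T' : measurableType d').
Variables (P : probability T R) (Q : probability T' R) (Z : T -> T').
Hypothesis mZ : measurable_fun setT Z.
Hypothesis lawZ : forall B, measurable B -> P (Z @^-1` B) = Q B.

Let X : {mfun T >-> T'} := HB.pack Z (isMeasurableFun.Build _ _ _ _ Z mZ).

Lemma ge0_integral_law (f : T' -> \bar R) : measurable_fun setT f ->
  (forall x, 0 <= f x)%E -> (\int[P]_w f (Z w) = \int[Q]_x f x)%E.
Proof.
move=> mf f0; rewrite -[LHS]/(\int[P]_(w in X @^-1` setT) (f \o X) w)%E.
rewrite -(@ge0_integral_pushforward _ _ _ _ _ X _ P setT f measurableT mf (fun x _ => f0 x)).
  by apply: eq_measure_integral => A mA _; exact: lawZ.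
exact: mZ.
Qed.

Lemma integrable_law (f : T' -> R) : Q.-integrable setT (EFin \o f) ->
  P.-integrable setT (EFin \o (fun w => f (Z w))).
Proof.
move=> fi; have mf := measurable_int _ fi.
apply/integrableP; split.
  exact: (measurableT_comp mf mZ).
have /integrableP[_] := fi.
by rewrite -(@ge0_integral_law (fun x => `|(EFin \o f) x|%E))//; exact: measurableT_comp.
Qed.

Lemma Rintegral_law (f : T' -> R) : Q.-integrable setT (EFin \o f) ->
  \int[P]_w f (Z w) = \int[Q]_x f x.
Proof.
move=> fi; have mf := measurable_int _ fi.
rewrite /Rintegral; congr fine.
rewrite -[LHS]/(\int[P]_(w in X @^-1` setT) ((EFin \o f) \o X) w)%E.
rewrite -(@integral_pushforward _ _ _ _ _ X _ P setT (EFin \o f))//; last exact: integrable_law.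
by apply: eq_measure_integral => A mA _; exact: lawZ.
Qed.

End law_transfer.

Section independent_family.
Variables (R : realType) (d : measure_display) (T : measurableType d).
Variables (P : probability T R) (I : finType) (Z : I -> T -> R).
Variable F : I -> probability R R.
Hypothesis mZ : forall i, measurable_fun setT (Z i).
Hypothesis lawZ : forall i B, measurable B -> P (Z i @^-1` B) = F i B.
Hypothesis indepZ : forall i j A B, i != j -> measurable A -> measurable B ->
  P (Z i @^-1` A `&` Z j @^-1` B) = (P (Z i @^-1` A) * P (Z j @^-1` B))%E.

Lemma joint_law i j : i != j -> forall A : set (R * R), measurable A ->
  P ((fun w => (Z i w, Z j w)) @^-1` A) = (F i \x F j)%E A.
Proof.
move=> ij; have mZij : measurable_fun setT (fun w => (Z i w, Z j w)).
  exact: measurable_fun_pair.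
have [Q QE _] := pushforward_probability P mZij.
move=> A mA; rewrite -QE; apply/esym.
apply: product_measure_unique => // B C mB mC.
have -> : (F i B * F j C)%E = P (Z i @^-1` B `&` Z j @^-1` C).
  by rewrite indepZ// !lawZ.
exact: QE.
Qed.

Lemma Rintegral_prod_indep i j (f g : R -> R) : i != j ->
  (F i).-integrable setT (EFin \o f) -> (F j).-integrable setT (EFin \o g) ->
  P.-integrable setT (EFin \o (fun w => f (Z i w) * g (Z j w))) /\
  \int[P]_w (f (Z i w) * g (Z j w)) = (\int[F i]_x f x) * (\int[F j]_x g x).
Proof.
move=> ij fi gi.
have mf : measurable_fun setT f by apply/measurable_EFinP; exact: measurable_int fi.
have mg : measurable_fun setT g by apply/measurable_EFinP; exact: measurable_int gi.
pose h (p : R * R) : R := f p.1 * g p.2.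
have mh : measurable_fun setT h.
  by apply: measurable_funM; apply: measurableT_comp.
have mZij : measurable_fun setT (fun w => (Z i w, Z j w)) by exact: measurable_fun_pair.
have ih : (F i \x F j)%E.-integrable setT (EFin \o h).
  apply/integrable12ltyP; first exact/measurable_EFinP.
  rewrite (eq_integral (fun x => (\int[F j]_y `|(g y)%:E|) * `|(f x)%:E|))%E; last first.
    move=> x _; under eq_integral do rewrite /h/= normrM EFinM.
    rewrite ge0_integralZl//; first by rewrite muleC.
    by apply/measurable_EFinP; exact: measurableT_comp.
  rewrite ge0_integralZl//.
  - have /integrableP[_ a] := fi; have /integrableP[_ b] := gi.
    by rewrite lte_mul_pinfty//; [exact: integral_ge0|rewrite ge0_fin_numE//; exact: integral_ge0].
  - by apply/measurable_EFinP; exact: measurableT_comp.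
  - exact: integral_ge0.
have lawE := joint_law ij.
split; first exact: (integrable_law mZij lawE ih).
rewrite (Rintegral_law mZij lawE ih).
rewrite -[LHS]/(fine (\int[(F i \x F j)%E]_p (EFin \o h) p)%E) -integral12_prod_meas1//.
have -> : fubini_F (F j) (EFin \o h) = fun x => ((\int[F j]_y g y) * f x)%:E.
  apply/funext => x; rewrite /fubini_F/= /h/=.
  rewrite integral_EFin_Rintegral; first by rewrite RintegralZl// mulrC.
  by rewrite /comp; under eq_fun do rewrite EFinM; exact: integrableZl.
by rewrite -/(Rintegral _ _ _) RintegralZl// mulrC.
Qed.

(** The [u i (Z i w)] are centred and pairwise independent, so the cross terms of the square vanish.
    The laws [F i] may differ, because both arms form one family. *)
Lemma Rintegral_sum_sqr (u : I -> R -> R) (a : I -> R) :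
  (forall i, (F i).-integrable setT (EFin \o u i)) ->
  (forall i, (F i).-integrable setT (EFin \o (fun x => u i x ^+ 2))) ->
  (forall i, \int[F i]_x u i x = 0) ->
  P.-integrable setT (EFin \o (fun w => (\sum_i a i * u i (Z i w)) ^+ 2)) /\
  \int[P]_w ((\sum_i a i * u i (Z i w)) ^+ 2) =
    \sum_i a i ^+ 2 * \int[F i]_x (u i x ^+ 2).
Proof.
move=> iu iu2 u0.
have E w : (\sum_i a i * u i (Z i w)) ^+ 2 =
    \sum_i \sum_j (a i * a j) * (u i (Z i w) * u j (Z j w)).
  rewrite expr2 mulr_suml; apply: eq_bigr => i _; rewrite mulr_sumr.
  by apply: eq_bigr => j _; ring.
rewrite (funext E).
have H i j : P.-integrable setT (EFin \o (fun w => u i (Z i w) * u j (Z j w))) /\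
    \int[P]_w (u i (Z i w) * u j (Z j w)) = if j == i then \int[F i]_x (u i x ^+ 2) else 0.
  case: eqP => [->|/eqP ji].
    by split; [exact: (integrable_law (mZ i) (lawZ i) (iu2 i))|exact: (Rintegral_law (mZ i) (lawZ i) (iu2 i))].
  have ij : i != j by rewrite eq_sym.
  have [h1 h2] := Rintegral_prod_indep ij (iu i) (iu j).
  by split => //; rewrite h2 u0 mul0r.
have iH i j : P.-integrable setT (EFin \o (fun w => (a i * a j) * (u i (Z i w) * u j (Z j w)))).
  by rewrite /comp; under eq_fun do rewrite EFinM; apply: integrableZl => //; exact: (H i j).1.
have S i := Rintegral_sum (index_enum I) measurableT (iH i).
have [S1 S2] := Rintegral_sum (index_enum I) measurableT (fun i => (S i).1).
split; first exact: S1.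
rewrite S2; apply: eq_bigr => i _; rewrite (S i).2 (bigD1 i)//= big1 ?addr0 => [|j /negPf ji].
  by rewrite RintegralZl//; [rewrite (H i i).2 eqxx expr2|exact: (H i i).1].
by rewrite RintegralZl//; [rewrite (H i j).2 ji mulr0|exact: (H i j).1].
Qed.

End independent_family.

(** * L1 bounds over data and permutations *)

Section outer_L1.
Variables (R : realType) (d : measure_display) (T : measurableType d).
Variables (P : probability T R) (Om : finType).
Hypothesis Om_gt0 : (0 < #|Om|)%N.
Implicit Types (F G : T -> Om -> R) (a b c : R).

(* An upper bound for the L^1 norm of F on T x Om, with the uniform law on Om:
   as the mean over Om is only dominated by a measurable function, no
   measurability of F itself is needed. *)
Definition L1_le F c := exists g : T -> R, [/\ measurable_fun setT g,
  forall w, avg (fun t => `|F w t|) <= g w & (\int[P]_w (g w)%:E <= c%:E)%E].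

Lemma L1_le_mono F G c c' : (forall w, avg (fun t => `|F w t|) <= avg (fun t => `|G w t|)) ->
  c <= c' -> L1_le G c -> L1_le F c'.
Proof.
move=> FG cc' [g [mg Gg gc]]; exists g; split => //.
  by move=> w; apply: le_trans (Gg w).
by apply: le_trans gc _; rewrite lee_fin.
Qed.

Lemma L1_le_dom F G c : (forall w t, `|F w t| <= `|G w t|) -> L1_le G c -> L1_le F c.
Proof. by move=> FG; apply: L1_le_mono => // w; apply: avg_le. Qed.

Lemma L1_le_fun F (g : T -> R) c : measurable_fun setT g ->
  (forall w t, `|F w t| <= g w) -> (\int[P]_w (g w)%:E <= c%:E)%E -> L1_le F c.
Proof.
move=> mg Fg gc; exists g; split => // w.
by rewrite -[leRHS](avg_cst _ Om_gt0); apply: avg_le.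
Qed.

Lemma L1_le_cst c : L1_le (fun _ _ => c) `|c|.
Proof.
apply: (@L1_le_fun _ (fun=> `|c|)) => //.
by rewrite integral_cst// [X in (_ * X)%E](probability_setT P) mule1.
Qed.

Lemma L1_leD F G a b : L1_le F a -> L1_le G b -> L1_le (fun w t => F w t + G w t) (a + b).
Proof.
move=> [f [mf Ff fa]] [g [mg Gg gb]]; exists (fun w => f w + g w); split.
- exact: measurable_funD.
- move=> w; apply: le_trans (lerD (Ff w) (Gg w)); rewrite -avgD.
  by apply: avg_le => t; exact: ler_normD.
- have f0 w : 0 <= f w by apply: le_trans (Ff w); apply: avg_ge0.
  have g0 w : 0 <= g w by apply: le_trans (Gg w); apply: avg_ge0.
  under eq_integral do rewrite EFinD.
  rewrite ge0_integralD//; try (by move=> w _; rewrite lee_fin); try exact/measurable_EFinP.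
  by rewrite EFinD leeD.
Qed.

Lemma L1_leZ x F a : L1_le F a -> L1_le (fun w t => x * F w t) (`|x| * a).
Proof.
move=> [f [mf Ff fa]]; exists (fun w => `|x| * f w); split.
- exact: measurable_funM.
- move=> w; under avg_ext do rewrite normrM.
  by rewrite avgZ ler_wpM2l.
- have f0 w : 0 <= f w by apply: le_trans (Ff w); apply: avg_ge0.
  under eq_integral do rewrite EFinM.
  rewrite ge0_integralZl//; try (by move=> w _; rewrite lee_fin); try exact/measurable_EFinP.
  by rewrite EFinM lee_wpmul2l// lee_fin.
Qed.

Lemma L1_le_sum (I : Type) (r : seq I) (Q : pred I) (F : I -> T -> Om -> R) (a : I -> R) :
  (forall i, L1_le (F i) (a i)) ->
  L1_le (fun w t => \sum_(i <- r | Q i) F i w t) (\sum_(i <- r | Q i) a i).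
Proof.
move=> Fa; elim: r => [|i r IH].
  rewrite big_nil; have := L1_le_cst 0; rewrite normr0; apply: L1_le_dom => w t.
  by rewrite big_nil.
rewrite big_cons; case: ifP => Qi; last first.
  by apply: L1_le_dom IH => w t; rewrite big_cons Qi.
by apply: L1_le_dom (L1_leD (Fa i) IH) => w t; rewrite big_cons Qi.
Qed.

(** Pointwise [|x| <= x ^+ 2 / e + e], according to whether [|x|] exceeds [e]. This passes from
    second to first moments with a free parameter, in place of the Cauchy-Schwarz inequality. *)
Lemma L1_le_sqr F b e : 0 < e -> L1_le (fun w t => F w t ^+ 2) b -> L1_le F (b / e + e).
Proof.
move=> e0 Fb; have H := L1_leD (L1_leZ e^-1 Fb) (L1_le_cst e).
rewrite !gtr0_norm ?invr_gt0// mulrC in H.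
apply: L1_le_dom H => w t; rewrite [leRHS]ger0_norm; last first.
  by rewrite addr_ge0 ?(ltW e0)// mulr_ge0 ?sqr_ge0 ?invr_ge0 ?(ltW e0).
rewrite -[X in e^-1 * X]real_normK ?num_real//; set x := `|_|.
have [xe|ex] := leP x e.
  by rewrite (le_trans xe)// lerDr mulr_ge0 ?sqr_ge0 ?invr_ge0 ?(ltW e0).
rewrite (@le_trans _ _ (e^-1 * x ^+ 2)) ?lerDl ?(ltW e0)//.
by rewrite ler_pdivlMl// expr2 ler_wpM2r ?normr_ge0// ltW.
Qed.

End outer_L1.

Section permuted_sums.
Variables (R : realType) (d : measure_display) (T : measurableType d).
Variables (P : probability T R) (N : nat) (Om : finType).
Variables (p : Om -> 'S_N) (sw : 'I_N -> 'I_N -> Om -> Om).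
Hypothesis sw_inv : forall i j, involutive (sw i j).
Hypothesis Om_gt0 : (0 < #|Om|)%N.
Hypothesis p_sw : forall i j t k, p (sw i j t) k = p t (tperm i j k).
Variables (Z : 'I_N -> T -> R) (F : 'I_N -> probability R R).
Hypothesis mZ : forall i, measurable_fun setT (Z i).
Hypothesis lawZ : forall i B, measurable B -> P (Z i @^-1` B) = F i B.
Hypothesis indepZ : forall i j A B, i != j -> measurable A -> measurable B ->
  P (Z i @^-1` A `&` Z j @^-1` B) = (P (Z i @^-1` A) * P (Z j @^-1` B))%E.
Hypothesis N_gt0 : (0 < N)%N.

Lemma ge0_integral_sum_law (g : R -> R) (q : R) : measurable_fun setT g -> (forall x, 0 <= g x) ->
  (forall i, \int[F i]_x (g x)%:E <= q%:E)%E ->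
  (\int[P]_w (\sum_i g (Z i w))%:E <= (N%:R * q)%:E)%E.
Proof.
move=> mg g0 gq; rewrite (eq_integral (fun w => \sum_i (g (Z i w))%:E)%E); last first.
  by move=> w _; rewrite sumEFin.
rewrite ge0_integral_sum//; last 2 first.
- by move=> i; apply/measurable_EFinP; exact: measurableT_comp.
- by move=> i w _; rewrite lee_fin.
apply: (@le_trans _ _ (\sum_(i < N) q%:E)%E).
  apply: lee_sum => i _; rewrite (ge0_integral_law (mZ i) (lawZ i) (f := fun x => (g x)%:E))//.
  exact/measurable_EFinP.
by rewrite sumEFin sumr_const card_ord mulr_natl.
Qed.

Lemma L1_permsum_sqr (a : 'I_N -> R) (u : R -> R) (q : R) : measurable_fun setT u ->
  \sum_i a i = 0 -> (forall i, \int[F i]_x (u x ^+ 2)%:E <= q%:E)%E ->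
  L1_le P (fun w t => permsum p a (fun k => u (Z k w)) t ^+ 2) (2 * (\sum_i a i ^+ 2) * q).
Proof.
move=> mu a0 uq.
have A0 : 0 <= 2 * \sum_i a i ^+ 2 by rewrite mulr_ge0// sumr_ge0// => i _; rewrite sqr_ge0.
exists (fun w => 2 * (\sum_i a i ^+ 2) * (N%:R^-1 * \sum_k u (Z k w) ^+ 2)).
have mu2 : measurable_fun setT (fun x => u x ^+ 2) by exact: measurable_funX.
have ms : measurable_fun setT (fun w => \sum_k u (Z k w) ^+ 2).
  by apply: measurable_sumf => k; apply: (measurableT_comp mu2 (mZ k)).
split.
- by apply: measurable_funM => //; exact: measurable_funM.
- move=> w; apply: le_trans (avg_permsum_sqr sw_inv Om_gt0 p_sw _ a0).
  by apply: avg_le => t; rewrite ger0_norm// sqr_ge0.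
under eq_integral do rewrite mulrA EFinM.
rewrite ge0_integralZl//.
- apply: le_trans (lee_wpmul2l _ (ge0_integral_sum_law mu2 (fun x => sqr_ge0 _) uq)) _.
    by rewrite lee_fin mulr_ge0// invr_ge0.
  by rewrite -EFinM lee_fin mulrA divfK// pnatr_eq0 -lt0n.
- exact/measurable_EFinP.
- by move=> w _; rewrite lee_fin sumr_ge0// => k _; rewrite sqr_ge0.
- by rewrite lee_fin mulr_ge0// invr_ge0.
Qed.

(** A law of large numbers for an integrable [f] with bounded substitute [fc]. The two replacements
    cost at most [N%:R * eta] each, and the two quadratic deviations [2 * N%:R * c ^+ 2 / e + e] and
    [4 * N%:R * c ^+ 2 / e + e]. When [e] is a small multiple of [n], the bound is small compared
    with [n] for large [n]. *)
Lemma L1_permsum_lln (a : 'I_N -> R) (f fc : R -> R) (c eta e : R) :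
  (forall i, `|a i| <= 1) ->
  (forall i, (F i).-integrable setT (EFin \o f)) ->
  measurable_fun setT fc -> (forall x, `|fc x| <= c) ->
  (forall i, \int[F i]_x (`|f x - fc x|)%:E <= eta%:E)%E -> 0 < e ->
  L1_le P (fun w t => permsum p a (fun k => f (Z k w)) t -
      (\sum_i a i) / N%:R * \sum_i \int[F i]_x f x)
    (2 * N%:R * eta + 6 * N%:R * c ^+ 2 / e + 2 * e).
Proof.
move=> a1 fi mfc fcc feta e0.
have Np : 0 < N%:R :> R by rewrite ltr0n.
pose i0 := Ordinal N_gt0.
have mf : measurable_fun setT f by apply/measurable_EFinP; exact: measurable_int (fi i0).
pose ab := (\sum_i a i) / N%:R.
have ab1 : `|ab| <= 1.
  rewrite normrM normfV (ger0_norm (ltW Np)) ler_pdivrMr// mul1r.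
  apply: le_trans (ler_norm_sum _ _ _) _.
  by rewrite (le_trans (ler_sum _ (fun i _ => a1 i)))// sumr_const card_ord.
have fci i : (F i).-integrable setT (EFin \o fc) by exact: bounded_integrable fcc.
have mu_ : measurable_fun setT (fun x => `|f x - fc x|).
  by apply: measurableT_comp => //; exact: measurable_funB.
(* f = fc + (f - fc); then T2 is the deviation of the permuted sum of fc from its
   mean over the permutations, T3 and T4 compare that mean with the expectation. *)
have T1 : L1_le P (fun w t => permsum p a (fun k => f (Z k w) - fc (Z k w)) t) (N%:R * eta).
  apply: (@L1_le_fun _ _ _ _ _ Om_gt0 _ (fun w => \sum_i `|f (Z i w) - fc (Z i w)|)).
  - by apply: measurable_sumf => i; apply: (measurableT_comp mu_ (mZ i)).
  - move=> w t; rewrite /permsum [leRHS](reindex_inj (@perm_inj _ (p t)))/=.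
    apply: le_trans (ler_norm_sum _ _ _) _; apply: ler_sum => i _.
    by rewrite normrM ler_piMl.
  - exact: (ge0_integral_sum_law mu_ (fun x => normr_ge0 _) feta).
have T2 : L1_le P (fun w t => permsum p (fun i => a i - ab) (fun k => fc (Z k w)) t)
    (2 * N%:R * c ^+ 2 / e + e).
  apply: L1_le_sqr => //.
  have s0 : \sum_i (a i - ab) = 0.
    rewrite sumrB sumr_const card_ord -[ab *+ N]mulr_natr /ab divfK ?subrr//.
    by rewrite gt_eqF.
  have fq i : (\int[F i]_x (fc x ^+ 2)%:E <= (c ^+ 2)%:E)%E.
    apply: (@le_trans _ _ (\int[F i]_x (c ^+ 2)%:E)%E).
      apply: ge0_le_integral => //.
      - by move=> x _; rewrite lee_fin sqr_ge0.
      - by apply/measurable_EFinP; exact: measurable_funX.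
      - move=> x _; rewrite lee_fin -real_normK ?num_real// ler_sqr ?nnegrE//.
        by apply: le_trans (fcc x).
    by rewrite integral_cst// [X in (_ * X)%E](probability_setT (F i)) mule1.
  apply: (L1_le_mono _ _ (L1_permsum_sqr mfc s0 fq)) => // .
  rewrite ler_wpM2r ?sqr_ge0// ler_wpM2l//.
  apply: (@le_trans _ _ (\sum_i a i ^+ 2)).
    have -> : \sum_i (a i - ab) ^+ 2 = \sum_i a i ^+ 2 - N%:R * ab ^+ 2.
      transitivity (\sum_i (a i ^+ 2 - 2 * ab * a i + ab ^+ 2)).
        by apply: eq_bigr => i _; ring.
      rewrite big_split/= sumrB -mulr_sumr sumr_const card_ord -[_ *+ N]mulr_natl.
      have -> : \sum_i a i = N%:R * ab by rewrite /ab mulrC divfK// gt_eqF.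
      by ring.
    by rewrite gerBl mulr_ge0 ?sqr_ge0.
  apply: (@le_trans _ _ (\sum_(i < N) 1)); last by rewrite sumr_const card_ord.
  by apply: ler_sum => i _; rewrite -real_normK ?num_real// expr_le1.
have T3 : L1_le P (fun w (t : Om) => \sum_i (fc (Z i w) - \int[F i]_x fc x))
    (4 * N%:R * c ^+ 2 / e + e).
  apply: L1_le_sqr => //.
  pose m_ i := \int[F i]_x fc x.
  have mb i : `|m_ i| <= c.
    have := @Rintegral_close _ _ _ (F i) fc (cst 0) c c set0 mfc _ measurable0 fcc.
    rewrite Rintegral_cst_prob measure0 mulr0 addr0 subr0; apply => //.
    - by move=> x; rewrite normr0 (le_trans _ (fcc x)).
    - by move=> x _; rewrite subr0.
    - by apply: le_trans (fcc 0).
  pose u i x := fc x - m_ i.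
  have mu i : measurable_fun setT (u i) by exact: measurable_funB.
  have ub i x : `|u i x| <= 2 * c.
    by rewrite (le_trans (ler_normB _ _))// mulrDl mul1r lerD.
  have iu i : (F i).-integrable setT (EFin \o u i) by exact: bounded_integrable (ub i).
  have ub2 i x : `|u i x ^+ 2| <= 4 * c ^+ 2.
    rewrite normrX (_ : 4 * c ^+ 2 = (2 * c) ^+ 2); last by ring.
    by rewrite ler_sqr ?nnegrE// (le_trans (normr_ge0 _) (ub i x)).
  have iu2 i : (F i).-integrable setT (EFin \o (fun x => u i x ^+ 2)).
    by apply: bounded_integrable (ub2 i); exact: measurable_funX.
  have u0 i : \int[F i]_x u i x = 0.
    have ic : (F i).-integrable setT (EFin \o cst (m_ i)).
      by apply: (@bounded_integrable _ _ _ (F i) (cst (m_ i)) `|m_ i|).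
    by rewrite (RintegralB measurableT (fci i) ic) Rintegral_cst_prob subrr.
  have [S1 S2] := Rintegral_sum_sqr mZ lawZ indepZ (fun=> 1) iu iu2 u0.
  have E w : \sum_i 1 * u i (Z i w) = \sum_i (fc (Z i w) - m_ i).
    by apply: eq_bigr => i _; rewrite mul1r.
  apply: (@L1_le_fun _ _ _ _ _ Om_gt0 _ (fun w => (\sum_i 1 * u i (Z i w)) ^+ 2)).
  - by apply/measurable_EFinP; exact: measurable_int S1.
  - by move=> w t; rewrite E ger0_norm ?sqr_ge0.
  - rewrite integral_EFin_Rintegral// S2 lee_fin.
    apply: (@le_trans _ _ (\sum_(i < N) 4 * c ^+ 2)).
      apply: ler_sum => i _; rewrite expr1n mul1r.
      have := @Rintegral_close _ _ _ (F i) (fun x => u i x ^+ 2) (cst 0) (4 * c ^+ 2) (4 * c ^+ 2) set0.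
      rewrite Rintegral_cst_prob measure0 mulr0 addr0 subr0 => H.
      apply: le_trans (ler_norm _) (H _ _ _ _ _ _ _) => //.
      - exact: measurable_funX.
      - by move=> x; rewrite normr0 mulr_ge0 ?sqr_ge0.
      - by move=> x _; rewrite subr0.
      - by rewrite mulr_ge0 ?sqr_ge0.
    by rewrite sumr_const card_ord -[leLHS]mulr_natr mulrAC -mulrA mulrCA.
have T4 : L1_le P (fun w (t : Om) => \sum_i (\int[F i]_x fc x - \int[F i]_x f x)) (N%:R * eta).
  have H := L1_le_cst P Om_gt0 (\sum_i (\int[F i]_x fc x - \int[F i]_x f x)).
  apply: (L1_le_mono _ _ H) => //.
  apply: le_trans (ler_norm_sum _ _ _) _.
  apply: (@le_trans _ _ (\sum_(i < N) eta)); last by rewrite sumr_const card_ord mulr_natl.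
  apply: ler_sum => i _; rewrite distrC -(RintegralB measurableT (fi i) (fci i)).
  have iB : (F i).-integrable setT (EFin \o (fun x => f x - fc x)).
    by rewrite /comp; under eq_fun do rewrite EFinB; exact: (integrableB measurableT (fi i) (fci i)).
  apply: le_trans (le_normr_Rintegral measurableT iB) _.
  rewrite -lee_fin; apply: le_trans (feta i); rewrite /Rintegral fineK//.
  exact: (integrable_fin_num measurableT (integrable_norm iB)).
have TT := L1_leD (L1_leD T1 T2) (L1_leZ ab (L1_leD T3 T4)).
apply: (L1_le_mono _ _ TT).
  move=> w; rewrite le_eqVlt; apply/orP; left; apply/eqP; apply: avg_ext => t.
  congr `|_|.
  have -> : \sum_i (fc (Z i w) - \int[F i]_x fc x) + \sum_i (\int[F i]_x fc x - \int[F i]_x f x)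
     = \sum_i fc (Z (p t i) w) - \sum_i \int[F i]_x f x.
    rewrite -big_split/= -[in RHS](reindex_inj (@perm_inj _ (p t)) (P := xpredT) (F := fun i => fc (Z i w)))/=.
    by rewrite -sumrB; apply: eq_bigr => i _; ring.
  rewrite mulrBr addrA; congr (_ - _).
  rewrite /permsum mulr_sumr -!big_split/=; apply: eq_bigr => i _; ring.
have eta0 : 0 <= eta.
  rewrite -lee_fin; apply: le_trans (feta i0); apply: integral_ge0 => x _.
  by rewrite lee_fin.
have B0 : 0 <= 4 * N%:R * c ^+ 2 / e + e + N%:R * eta.
  apply: addr_ge0; last by rewrite mulr_ge0.
  have e0' := ltW e0; apply: addr_ge0 => //; apply: mulr_ge0; last by rewrite invr_ge0.
  by rewrite mulr_ge0 ?sqr_ge0// mulr_ge0.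
apply: (@le_trans _ _ (N%:R * eta + (2 * N%:R * c ^+ 2 / e + e) +
    (4 * N%:R * c ^+ 2 / e + e + N%:R * eta))).
  by rewrite lerD2l ler_piMl.
rewrite le_eqVlt; apply/orP; left; apply/eqP; ring.
Qed.

End permuted_sums.

(** * Stages and arms *)

Section stage_swap.
Variables (K : nat) (m l : 'I_K -> nat).

(** The factor [tperm i j] stands on the left because positions are exchanged, not observations. *)
Definition stage_swap (s : 'I_K) (i j : 'I_(m s + l s)) (t : Om m l) : Om m l :=
  [ffun k => @eqtype.dfwith _ (fun k => 'S_(m k + l k)) t s (tperm i j * t s)%g k].

Lemma stage_swap_in s i j t : @stage_swap s i j t s = (tperm i j * t s)%g.
Proof. by rewrite ffunE eqtype.dfwith_in. Qed.

Lemma stage_swap_out s i j t k : s != k -> @stage_swap s i j t k = t k.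
Proof. by move=> sk; rewrite ffunE eqtype.dfwith_out. Qed.

Lemma stage_swap_inv s i j : involutive (@stage_swap s i j).
Proof.
move=> t; apply/ffunP => k; have [<-|sk] := eqVneq s k.
  by rewrite !stage_swap_in mulgA tperm2 mul1g.
by rewrite !stage_swap_out.
Qed.

Lemma stage_swap_perm s i j t k : @stage_swap s i j t s k = t s (tperm i j k).
Proof. by rewrite stage_swap_in permM. Qed.

End stage_swap.

Section one_experiment.
Variables (R : realType) (K : nat) (m l : 'I_K -> nat).
Variables (F1 F2 : probability R R).
Variables (d : measure_display) (T : measurableType d) (P : probability T R).
Variables (X Y : nat -> {RV P >-> R}) (tau : forall k : 'I_K, T -> 'S_(m k + l k)).

Local Notation M := (total_size m).
Local Notation L := (total_size l).
Local Notation obs := (@observation T R M L X Y).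
Local Notation Om := (Om m l).

Hypothesis hX : forall i (B : set R), (i < M)%N -> measurable B -> P (X i @^-1` B) = F1 B.
Hypothesis hY : forall j (B : set R), (j < L)%N -> measurable B -> P (Y j @^-1` B) = F2 B.
Hypothesis hindep : mutually_independent P (experiment_events X Y tau).

Definition obs_law (z : 'I_M + 'I_L) : probability R R :=
  match z with inl _ => F1 | inr _ => F2 end.

Lemma obs_lawE z (B : set R) : measurable B -> P (obs z @^-1` B) = obs_law z B.
Proof. by move=> mB; case: z => i; [apply: hX|apply: hY]. Qed.

Lemma obs_indep z z' (A B : set R) : z != z' -> measurable A -> measurable B ->
  P (obs z @^-1` A `&` obs z' @^-1` B) = (P (obs z @^-1` A) * P (obs z' @^-1` B))%E.
Proof.
move=> zz' mA mB.
pose E (i : ('I_M + 'I_L) + 'I_K) : set T := match i with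
  | inl y => obs y @^-1` (if y == z then A else if y == z' then B else setT) | inr k => setT end.
have EE i : experiment_events X Y tau i (E i).
  case: i => [y|k] /=.
    exists (if y == z then A else if y == z' then B else setT); last by rewrite setTI.
    by case: (y == z) => //; case: (y == z').
  by exists setT => //; rewrite setTI preimage_setT.
have e1 : \bigcap_i E i = obs z @^-1` A `&` obs z' @^-1` B.
  apply/seteqP; split => [w H|w [H1 H2] [y|k] _ //].
    have := H (inl z) I; have := H (inl z') I.
    by rewrite /E/= eqxx eq_sym (negPf zz') eqxx.
  rewrite /E/=; case: eqP => [->//|_]; case: eqP => [->//|_ //].
rewrite -e1 (hindep EE) big_sumType/= [X in (_ * X)%:E]big1 ?mulr1; last first.
  by move=> k _; rewrite [P _](probability_setT P).
have z'z : z' != z by rewrite eq_sym.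
rewrite (bigD1 z)//= (bigD1 z')//= eqxx (negPf z'z) eqxx [X in _ * (_ * X)]big1.
  have mP y C : measurable C -> P (obs y @^-1` C) = (fine (P (obs y @^-1` C)))%:E.
    move=> mC; rewrite fineK// fin_num_measure//.
    by rewrite -[_ @^-1` _]setTI; apply: measurable_obs.
  by rewrite mulr1 EFinM -!mP.
move=> y /andP[/negPf -> /negPf ->].
by rewrite preimage_setT [P _](probability_setT P).
Qed.

Definition stage_obs (s : 'I_K) (i : 'I_(m s + l s)) : 'I_M + 'I_L :=
  match fintype.split i with
  | inl a => inl (Ordinal (cum_before_lt (ltn_ord a)))
  | inr b => inr (Ordinal (cum_before_lt (ltn_ord b))) end.

Lemma stage_dataE s i w : stage_data (X ^~ w) (Y ^~ w) (i : 'I_(m s + l s)) = obs (stage_obs i) w.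
Proof. by rewrite /stage_data /stage_obs; case: (fintype.split i). Qed.

Lemma stage_obs_inj s : injective (@stage_obs s).
Proof.
move=> i j; rewrite /stage_obs -{2}(splitK i) -{2}(splitK j).
case: (fintype.split i) => a; case: (fintype.split j) => b //= [/eqP];
  by rewrite eqn_add2l => /eqP/val_inj ->.
Qed.

Definition arm_weight (al be : R) (s : 'I_K) (i : 'I_(m s + l s)) : R :=
  match fintype.split i with inl _ => al | inr _ => be end.

(** One definition serves several purposes: the weights [1, 0] and [0, 1] isolate an arm,
    [gamma^-1, - 1] give a contrast free of the overall level, and [1, 1] give the total, which no
    permutation changes. *)
Definition arm_sum (al be : R) (f : R -> R) (s : 'I_K) (w : T) (t : Om) : R :=
  al * \sum_(i < m s) f (perm_treat (X ^~ w) (Y ^~ w) (fun k => t k) i) +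
  be * \sum_(i < l s) f (perm_ctrl (X ^~ w) (Y ^~ w) (fun k => t k) i).

Lemma sum_arm (s : 'I_K) (g : R -> 'I_(m s + l s) -> R) al be :
  \sum_i g (arm_weight al be i) i =
  \sum_(i < m s) g al (lshift (l s) i) + \sum_(i < l s) g be (rshift (m s) i).
Proof.
rewrite big_split_ord/=; congr (_ + _); apply: eq_bigr => i _.
  by rewrite /arm_weight (unsplitK (inl i : 'I_(m s) + 'I_(l s))).
by rewrite /arm_weight (unsplitK (inr i : 'I_(m s) + 'I_(l s))).
Qed.

Lemma arm_sumE al be f s w t :
  arm_sum al be f s w t = permsum (fun t : Om => t s) (@arm_weight al be s)
    (fun k => f (obs (stage_obs k) w)) t.
Proof.
rewrite /permsum (sum_arm (fun a i => a * f (obs (stage_obs (t s i)) w))) /arm_sum !mulr_sumr.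
by congr (_ + _); apply: eq_bigr => i _; rewrite /perm_treat /perm_ctrl stage_dataE.
Qed.

Lemma sum_arm_weight al be s : \sum_i (@arm_weight al be s i) = al * (m s)%:R + be * (l s)%:R.
Proof. by rewrite (sum_arm (fun a _ => a)) !sumr_const !card_ord !mulr_natr. Qed.

Lemma sum_arm_weight_sqr al be s :
  \sum_i (@arm_weight al be s i) ^+ 2 = al ^+ 2 * (m s)%:R + be ^+ 2 * (l s)%:R.
Proof. by rewrite (sum_arm (fun a _ => a ^+ 2)) !sumr_const !card_ord !mulr_natr. Qed.

Definition stage_law s (i : 'I_(m s + l s)) := obs_law (stage_obs i).

Lemma sum_stage_law s (h : probability R R -> R) :
  \sum_i h (@stage_law s i) = (m s)%:R * h F1 + (l s)%:R * h F2.
Proof.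
rewrite big_split_ord/= !mulr_natl -[in RHS](card_ord (m s)) -[in RHS](card_ord (l s)) -!sumr_const.
congr (_ + _); apply: eq_bigr => i _; rewrite /stage_law /stage_obs.
  by rewrite (unsplitK (inl i : 'I_(m s) + 'I_(l s))).
by rewrite (unsplitK (inr i : 'I_(m s) + 'I_(l s))).
Qed.

Lemma stage_law_ind s (Q : probability R R -> Prop) : Q F1 -> Q F2 -> forall i, Q (@stage_law s i).
Proof. by move=> Q1 Q2 i; rewrite /stage_law; case: (stage_obs i). Qed.

Lemma stage_indep s (i j : 'I_(m s + l s)) A B : i != j -> measurable A -> measurable B ->
  P (obs (stage_obs i) @^-1` A `&` obs (stage_obs j) @^-1` B) =
  (P (obs (stage_obs i) @^-1` A) * P (obs (stage_obs j) @^-1` B))%E.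
Proof. by move=> ij; apply: obs_indep; apply: contra_neq ij; exact: stage_obs_inj. Qed.

Lemma L1_arm_sum_sqr al be (u : R -> R) (q : R) s : (0 < m s + l s)%N ->
  measurable_fun setT u -> al * (m s)%:R + be * (l s)%:R = 0 ->
  (\int[F1]_x (u x ^+ 2)%:E <= q%:E)%E -> (\int[F2]_x (u x ^+ 2)%:E <= q%:E)%E ->
  L1_le P (fun w t => arm_sum al be u s w t ^+ 2)
    (2 * (al ^+ 2 * (m s)%:R + be ^+ 2 * (l s)%:R) * q).
Proof.
move=> N0 mu ab0 q1 q2; rewrite -sum_arm_weight_sqr -(sum_arm_weight al be) in ab0 *.
apply: L1_le_dom (@L1_permsum_sqr _ _ _ P _ _ (fun t : Om => t s) (@stage_swap K m l s)
  (@stage_swap_inv K m l s) (Om_gt0 m l) (@stage_swap_perm K m l s) (fun i => obs (stage_obs i))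
  (@stage_law s) (fun i => measurable_obs X Y (stage_obs i))
  (fun i B mB => obs_lawE (stage_obs i) mB) N0 (@arm_weight al be s) u q mu ab0 _).
  by move=> w t; rewrite arm_sumE.
by apply: (@stage_law_ind s (fun F => (\int[F]_x (u x ^+ 2)%:E <= q%:E)%E)).
Qed.

Lemma L1_arm_sum_lln al be (f fc : R -> R) (c eta e : R) s : (0 < m s + l s)%N ->
  `|al| <= 1 -> `|be| <= 1 ->
  F1.-integrable setT (EFin \o f) -> F2.-integrable setT (EFin \o f) ->
  measurable_fun setT fc -> (forall x, `|fc x| <= c) ->
  (\int[F1]_x (`|f x - fc x|)%:E <= eta%:E)%E -> (\int[F2]_x (`|f x - fc x|)%:E <= eta%:E)%E ->
  0 < e ->
  L1_le P (fun w t => arm_sum al be f s w t -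
      (al * (m s)%:R + be * (l s)%:R) / (m s + l s)%:R *
        ((m s)%:R * \int[F1]_x f x + (l s)%:R * \int[F2]_x f x))
    (2 * (m s + l s)%:R * eta + 6 * (m s + l s)%:R * c ^+ 2 / e + 2 * e).
Proof.
move=> N0 al1 be1 f1 f2 mfc fcc h1 h2 e0.
have a1 i : `|@arm_weight al be s i| <= 1 by rewrite /arm_weight; case: (fintype.split i).
apply: L1_le_dom (@L1_permsum_lln _ _ _ P _ _ (fun t : Om => t s) (@stage_swap K m l s)
  (@stage_swap_inv K m l s) (Om_gt0 m l) (@stage_swap_perm K m l s) (fun i => obs (stage_obs i))
  (@stage_law s) (fun i => measurable_obs X Y (stage_obs i))
  (fun i B mB => obs_lawE (stage_obs i) mB) (@stage_indep s) N0 (@arm_weight al be s) f fc c eta e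
  a1 _ mfc fcc _ e0).
- move=> w t; rewrite arm_sumE sum_arm_weight.
  by rewrite (sum_stage_law s (fun F => \int[F]_x f x)).
- by apply: (@stage_law_ind s (fun F => F.-integrable setT (EFin \o f))).
- by apply: (@stage_law_ind s (fun F => (\int[F]_x (`|f x - fc x|)%:E <= eta%:E)%E)).
Qed.

End one_experiment.

Lemma Rintegral_sqr_sub (R : realType) (F : probability R R) (f : R -> R) (a : R) :
  F.-integrable setT (EFin \o f) -> F.-integrable setT (EFin \o (fun x => f x ^+ 2)) ->
  \int[F]_x (f x - a) ^+ 2 = \int[F]_x (f x ^+ 2) - 2 * a * \int[F]_x f x + a ^+ 2.
Proof.
move=> i2 i1.
have i3 : F.-integrable setT (EFin \o (fun x => 2 * a * f x)).
  by rewrite /comp; under eq_fun do rewrite EFinM; exact: (integrableZl measurableT _ i2).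
have i4 : F.-integrable setT (EFin \o (fun x => f x ^+ 2 - 2 * a * f x)).
  by rewrite /comp; under eq_fun do rewrite EFinB; exact: (integrableB measurableT i1 i3).
have i5 : F.-integrable setT (EFin \o (fun=> a ^+ 2)).
  by apply: (@bounded_integrable _ _ _ F (cst _) `|a ^+ 2|).
transitivity (\int[F]_x ((f x ^+ 2 - 2 * a * f x) + a ^+ 2)).
  by apply: eq_Rintegral => x _; ring.
rewrite (RintegralD measurableT i4 i5) (RintegralB measurableT i1 i3).
by rewrite (RintegralZl (2 * a) measurableT i2) Rintegral_cst_prob.
Qed.

Section finite_variance.
Variables (R : realType) (F : probability R R).
Hypothesis hmean : F.-integrable setT (fun x => x%:E).
Hypothesis hvar : ('V_F[@idfun R] < +oo)%E.

(** Finite variance is the case where [c] is the mean [mu]; another centre changes the square by an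
    affine function of [x], integrable by [hmean]. *)
Lemma integrable_centered_sqr (c : R) : F.-integrable setT (EFin \o (fun x => (x - c) ^+ 2)).
Proof.
pose mu := \int[F]_x x.
have i2 : F.-integrable setT (EFin \o (fun x => (x - mu) ^+ 2)).
  apply/integrableP; split.
    by apply/measurable_EFinP; apply: measurable_funX; exact: measurable_funB.
  move: hvar; rewrite /variance covariance.unlock !expectation.unlock.
  congr (_ < _)%E; apply: eq_integral => x _ /=.
  by rewrite ger0_norm ?sqr_ge0// -/(Rintegral _ _ _) expr2.
rewrite (_ : (fun x => _) = fun x => (x - mu) ^+ 2 + (2 * (mu - c) * x + (c ^+ 2 - mu ^+ 2))); last first.
  by apply/funext => x; ring.
rewrite /comp; under eq_fun do rewrite EFinD.
apply: integrableD => //; under eq_fun do rewrite EFinD.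
apply: integrableD => //.
  by under eq_fun do rewrite EFinM; exact: integrableZl.
by apply: (@bounded_integrable _ _ _ F (cst _) `|c ^+ 2 - mu ^+ 2|).
Qed.

End finite_variance.

(** * The true variance of the difference of means *)

Section variance_mean_diff.
Variables (R : realType) (K : nat) (m l : 'I_K -> nat).
Variables (F1 F2 : probability R R).
Variables (d : measure_display) (T : measurableType d) (P : probability T R).
Variables (X Y : nat -> {RV P >-> R}) (tau : forall k : 'I_K, T -> 'S_(m k + l k)).
Local Notation M := (total_size m).
Local Notation L := (total_size l).
Local Notation obs := (@observation T R M L X Y).
Hypothesis hX : forall i (B : set R), (i < M)%N -> measurable B -> P (X i @^-1` B) = F1 B.
Hypothesis hY : forall j (B : set R), (j < L)%N -> measurable B -> P (Y j @^-1` B) = F2 B.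
Hypothesis hindep : mutually_independent P (experiment_events X Y tau).
Hypothesis hmean1 : F1.-integrable setT (fun x => x%:E).
Hypothesis hmean2 : F2.-integrable setT (fun x => x%:E).
Hypothesis hvar1 : ('V_F1[@idfun R] < +oo)%E.
Hypothesis hvar2 : ('V_F2[@idfun R] < +oo)%E.

Lemma cum_le_total (a : 'I_K -> nat) k : (cum a k <= total_size a)%N.
Proof.
rewrite /cum /total_size [X in (_ <= X)%N](bigID (fun j : 'I_K => (j <= k)%N))/=.
exact: leq_addr.
Qed.

(** The difference of means is a single weighted sum over the observations of both arms, with weight
    0 after stage [k]; once centred, it falls under [Rintegral_sum_sqr]. *)
Lemma variance_mean_diff k : (0 < cum m k)%N -> (0 < cum l k)%N ->
  fine 'V_P[fun w : T => mean_diff m l (X ^~ w) (Y ^~ w) k] =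
  (\int[F1]_x (x - \int[F1]_x x) ^+ 2) / (cum m k)%:R +
  (\int[F2]_x (x - \int[F2]_x x) ^+ 2) / (cum l k)%:R.
Proof.
move=> m0 l0.
pose a (z : 'I_M + 'I_L) : R := match z with
  | inl i => if (i < cum m k)%N then (cum m k)%:R^-1 else 0
  | inr i => if (i < cum l k)%N then - (cum l k)%:R^-1 else 0 end.
pose F (z : 'I_M + 'I_L) := obs_law F1 F2 z.
have aE (b : 'I_M + 'I_L -> R) : \sum_z a z * b z =
    (cum m k)%:R^-1 * (\sum_(i < M | (i < cum m k)%N) b (inl i)) -
    (cum l k)%:R^-1 * (\sum_(i < L | (i < cum l k)%N) b (inr i)).
  rewrite big_sumType/= !mulr_sumr -sumrN; congr (_ + _); rewrite [RHS]big_mkcond/=;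
  by apply: eq_bigr => i _; case: ifP => _; rewrite ?mul0r ?mulNr.
have ZE w : mean_diff m l (X ^~ w) (Y ^~ w) k = \sum_z a z * obs z w.
  rewrite aE /mean_diff /sample_mean.
  by rewrite (big_ord_widen M (fun i => X i w) (cum_le_total m k)) (big_ord_widen L (fun i => Y i w) (cum_le_total l k)).
pose mu z := \int[F z]_x x.
have iF z : (F z).-integrable setT (EFin \o id) by case: z.
have mO z : measurable_fun setT (obs z) by exact: measurable_obs.
have lO z B : measurable B -> P (obs z @^-1` B) = F z B by exact: obs_lawE.
have iO z : P.-integrable setT (EFin \o (fun w => obs z w)).
  exact: (integrable_law (mO z) (lO z) (iF z)).
have iaO z : P.-integrable setT (EFin \o (fun w => a z * obs z w)).
  by rewrite /comp; under eq_fun do rewrite EFinM; exact: (integrableZl measurableT (a z) (iO z)).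
have [S1 S2] := Rintegral_sum (index_enum _) measurableT iaO.
pose c := \sum_z a z * mu z.
have EZ : fine 'E_P[fun w : T => mean_diff m l (X ^~ w) (Y ^~ w) k] = c.
  rewrite expectation.unlock -[LHS]/(\int[P]_w mean_diff m l (X ^~ w) (Y ^~ w) k).
  transitivity (\int[P]_w \sum_z a z * obs z w); first by apply: eq_Rintegral => w _; rewrite ZE.
  rewrite S2; apply: eq_bigr => z _; rewrite (RintegralZl (a z) measurableT (iO z)).
  by rewrite (Rintegral_law (mO z) (lO z) (iF z)).
pose u z (x : R) := x - mu z.
have iu2 z : (F z).-integrable setT (EFin \o (fun x => u z x ^+ 2)).
  by case: z => z; exact: integrable_centered_sqr.
have ic z : (F z).-integrable setT (EFin \o (fun=> mu z)).
  by apply: (@bounded_integrable _ _ _ (F z) (cst _) `|mu z|).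
have iu z : (F z).-integrable setT (EFin \o u z).
  by rewrite /comp /u; under eq_fun do rewrite EFinB; exact: (integrableB measurableT (iF z) (ic z)).
have u0 z : \int[F z]_x u z x = 0.
  by rewrite (RintegralB measurableT (iF z) (ic z)) Rintegral_cst_prob subrr.
have iO2 z z' A B : z != z' -> measurable A -> measurable B ->
    P (obs z @^-1` A `&` obs z' @^-1` B) = (P (obs z @^-1` A) * P (obs z' @^-1` B))%E.
  exact: (obs_indep hindep).
have [_ V] := Rintegral_sum_sqr mO lO iO2 a iu iu2 u0.
rewrite /variance covariance.unlock EZ expectation.unlock.
transitivity (\int[P]_w ((\sum_z a z * u z (obs z w)) ^+ 2)).
  rewrite /Rintegral; congr fine; apply: eq_integral => w _ /=.
  have -> : \sum_z a z * u z (obs z w) = mean_diff m l (X ^~ w) (Y ^~ w) k - c.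
    by rewrite ZE /c -sumrB; apply: eq_bigr => z _; rewrite /u mulrBr.
  by rewrite expr2.
rewrite V big_sumType/=; congr (_ + _).
  transitivity ((\sum_(i < M) (if (i < cum m k)%N then (cum m k)%:R^-1 else 0) ^+ 2) *
    \int[F1]_x (x - \int[F1]_x x) ^+ 2); first by rewrite mulr_suml.
  rewrite mulrC; congr (_ * _).
  rewrite (eq_bigr (fun i : 'I_M => if (i < cum m k)%N then (cum m k)%:R^-2 else 0)); last first.
    by move=> i _; case: ifP => _; rewrite ?expr0n// exprVn.
  rewrite -big_mkcond/= -(big_ord_widen M (fun=> (cum m k)%:R^-2) (cum_le_total m k)).
  by rewrite sumr_const card_ord -mulr_natl; field; rewrite pnatr_eq0 -lt0n.
transitivity ((\sum_(i < L) (if (i < cum l k)%N then - (cum l k)%:R^-1 else 0) ^+ 2) *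
  \int[F2]_x (x - \int[F2]_x x) ^+ 2); first by rewrite mulr_suml.
rewrite mulrC; congr (_ * _).
rewrite (eq_bigr (fun i : 'I_L => if (i < cum l k)%N then (cum l k)%:R^-2 else 0)); last first.
  by move=> i _; case: ifP => _; rewrite ?expr0n// sqrrN exprVn.
rewrite -big_mkcond/= -(big_ord_widen L (fun=> (cum l k)%:R^-2) (cum_le_total l k)).
by rewrite sumr_const card_ord -mulr_natl; field; rewrite pnatr_eq0 -lt0n.
Qed.

End variance_mean_diff.

(** * The permuted statistic as a function of arm sums *)

Section perm_stat_arm_sums.
Variables (R : realType) (K : nat) (m l : 'I_K -> nat).
Variables (d : measure_display) (T : measurableType d) (P : probability T R).
Variables (X Y : nat -> {RV P >-> R}).
Variables (gamma : R).
Hypothesis gamma_gt0 : 0 < gamma.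
Hypothesis mE : forall k, (m k)%:R = gamma * (l k)%:R.
Hypothesis l_gt0 : forall k, (0 < l k)%N.

Local Notation asum := (@arm_sum R K m l d T P X Y).

Definition cum_arm_sum (al be : R) (f : R -> R) (k : 'I_K) (w : T) (t : Om m l) : R :=
  \sum_(s < K | (s <= k)%N) asum al be f s w t.

Lemma cumE k : (cum m k)%:R = gamma * (cum l k)%:R.
Proof. by rewrite /cum !natr_sum mulr_sumr; apply: eq_bigr => s _; rewrite mE. Qed.

Lemma cum_gt0 k : 0 < (cum l k)%:R :> R.
Proof. by rewrite ltr0n /cum (bigD1 k)//= addn_gt0 l_gt0. Qed.

(* the sample variance of M observations with sum s1 and sum of squares s2 *)
Definition arm_var (M s1 s2 : R) : R := M / (M - 1) * (s2 / M - (s1 / M) ^+ 2).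

Lemma cum_var_arm (a : 'I_K -> nat) (z : forall s : 'I_K, 'I_(a s) -> R) k : (cum a k)%:R != 0 :> R ->
  cum_var z k = arm_var (cum a k)%:R (\sum_(s < K | (s <= k)%N) \sum_(i < a s) z s i)
    (\sum_(s < K | (s <= k)%N) \sum_(i < a s) z s i ^+ 2).
Proof.
move=> a0; rewrite /cum_var /arm_var /cum_mean.
set S1 := \sum_(s < K | _) \sum_i z s i; set S2 := \sum_(s < K | _) \sum_i z s i ^+ 2.
set c := _^-1 * S1.
have -> : \sum_(s < K | (s <= k)%N) \sum_(i < a s) (z s i - c) ^+ 2 =
    S2 - 2 * c * S1 + (cum a k)%:R * c ^+ 2.
  rewrite /S1 /S2 /cum natr_sum !mulr_sumr mulr_suml -sumrB -big_split/=; apply: eq_bigr => s _.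
  rewrite mulr_sumr (_ : (a s)%:R * _ = \sum_(i < a s) c ^+ 2); last by rewrite sumr_const card_ord mulr_natl.
  rewrite -sumrB -big_split/=.
  by apply: eq_bigr => i _; ring.
have -> : S1 / (cum a k)%:R = c by rewrite /c mulrC.
have S1E : S1 = (cum a k)%:R * c by rewrite mulVKf.
rewrite [_%:R / _]mulrC -[RHS]mulrA; congr (_ * _).
by rewrite mulrBr [_ * (S2 / _)]mulrC divfK// S1E; ring.
Qed.

Definition perm_var k w t : R :=
  (1 + gamma)^-1 * arm_var (cum m k)%:R (cum_arm_sum 1 0 id k w t)
     (cum_arm_sum 1 0 (fun x => x ^+ 2) k w t) +
  gamma / (1 + gamma) * arm_var (cum l k)%:R (cum_arm_sum 0 1 id k w t)
     (cum_arm_sum 0 1 (fun x => x ^+ 2) k w t).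

(** By the fixed ratio [gamma], the normalizing factor is a constant times the square root of
    [cum l k], and the difference of means is a contrast divided by [cum l k]. All dependence on the
    permutations is now in arm sums. *)
Lemma perm_statE k w (t : Om m l) :
  perm_stat (X ^~ w) (Y ^~ w) (fun k => t k) k =
  Num.sqrt (gamma / (1 + gamma)) * (Num.sqrt (cum l k)%:R)^-1 *
  cum_arm_sum gamma^-1 (- 1) id k w t / Num.sqrt (perm_var k w t).
Proof.
have L0 := cum_gt0 k; have g1 : 0 < 1 + gamma by rewrite addr_gt0.
have M0 : 0 < (cum m k)%:R :> R by rewrite cumE mulr_gt0.
have MLE : gamma * (cum l k)%:R + (cum l k)%:R = (1 + gamma) * (cum l k)%:R by ring.
rewrite /perm_stat !cum_var_arm ?gt_eqF//; congr (_ / Num.sqrt _); last first.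
  rewrite /perm_var /cum_arm_sum /arm_sum; congr (_ * arm_var _ _ _ + _ * arm_var _ _ _).
  - by rewrite cumE MLE; field; rewrite !gt_eqF.
  - by apply: eq_bigr => s _; rewrite mul1r mul0r addr0.
  - by apply: eq_bigr => s _; rewrite mul1r mul0r addr0.
  - by rewrite cumE MLE; field; rewrite !gt_eqF.
  - by apply: eq_bigr => s _; rewrite mul1r mul0r add0r.
  - by apply: eq_bigr => s _; rewrite mul1r mul0r add0r.
have -> : cum_mean (perm_treat (X ^~ w) (Y ^~ w) (fun k => t k)) k -
    cum_mean (perm_ctrl (X ^~ w) (Y ^~ w) (fun k => t k)) k =
    (cum l k)%:R^-1 * cum_arm_sum gamma^-1 (- 1) id k w t.
  rewrite /cum_mean /cum_arm_sum /arm_sum cumE invfM [gamma^-1 * _]mulrC -mulrA -mulrBr; congr (_ * _).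
  by rewrite mulr_sumr -sumrB; apply: eq_bigr => s _; rewrite mulN1r.
rewrite mulrA; congr (_ * _).
rewrite (_ : _ / (_ + _) = gamma / (1 + gamma) * (cum l k)%:R); last first.
  by rewrite cumE MLE; field; rewrite !gt_eqF.
rewrite sqrtrM ?divr_ge0 ?(ltW g1) ?(ltW gamma_gt0)// -mulrA; congr (_ * _).
rewrite -{2}(sqr_sqrtr (ltW L0)) expr2 invfM mulrA divff ?mul1r//.
by rewrite gt_eqF// sqrtr_gt0.
Qed.

End perm_stat_arm_sums.

(** * Calculus of vanishing L1 bounds *)

Section vanishing.
Variables (R : realType) (d : nat -> measure_display) (T : forall n, measurableType (d n)).
Variables (P : forall n, probability (T n) R) (Om : nat -> finType).
Hypothesis Om_gt0 : forall n, (0 < #|Om n|)%N.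
Implicit Types F G : forall n, T n -> Om n -> R.

Definition L1_cvg0 F := forall e : R, 0 < e -> \forall n \near \oo, L1_le (P n) (F n) e.

Lemma L1_cvg0_mono F G :
  (\forall n \near \oo, forall w, avg (fun t => `|F n w t|) <= avg (fun t => `|G n w t|)) ->
  L1_cvg0 G -> L1_cvg0 F.
Proof.
by move=> FG G0 e e0; near=> n; apply: (@L1_le_mono _ _ _ (P n) _ (F n) (G n) e);
  [near: n|exact: lexx|near: n; exact: G0].
Unshelve. all: by end_near. Qed.

Lemma L1_cvg0_dom F G : (\forall n \near \oo, forall w t, `|F n w t| <= `|G n w t|) ->
  L1_cvg0 G -> L1_cvg0 F.
Proof.
move=> FG; apply: L1_cvg0_mono; near=> n => w; apply: avg_le => t.
by move: w t; near: n.
Unshelve. all: by end_near. Qed.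

Lemma L1_cvg0_cst (c : nat -> R) : c n @[n --> \oo] --> 0 -> L1_cvg0 (fun n _ _ => c n).
Proof.
move=> c0 e e0; near=> n.
apply: (@L1_le_mono _ _ _ (P n) _ _ (fun _ _ => c n) `|c n|) => //.
  by near: n; apply: cvgr0_norm_le.
exact: L1_le_cst.
Unshelve. all: by end_near. Qed.

Lemma L1_cvg0D F G : L1_cvg0 F -> L1_cvg0 G -> L1_cvg0 (fun n w t => F n w t + G n w t).
Proof.
move=> F0 G0 e e0; have e20 : 0 < e / 2 by rewrite divr_gt0.
near=> n; rewrite [e]splitr; apply: L1_leD; near: n; [exact: F0|exact: G0].
Unshelve. all: by end_near. Qed.

Lemma L1_cvg0Z (x : nat -> R) c F : (\forall n \near \oo, `|x n| <= c) ->
  L1_cvg0 F -> L1_cvg0 (fun n w t => x n * F n w t).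
Proof.
move=> xc F0 e e0; pose C := `|c| + 1; have c0 : 0 < C by rewrite ltr_wpDl.
near=> n.
apply: (@L1_le_mono _ _ _ (P n) _ _ (fun w t => C * F n w t) (`|C| * (e / C))).
- move=> w; apply: avg_le => t; rewrite !normrM ler_wpM2r//.
  rewrite [leRHS]gtr0_norm// ler_wpDr//; apply: le_trans (ler_norm c).
  by near: n.
- by rewrite gtr0_norm// mulrC divfK// gt_eqF.
- apply: L1_leZ; near: n; apply: F0; exact: divr_gt0.
Unshelve. all: by end_near. Qed.

Lemma L1_cvg0_sum (I : Type) (r : seq I) (Q : pred I) (F : I -> forall n, T n -> Om n -> R) :
  (forall i, L1_cvg0 (F i)) -> L1_cvg0 (fun n w t => \sum_(i <- r | Q i) F i n w t).
Proof.
move=> F0; elim: r => [|i r IH].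
  apply: L1_cvg0_dom (L1_cvg0_cst (cvg_cst (0:R))).
  by near=> n => w t; rewrite big_nil.
case Qi : (Q i); last first.
  by apply: L1_cvg0_dom IH; near=> n => w t; rewrite big_cons Qi.
by apply: L1_cvg0_dom (L1_cvg0D (F0 i) IH); near=> n => w t; rewrite big_cons Qi.
Unshelve. all: by end_near. Qed.

Lemma L1_cvg0_norm F : L1_cvg0 F -> L1_cvg0 (fun n w t => `|F n w t|).
Proof.
by apply: L1_cvg0_dom; near=> n => w t; rewrite normr_id.
Unshelve. all: by end_near. Qed.

Lemma L1_cvg0_avg F : L1_cvg0 F -> L1_cvg0 (fun n w _ => avg (F n w)).
Proof.
apply: L1_cvg0_mono; near=> n => w.
by rewrite avg_cst// norm_avg_le.
Unshelve. all: by end_near. Qed.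

(* Convergence in probability to a constant, on the product of the data space
   with the uniform space of permutations. *)
Definition prod_cvg F (a : R) := L1_cvg0 (fun n w t => Num.min 1 `|F n w t - a|).

Lemma min1_ge0 (x : R) : 0 <= Num.min 1 `|x|.
Proof. by rewrite le_min ler01 normr_ge0. Qed.

Lemma prod_cvg_L1 F a : L1_cvg0 (fun n w t => F n w t - a) -> prod_cvg F a.
Proof.
apply: L1_cvg0_dom; near=> n => w t.
by rewrite ger0_norm ?min1_ge0// ge_min lexx orbT.
Unshelve. all: by end_near. Qed.

Lemma prod_cvg_cst (c : nat -> R) a : c n @[n --> \oo] --> a -> prod_cvg (fun n _ _ => c n) a.
Proof.
by move=> ca; apply: prod_cvg_L1; apply: L1_cvg0_cst; rewrite -(subrr a); apply: cvgB => //; exact: cvg_cst.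
Qed.

Lemma prod_cvg_dom F a (H : forall n, T n -> Om n -> R) :
  (\forall n \near \oo, forall w t, Num.min 1 `|F n w t - a| <= H n w t) -> L1_cvg0 H -> prod_cvg F a.
Proof.
move=> FH; apply: L1_cvg0_dom; near=> n => w t.
rewrite ger0_norm ?min1_ge0//; apply: le_trans (ler_norm _).
by move: w t; near: n.
Unshelve. all: by end_near. Qed.

Lemma prod_cvgD F G a b : prod_cvg F a -> prod_cvg G b ->
  prod_cvg (fun n w t => F n w t + G n w t) (a + b).
Proof.
move=> Fa Gb; apply: prod_cvg_dom (L1_cvg0D Fa Gb); near=> n => w t.
rewrite opprD addrACA; set x := F _ _ _ - a; set y := G _ _ _ - b.
have := ler_normD x y; have := normr_ge0 x; have := normr_ge0 y; move: `|x| `|y| `|x + y| => p q r q0 p0 h.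
have [p1|/ltW p1] := leP 1 p; rewrite ?(min_l p1) ?(min_r p1);
  have [q1|/ltW q1] := leP 1 q; rewrite ?(min_l q1) ?(min_r q1) ge_min; apply/orP;
  first [by left; lra|by right; lra].
Unshelve. all: by end_near. Qed.

Lemma prod_cvgM F G a b : prod_cvg F a -> prod_cvg G b ->
  prod_cvg (fun n w t => F n w t * G n w t) (a * b).
Proof.
move=> Fa Gb.
have c0 : 0 <= 1 + `|a| + `|b| by rewrite !addr_ge0.
have K : L1_cvg0 (fun n w t => (1 + `|a| + `|b|) *
    (Num.min 1 `|F n w t - a| + Num.min 1 `|G n w t - b|)).
  apply: (L1_cvg0Z (x := fun=> 1 + `|a| + `|b|) (c := `|1 + `|a| + `|b| |)) (L1_cvg0D Fa Gb).
  by near=> n.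
apply: prod_cvg_dom K; near=> n => w t.
rewrite (_ : F n w t * G n w t - a * b = (F n w t - a) * (G n w t - b) +
  a * (G n w t - b) + b * (F n w t - a)); last by ring.
set x := F _ _ _ - a; set y := G _ _ _ - b.
apply: (@le_trans _ _ (Num.min 1 (`|x| * `|y| + `|a| * `|y| + `|b| * `|x|))).
  rewrite le_min !ge_min lexx/=; apply/orP; right.
  by rewrite -!normrM (le_trans (ler_normD _ _))// lerD2r ler_normD.
have := normr_ge0 x; have := normr_ge0 y; have := normr_ge0 a; have := normr_ge0 b.
move: `|x| `|y| `|a| `|b| => p q u v v0 u0 q0 p0.
have [p1|p1] := ltP 1 p.
  by rewrite ge_min; apply/orP; left; rewrite /Num.min; case: ltP => _; nra.
have [q1|q1] := ltP 1 q.
  by rewrite ge_min; apply/orP; left; nra.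
by rewrite ge_min; apply/orP; right; nra.
Unshelve. all: by end_near. Qed.

Lemma prod_cvgZ (x : R) F a : prod_cvg F a -> prod_cvg (fun n w t => x * F n w t) (x * a).
Proof. by apply: prod_cvgM; apply: prod_cvg_cst; exact: cvg_cst. Qed.

Lemma prod_cvg_sum (I : Type) (r : seq I) (Q : pred I)
    (F : I -> forall n, T n -> Om n -> R) (a : I -> R) :
  (forall i, prod_cvg (F i) (a i)) ->
  prod_cvg (fun n w t => \sum_(i <- r | Q i) F i n w t) (\sum_(i <- r | Q i) a i).
Proof.
move=> Fa; elim: r => [|i r IH].
  rewrite big_nil; apply: L1_cvg0_dom (prod_cvg_cst (cvg_cst (0:R))).
  by near=> n => w t; rewrite big_nil.
rewrite big_cons; case Qi : (Q i); last first.
  by apply: L1_cvg0_dom IH; near=> n => w t; rewrite big_cons Qi.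
by apply: L1_cvg0_dom (prod_cvgD (Fa i) IH); near=> n => w t; rewrite big_cons Qi.
Unshelve. all: by end_near. Qed.

(** Continuous mapping: either the value is within [dl] of [a], where [h] moves by at most [e / 2],
    or the truncated distance is at least [D], and then 1 is at most [D^-1] times that distance. *)
Lemma prod_cvg_comp F a (h : R -> R) : {for a, continuous h} -> prod_cvg F a ->
  prod_cvg (fun n w t => h (F n w t)) (h a).
Proof.
move=> hc Fa e e0; have e20 : 0 < e / 2 by rewrite divr_gt0.
have [dl /= dl0 H] : exists2 dl : R, 0 < dl & forall x, `|x - a| < dl -> `|h x - h a| <= e / 2.
  move/cvgrPdist_le: (hc) => /(_ _ e20)/nbhs_ballP[dl /= dl0 H]; exists dl => // x xa.
  by rewrite distrC; apply: H; rewrite /ball/= distrC.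
pose D := Num.min 1 dl; have D0 : 0 < D by rewrite lt_min ltr01.
near=> n; rewrite [e]splitr.
have K1 : L1_le (P n) (fun w t => D^-1 * Num.min 1 `|F n w t - a|) (`|D^-1| * (D * (e / 2))).
  by apply: L1_leZ; near: n; apply: Fa; rewrite mulr_gt0.
rewrite gtr0_norm ?invr_gt0// mulKf ?gt_eqF// in K1.
have K2 : L1_le (P n) (fun (_ : T n) (_ : Om n) => e / 2) (e / 2).
  by rewrite -{2}(gtr0_norm e20); apply: L1_le_cst.
apply: L1_le_dom (L1_leD K1 K2) => w t.
rewrite ger0_norm ?min1_ge0//; apply: le_trans (ler_norm _).
have [xa|xa] := ltP `|F n w t - a| dl.
  rewrite ge_min; apply/orP; right; apply: (le_trans (H _ xa)).
  by rewrite lerDr mulr_ge0 ?min1_ge0// invr_ge0 ltW.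
rewrite ge_min; apply/orP; left; rewrite ler_wpDr ?(ltW e20)//.
by rewrite ler_pdivlMl// mulr1 /D le_min !ge_min lexx/= xa orbT.
Unshelve. all: by end_near. Qed.

(** Slutsky's argument for a factor [F] with bounded second moments: where [|F| > A] Chebyshev's
    bound [F ^+ 2 / A ^+ 2] is used; elsewhere the truncated product is at most [1 + A] times the
    truncated distance of [G] from [b]. *)
Lemma prod_cvg_tight F G C b : (\forall n \near \oo, L1_le (P n) (fun w t => F n w t ^+ 2) C) ->
  prod_cvg G b -> prod_cvg (fun n w t => (G n w t - b) * F n w t) 0.
Proof.
move=> FC Gb e e0; have e20 : 0 < e / 2 by rewrite divr_gt0.
(* Chosen so that [C / A ^+ 2 <= e / 2]; the added 1 keeps [A] positive. *)
pose A := Num.sqrt ((`|C| + 1) / (e / 2)).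
have A2 : A ^+ 2 = (`|C| + 1) / (e / 2).
  by rewrite sqr_sqrtr// divr_ge0 ?(ltW e20)// addr_ge0.
have c0 : 0 < `|C| + 1 by rewrite ltr_wpDl.
have A0 : 0 < A by rewrite sqrtr_gt0 divr_gt0.
pose B := 1 + A; have B0 : 0 < B by rewrite addr_gt0.
near=> n.
have K1 : L1_le (P n) (fun w t => B * Num.min 1 `|G n w t - b|) (`|B| * (B^-1 * (e / 2))).
  by apply: L1_leZ; near: n; apply: Gb; rewrite mulr_gt0// invr_gt0.
have K2 : L1_le (P n) (fun w t => (A ^+ 2)^-1 * F n w t ^+ 2) (`|(A ^+ 2)^-1| * C).
  by apply: L1_leZ; near: n.
apply: (L1_le_mono _ _ (L1_leD K1 K2)); last first.
  rewrite gtr0_norm// mulVKf ?gt_eqF// ger0_norm ?invr_ge0 ?sqr_ge0// A2 invf_div.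
  rewrite [leRHS]splitr lerD2l mulrAC ler_pdivrMr// ler_wpM2l ?(ltW e20)//.
  by apply: le_trans (ler_norm C) _; rewrite lerDl.
move=> w; apply: avg_le => t.
rewrite ger0_norm ?min1_ge0//; apply: le_trans (ler_norm _).
rewrite subr0 normrM -[F n w t ^+ 2]real_normK ?num_real//.
have := normr_ge0 (F n w t); have := normr_ge0 (G n w t - b).
move: `|F n w t| `|G n w t - b| => f g g0 f0.
have [fA|fA] := ltP A f.
  rewrite ge_min; apply/orP; left; rewrite ler_wpDl ?mulr_ge0 ?(ltW B0) ?le_min ?ler01//.
  by rewrite ler_pdivlMl ?exprn_gt0// mulr1 lerXn2r ?nnegrE// ltW.
apply: (@le_trans _ _ (B * Num.min 1 g)); last first.
  by rewrite lerDl mulr_ge0 ?invr_ge0 ?sqr_ge0.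
rewrite {2}/Num.min; case: ltP => g1.
  by rewrite ge_min /B mulr1 lerDl (ltW A0).
by rewrite ge_min; apply/orP; right; rewrite /B mulrC ler_wpM2r// ler_wpDl.
Unshelve. all: by end_near. Qed.

(** Convergence in probability suffices because the difference of two cosines is bounded by 2 and by
    the distance of the arguments, hence by twice the truncated distance. *)
Lemma L1_cvg0_cos F G : prod_cvg (fun n w t => F n w t - G n w t) 0 ->
  L1_cvg0 (fun n w t => cos (F n w t) - cos (G n w t)).
Proof.
move=> FG; have K := L1_cvg0Z (x := fun=> 2) (c := 2) _ FG.
apply: (L1_cvg0_dom _ (K _)); last by near=> n; rewrite ger0_norm.
near=> n => w t; rewrite subr0 [leRHS]ger0_norm ?mulr_ge0 ?min1_ge0//.
have h1 := cos_lipschitz (F n w t) (G n w t).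
have h2 : `|cos (F n w t) - cos (G n w t)| <= 2.
  by rewrite (le_trans (ler_normB _ _))// (_ : 2 = 1 + 1)// lerD// ler_norml cos_geN1 cos_le1.
by have [p1|/ltW p1] := leP 1 `|F n w t - G n w t|;
  rewrite ?(min_l p1) ?(min_r p1); have := normr_ge0 (F n w t - G n w t); lra.
Unshelve. all: by end_near. Qed.

End vanishing.

(** * Truncation *)

Section truncation.
Variables (R : realType) (F : probability R R).

Lemma dominated_Rintegral_cvg (f_ : nat -> R -> R) (f g : R -> R) :
  (forall j, measurable_fun setT (f_ j)) -> measurable_fun setT f ->
  (forall x, \forall j \near \oo, f_ j x = f x) ->
  (forall j x, `|f_ j x| <= g x) -> F.-integrable setT (EFin \o g) ->
  \int[F]_x f_ j x @[j --> \oo] --> \int[F]_x f x.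
Proof.
move=> mf_ mf ff fg ig.
have D1 j : measurable_fun setT (EFin \o f_ j) by apply/measurable_EFinP.
have D2 : measurable_fun setT (EFin \o f) by apply/measurable_EFinP.
have D3 x : setT x -> (EFin \o f_ j) x @[j --> \oo] --> (EFin \o f) x.
  move=> _; apply: cvg_near_cst; near=> j; congr EFin; by near: j.
have D5 x j : setT x -> (`|(EFin \o f_ j) x| <= (EFin \o g) x)%E.
  by move=> _; rewrite /= lee_fin.
have [If _ C] := @dominated_convergence _ _ _ F setT measurableT (fun j => EFin \o f_ j)
  (EFin \o f) _ D1 D2 (aeW F D3) ig (aeW F D5).
apply: fine_cvg; rewrite -/(Rintegral F setT f) -integral_EFin_Rintegral//; exact: C.
Unshelve. all: end_near. Qed.

Definition trunc (j : nat) (f : R -> R) (x : R) : R := if `|f x| <= j%:R then f x else 0.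

Lemma trunc_bound j f x : `|trunc j f x| <= j%:R.
Proof. by rewrite /trunc; case: ifP; rewrite ?normr0. Qed.

Lemma norm_trunc_le j f x : `|trunc j f x| <= `|f x|.
Proof. by rewrite /trunc; case: ifP; rewrite ?normr0. Qed.

Lemma norm_sub_trunc_le j f x : `|f x - trunc j f x| <= `|f x|.
Proof. by rewrite /trunc; case: ifP; rewrite ?subrr ?normr0 ?subr0. Qed.

Lemma trunc_near f x : \forall j \near \oo, trunc j f x = f x.
Proof.
near=> j; rewrite /trunc ifT//; near: j; exact: nbhs_infty_ger.
Unshelve. all: end_near. Qed.

Lemma measurable_trunc j f : measurable_fun setT f -> measurable_fun setT (trunc j f).
Proof.
move=> mf; apply: measurable_fun_ifT => //; apply: measurable_fun_ler => //.
exact: measurableT_comp.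
Qed.

Lemma L1_trunc f e : measurable_fun setT f -> F.-integrable setT (EFin \o f) -> 0 < e ->
  \forall j \near \oo, (\int[F]_x (`|f x - trunc j f x|)%:E <= e%:E)%E.
Proof.
move=> mf fi e0.
have md j : measurable_fun setT (fun x => `|f x - trunc j f x|).
  apply: measurableT_comp => //; apply: measurable_funB => //; exact: measurable_trunc.
have C : \int[F]_x `|f x - trunc j f x| @[j --> \oo] --> \int[F]_x 0.
  apply: (@dominated_Rintegral_cvg _ _ (fun x => `|f x|)) => //.
  - by move=> x; near=> j; rewrite [trunc j f x](_ : _ = f x) ?subrr ?normr0//; near: j; exact: trunc_near.
  - by move=> j x; rewrite normr_id norm_sub_trunc_le.
  - exact: integrable_norm fi.
near=> j; rewrite integral_EFin_Rintegral; last first.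
  apply: le_integrable fi => //; first exact/measurable_EFinP.
  by move=> x _; rewrite /= lee_fin normr_id norm_sub_trunc_le.
rewrite lee_fin; near: j.
rewrite Rintegral_cst_prob in C.
near=> j; apply: le_trans (ler_norm _) _; near: j; exact: cvgr0_norm_le.
Unshelve. all: end_near. Qed.

Hypothesis i2 : F.-integrable setT (EFin \o (fun x => x ^+ 2)).

Lemma L2_trunc e : 0 < e ->
  \forall j \near \oo, (\int[F]_x ((x - trunc j id x) ^+ 2)%:E <= e%:E)%E.
Proof.
move=> e0.
have mt j := measurable_trunc j (@measurable_id _ R setT).
have md j : measurable_fun setT (fun x : R => (x - trunc j id x) ^+ 2).
  by apply: measurable_funX; exact: measurable_funB.
have dle j (x : R) : `|(x - trunc j id x) ^+ 2| <= x ^+ 2.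
  by rewrite normrX -[leRHS]real_normK ?num_real// lerXn2r ?nnegrE// norm_sub_trunc_le.
have C : \int[F]_x (x - trunc j id x) ^+ 2 @[j --> \oo] --> \int[F]_x 0.
  apply: (@dominated_Rintegral_cvg _ _ (fun x => x ^+ 2)) => //.
  by move=> x; near=> j; rewrite [trunc j id x](_ : _ = x) ?subrr ?expr0n//; near: j; exact: trunc_near.
near=> j; rewrite integral_EFin_Rintegral; last first.
  apply: le_integrable i2 => //; first exact/measurable_EFinP.
  by move=> x _; rewrite /= lee_fin (le_trans (dle j x))// ler_norm.
rewrite lee_fin; near: j.
rewrite Rintegral_cst_prob in C.
near=> j; apply: le_trans (ler_norm _) _; near: j; exact: cvgr0_norm_le.
Unshelve. all: end_near. Qed.

Lemma trunc_sqr_cvg : \int[F]_x (trunc j id x) ^+ 2 @[j --> \oo] --> \int[F]_x (x ^+ 2).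
Proof.
apply: (@dominated_Rintegral_cvg _ _ (fun x => x ^+ 2)) => //.
- by move=> j; apply: measurable_funX; exact: measurable_trunc.
- by move=> x; near=> j; rewrite [trunc j id x](_ : _ = x)//; near: j; exact: trunc_near.
- by move=> j x; rewrite normrX -[leRHS]real_normK ?num_real// lerXn2r ?nnegrE// norm_trunc_le.
Unshelve. all: end_near. Qed.

Lemma trunc_mean_cvg : F.-integrable setT (EFin \o id) ->
  \int[F]_x trunc j id x @[j --> \oo] --> \int[F]_x x.
Proof.
move=> i1; apply: (@dominated_Rintegral_cvg _ _ (fun x => `|x|)) => //.
- by move=> j; exact: measurable_trunc.
- by move=> x; exact: trunc_near.
- by move=> j x; exact: norm_trunc_le.
- exact: integrable_norm i1.
Unshelve. all: end_near. Qed.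

End truncation.

(** * Stage sizes *)

Lemma cvg_seq_sum (R : realType) (I : Type) (r : seq I) (Q : pred I) (f : I -> nat -> R) (a : I -> R) :
  (forall i, Q i -> f i n @[n --> \oo] --> a i) ->
  \sum_(i <- r | Q i) f i n @[n --> \oo] --> \sum_(i <- r | Q i) a i.
Proof. by move=> fa; apply: cvg_big => //; exact: add_continuous. Qed.

Section stage_sizes.
Variables (R : realType) (K : nat) (m l : nat -> 'I_K -> nat) (gamma : R).
Hypothesis gamma_gt0 : 0 < gamma.
Hypothesis hratio : forall n k, (m n k)%:R / (l n k)%:R = gamma.

Lemma stage_gt0 n k : (0 < l n k)%N.
Proof.
rewrite lt0n; apply/eqP => l0; move: (hratio n k) gamma_gt0.
by rewrite l0 invr0 mulr0 => <-; rewrite ltxx.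
Qed.

Lemma stage_ratio n k : (m n k)%:R = gamma * (l n k)%:R.
Proof. by rewrite -(hratio n k) divfK// pnatr_eq0 -lt0n stage_gt0. Qed.

Variables (s1 s2 : R) (Istar : 'I_K -> R).
Hypothesis hK : (0 < K)%N.
Hypothesis s1_ge0 : 0 <= s1.
Hypothesis s2_ge0 : 0 <= s2.
Hypothesis hIstar : forall k, 0 < Istar k.
Hypothesis hinfo : forall k,
  (n%:R * (s1 / (cum (m n) k)%:R + s2 / (cum (l n) k)%:R))^-1 @[n --> \oo] --> Istar k.

Local Notation v := (s1 / gamma + s2).

Lemma info_invE n k : (n%:R * (s1 / (cum (m n) k)%:R + s2 / (cum (l n) k)%:R))^-1 =
  v^-1 * ((cum (l n) k)%:R / n%:R).
Proof.
rewrite (cumE (stage_ratio n)); have := cum_gt0 R (stage_gt0 n) k; move: (_%:R) => L L0.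
rewrite (_ : s1 / _ + _ = v / L); last by field; rewrite !gt_eqF.
by rewrite invfM invf_div mulrCA [RHS]mulrCA; congr (_ * _); exact: mulrC.
Qed.

(** If [v] were 0, which means that both laws are degenerate, every inverse would take its default
    value 0, and so would the limit [Istar k]. The hypothesis [hK] provides a stage for this. *)
Lemma var_rate_gt0 : 0 < v.
Proof.
have v0 : 0 <= v by rewrite addr_ge0// divr_ge0// ltW.
rewrite lt_neqAle v0 andbT eq_sym; apply/eqP => v0'.
pose k : 'I_K := Ordinal hK.
have := @hinfo k; under eq_fun do rewrite info_invE v0' invr0 mul0r.
move=> I0; have := hIstar k.
by rewrite (cvg_unique (@norm_hausdorff _ R) I0 (cvg_cst (0:R))) ltxx.
Qed.

Lemma cum_size_cvg k : (cum (l n) k)%:R / n%:R @[n --> \oo] --> v * Istar k.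
Proof.
have C : v * (n%:R * (s1 / (cum (m n) k)%:R + s2 / (cum (l n) k)%:R))^-1 @[n --> \oo] --> v * Istar k.
  by apply: cvgMl_tmp; exact: hinfo.
apply: cvg_trans C; apply: near_eq_cvg; near=> n.
by rewrite /= info_invE mulVKf ?gt_eqF ?var_rate_gt0.
Unshelve. all: end_near. Qed.

(** The information controls cumulative sizes, so the limits of single stages come by strong
    induction, as differences. After the first stage [lam k] may be 0; it is the partial sums that
    are positive. *)
Lemma stage_size_cvg : exists lam : 'I_K -> R,
  [/\ forall k, 0 <= lam k, forall k, (l n k)%:R / n%:R @[n --> \oo] --> lam k &
      forall k : 'I_K, \sum_(s < K | (s <= k)%N) lam s = v * Istar k].
Proof.
have H k : exists a, (l n k)%:R / n%:R @[n --> \oo] --> (a : R).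
  have [j] := ubnP (k : nat); elim: j k => // j IH k kj.
  have /choice[a aP] (s : 'I_K) : exists a : R, (s < k)%N -> (l n s)%:R / n%:R @[n --> \oo] --> a.
    have [sk|sk] := ltnP s k; last by exists 0.
    have [//|a aP] := IH s; first exact: leq_trans sk kj.
    by exists a.
  exists (v * Istar k - \sum_(s < K | (s < k)%N) a s).
  have E n : (l n k)%:R / n%:R = (cum (l n) k)%:R / n%:R - \sum_(s < K | (s < k)%N) (l n s)%:R / n%:R :> R.
    rewrite /cum (bigD1 k)//= natrD natr_sum mulrDl addrC -mulr_suml.
    rewrite [X in _ = - (X / _) + _](eq_bigl (fun i : 'I_K => (i <= k)%N && (i != k))) => [|i].
      by rewrite addrC addrK.
    by rewrite ltn_neqAle andbC.
  under eq_fun do rewrite E; apply: cvgB; first exact: cum_size_cvg.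
  by apply: cvg_seq_sum => s sk; exact: aP.
have [lam lamP] := choice H; exists lam; split => // k.
  rewrite -(cvg_lim (@norm_hausdorff _ R) (lamP k)); apply: limr_ge; first exact: cvgP (lamP k).
  by near=> n; rewrite divr_ge0.
have C : \sum_(s < K | (s <= k)%N) (l n s)%:R / n%:R @[n --> \oo] --> \sum_(s < K | (s <= k)%N) lam s.
  by apply: cvg_seq_sum => s _; exact: lamP.
apply: (cvg_unique (@norm_hausdorff _ R) C).
have E n : \sum_(s < K | (s <= k)%N) (l n s)%:R / n%:R = (cum (l n) k)%:R / n%:R :> R.
  by rewrite /cum natr_sum mulr_suml.
have D : \sum_(s < K | (s <= k)%N) (l n s)%:R / n%:R @[n --> \oo] --> v * Istar k.
  by under eq_fun do rewrite E; exact: cum_size_cvg.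
exact: D.
Unshelve. all: end_near. Qed.

End stage_sizes.

(** * Asymptotics of the permuted statistics *)

Lemma cvg_invn (R : realType) : (n%:R^-1 : R) @[n --> \oo] --> 0.
Proof. by rewrite -cvg_shiftS; exact: cvg_harmonic. Qed.

Lemma sqr_sum_le (R : realType) (I : finType) (Q : pred I) (x : I -> R) :
  (\sum_(i | Q i) x i) ^+ 2 <= #|I|%:R * \sum_i x i ^+ 2.
Proof.
pose y i := if Q i then x i else 0.
have -> : \sum_(i | Q i) x i = \sum_i y i by rewrite big_mkcond.
apply: (@le_trans _ _ (#|I|%:R * \sum_i y i ^+ 2)); last first.
  apply: ler_wpM2l => //; apply: ler_sum => i _; rewrite /y; case: ifP => _ //.
  by rewrite expr0n sqr_ge0.
have E : \sum_i \sum_j (y i ^+ 2 + y j ^+ 2) = 2 * (#|I|%:R * \sum_i y i ^+ 2).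
  under eq_bigr => i _ do rewrite big_split/= sumr_const.
  rewrite big_split/= sumrMnl sumr_const -[X in X + _]mulr_natl -[X in _ + X]mulr_natl -mulr2n.
  by rewrite [RHS]mulr_natl.
rewrite -(ler_pM2l (ltr0n R 2)) -E expr2 mulr_suml mulr_sumr; apply: ler_sum => i _.
rewrite !mulr_sumr; apply: ler_sum => j _.
by have := sqr_ge0 (y i - y j); rewrite sqrrB; lra.
Qed.

Lemma sum_sqr_diff (R : realType) (a b : nat) (x : 'I_a -> R) (y : 'I_b -> R) :
  \sum_i \sum_j (x i - y j) ^+ 2 =
  b%:R * \sum_i x i ^+ 2 + a%:R * \sum_j y j ^+ 2 - 2 * (\sum_i x i) * \sum_j y j.
Proof.
have E i : \sum_j (x i - y j) ^+ 2 = b%:R * x i ^+ 2 + \sum_j y j ^+ 2 - x i * (2 * \sum_j y j).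
  have -> : b%:R * x i ^+ 2 = \sum_(j < b) x i ^+ 2 by rewrite sumr_const card_ord mulr_natl.
  rewrite !mulr_sumr -big_split/= -sumrB; apply: eq_bigr => j _; ring.
rewrite (eq_bigr _ (fun i _ => E i)) sumrB big_split/= -mulr_sumr -mulr_suml sumr_const card_ord.
by rewrite -[_ *+ a]mulr_natl; ring.
Qed.

Section permutation_asymptotics.
Variables (R : realType) (K : nat) (m l : nat -> 'I_K -> nat) (gamma : R).
Hypothesis gamma_gt0 : 0 < gamma.
Hypothesis mE : forall n k, (m n k)%:R = gamma * (l n k)%:R.
Hypothesis l_gt0 : forall n k, (0 < l n k)%N.
Variables (F1 F2 : probability R R).
Hypothesis int1 : F1.-integrable setT (EFin \o id).
Hypothesis int2 : F2.-integrable setT (EFin \o id).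
Hypothesis sqr1 : F1.-integrable setT (EFin \o (fun x => x ^+ 2)).
Hypothesis sqr2 : F2.-integrable setT (EFin \o (fun x => x ^+ 2)).
Variables (d : nat -> measure_display) (T : forall n, measurableType (d n)).
Variables (P : forall n, probability (T n) R) (X Y : forall n, nat -> {RV (P n) >-> R}).
Variables (tau : forall n (k : 'I_K), T n -> 'S_(m n k + l n k)).
Hypothesis hX : forall n i (B : set R), (i < total_size (m n))%N -> measurable B ->
  P n (X n i @^-1` B) = F1 B.
Hypothesis hY : forall n j (B : set R), (j < total_size (l n))%N -> measurable B ->
  P n (Y n j @^-1` B) = F2 B.
Hypothesis hindep : forall n, mutually_independent (P n) (experiment_events (X n) (Y n) (@tau n)).
Variable lam : 'I_K -> R.
Hypothesis lam_ge0 : forall k, 0 <= lam k.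
Hypothesis lamP : forall k, (l n k)%:R / n%:R @[n --> \oo] --> lam k.

Local Notation asum n := (@arm_sum R K (m n) (l n) (d n) (T n) (P n) (X n) (Y n)).
Local Notation casum n := (@cum_arm_sum R K (m n) (l n) (d n) (T n) (P n) (X n) (Y n)).
Local Notation Om n := (Om (m n) (l n)).
Local Notation van := (@L1_cvg0 R d T P (fun n => Om n)).
Local Notation pcvg := (@prod_cvg R d T P (fun n => Om n)).
Local Notation cweight n c s :=
  (@arm_weight R K (m n) (l n) (c / Num.sqrt n%:R / gamma) (- (c / Num.sqrt n%:R)) s).
Local Notation score n s f w :=
  (fun k => f (observation (X n) (Y n) (@stage_obs K (m n) (l n) s k) w)).
Let Og n := Om_gt0 (m n) (l n).

Definition mix (f : R -> R) : R := (gamma * \int[F1]_x f x + \int[F2]_x f x) / (1 + gamma).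

Lemma size_bound s : \forall n \near \oo, (l n s)%:R <= (lam s + 1) * n%:R.
Proof.
near=> n; rewrite -ler_pdivrMr; last by rewrite ltr0n; near: n; exact: nbhs_infty_gt.
near: n; apply: (cvgr_le _ (@lamP s)); by rewrite ltrDl.
Unshelve. all: end_near. Qed.

(** The centring keeps the ratio of [l n s] to [n] instead of its limit, so that only random
    fluctuations are estimated here. *)
Lemma arm_sum_cvg al be f s : `|al| <= 1 -> `|be| <= 1 -> measurable_fun setT f ->
  F1.-integrable setT (EFin \o f) -> F2.-integrable setT (EFin \o f) ->
  van (fun n w t => n%:R^-1 * asum n al be f s w t -
    (al * gamma + be) * ((l n s)%:R / n%:R) * mix f).
Proof.
move=> al1 be1 mf f1 f2 e e0.
have g1 : 0 < 1 + gamma by rewrite addr_gt0.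
pose C := (1 + gamma) * (lam s + 1).
have C0 : 0 < C by rewrite mulr_gt0// ltr_wpDl.
(* Of the three terms in [L1_arm_sum_lln], the first is at most [e * n%:R / 4] because the stage has
   at most [C * n%:R] observations, the last equals [e * n%:R / 4], and the middle one stays
   bounded, hence falls below the same value for large [n]. *)
pose eta := e / 8 / C; have eta0 : 0 < eta by rewrite !divr_gt0.
have [j [h1 h2]] := filter_ex (filterI (L1_trunc mf f1 eta0) (L1_trunc mf f2 eta0)).
pose ep := e / 8; have ep0 : 0 < ep by rewrite divr_gt0.
near=> n.
have n0 : 0 < n%:R :> R by rewrite ltr0n; near: n; exact: nbhs_infty_gt.
have l0 : 0 < (l n s)%:R :> R by rewrite ltr0n.
have N0 : (0 < m n s + l n s)%N by rewrite addn_gt0 l_gt0 orbT.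
have NE : (m n s + l n s)%:R = (1 + gamma) * (l n s)%:R by rewrite natrD mE; ring.
have epn : 0 < ep * n%:R by rewrite mulr_gt0.
have K1 := L1_arm_sum_lln (@hX n) (@hY n) (@hindep n) N0 al1 be1 f1 f2
  (measurable_trunc j mf) (trunc_bound j f) h1 h2 epn.
apply: (L1_le_mono _ _ (L1_leZ n%:R^-1 K1)).
  move=> w; apply: avg_le => t; rewrite mulrBr NE mE /mix.
  rewrite [X in _ <= `|_ - X|](_ : _ = (al * gamma + be) * ((l n s)%:R / n%:R) *
    ((gamma * \int[F1]_x f x + \int[F2]_x f x) / (1 + gamma)))//.
  by field; rewrite !gt_eqF.
rewrite gtr0_norm ?invr_gt0// NE ler_pdivrMl//.
have H1 : (1 + gamma) * (l n s)%:R <= C * n%:R.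
  by rewrite /C -mulrA ler_pM2l//; near: n; exact: size_bound.
have H2 : C * (6 * j%:R ^+ 2 / ep) <= e / 4 * n%:R.
  rewrite -ler_pdivrMl ?divr_gt0//; near: n; exact: nbhs_infty_ger.
set N := (1 + gamma) * _ in H1 *.
rewrite (_ : 6 * N * j%:R ^+ 2 / (ep * n%:R) = N / n%:R * (6 * j%:R ^+ 2 / ep)); last first.
  by field; rewrite !gt_eqF.
have H3 : N / n%:R * (6 * j%:R ^+ 2 / ep) <= e / 4 * n%:R.
  apply: le_trans H2; apply: ler_wpM2r; last by rewrite ler_pdivrMr.
  by rewrite divr_ge0 ?(ltW ep0)// mulr_ge0 ?sqr_ge0.
have H4 : N * eta <= ep * n%:R.
  apply: (le_trans (ler_wpM2r (ltW eta0) H1)).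
  by rewrite /eta /ep mulrAC [C * _]mulrC divfK ?gt_eqF.
have H5 : ep * n%:R = e * n%:R / 8 by rewrite /ep; ring.
by rewrite -[2 * N * eta]mulrA; lra.
Unshelve. all: end_near. Qed.

(* With u = id, the sum of the contrasts of the first stages is the difference of
   the two permuted means up to the factor cum l k / Num.sqrt n. *)
Definition contrast n s (u : R -> R) (w : T n) (t : Om n) : R :=
  (Num.sqrt n%:R)^-1 * asum n gamma^-1 (- 1) u s w t.

Lemma contrastB n s u u' w t :
  contrast s u w t - contrast s u' w t = contrast s (fun x => u x - u' x) (w : T n) t.
Proof.
by rewrite /contrast -mulrBr; congr (_ * _); rewrite /arm_sum !sumrB; ring.
Qed.

Lemma contrast_sqr_le s (u : R -> R) (q : R) : measurable_fun setT u -> 0 <= q ->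
  (\int[F1]_x (u x ^+ 2)%:E <= q%:E)%E -> (\int[F2]_x (u x ^+ 2)%:E <= q%:E)%E ->
  \forall n \near \oo, L1_le (P n) (fun w t => contrast s u w t ^+ 2)
    (2 * (gamma^-1 + 1) * (lam s + 1) * q).
Proof.
move=> mu q0 q1 q2; near=> n.
have n0 : 0 < n%:R :> R by rewrite ltr0n; near: n; exact: nbhs_infty_gt.
have N0 : (0 < m n s + l n s)%N by rewrite addn_gt0 l_gt0 orbT.
have ab0 : gamma^-1 * (m n s)%:R + - 1 * (l n s)%:R = 0.
  by rewrite mE mulKf ?gt_eqF// mulN1r subrr.
have K1 := L1_arm_sum_sqr (@hX n) (@hY n) N0 mu ab0 q1 q2.
apply: (L1_le_mono _ _ (L1_leZ n%:R^-1 K1)).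
  by move=> w; apply: avg_le => t; rewrite /contrast exprMn exprVn sqr_sqrtr.
rewrite gtr0_norm ?invr_gt0// ler_pdivrMl// mE.
rewrite (_ : 2 * _ * q = 2 * (gamma^-1 + 1) * q * (l n s)%:R); last first.
  by field; rewrite gt_eqF.
rewrite (_ : n%:R * _ = 2 * (gamma^-1 + 1) * q * ((lam s + 1) * n%:R)); last by ring.
apply: ler_wpM2l; last by near: n; exact: size_bound.
by rewrite !mulr_ge0// addr_ge0// invr_ge0 ltW.
Unshelve. all: end_near. Qed.

Lemma arm_sum_pcvg al be f s : `|al| <= 1 -> `|be| <= 1 -> measurable_fun setT f ->
  F1.-integrable setT (EFin \o f) -> F2.-integrable setT (EFin \o f) ->
  pcvg (fun n w t => n%:R^-1 * asum n al be f s w t) ((al * gamma + be) * lam s * mix f).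
Proof.
move=> al1 be1 mf f1 f2.
have A : pcvg (fun n w t => n%:R^-1 * asum n al be f s w t -
    (al * gamma + be) * ((l n s)%:R / n%:R) * mix f) 0.
  apply: prod_cvg_L1; apply: L1_cvg0_dom (@arm_sum_cvg al be f s al1 be1 mf f1 f2).
  by near=> n => w t; rewrite subr0.
have B : pcvg (fun n _ _ => (al * gamma + be) * ((l n s)%:R / n%:R) * mix f)
    ((al * gamma + be) * lam s * mix f).
  apply: prod_cvg_cst => //; apply: cvgMr_tmp; apply: cvgMl_tmp; exact: lamP.
have := prod_cvgD A B; rewrite add0r; apply: L1_cvg0_dom.
by near=> n => w t; rewrite subrK.
Unshelve. all: end_near. Qed.

Definition Lam (k : 'I_K) := \sum_(s < K | (s <= k)%N) lam s.
Hypothesis Lam_gt0 : forall k, 0 < Lam k.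

Lemma Lam_cvg k : (cum (l n) k)%:R / n%:R @[n --> \oo] --> Lam k.
Proof.
under eq_fun do rewrite /cum natr_sum mulr_suml.
by apply: cvg_seq_sum => s _; exact: lamP.
Qed.

Lemma cum_arm_sum_pcvg al be f k : `|al| <= 1 -> `|be| <= 1 -> measurable_fun setT f ->
  F1.-integrable setT (EFin \o f) -> F2.-integrable setT (EFin \o f) ->
  pcvg (fun n w t => n%:R^-1 * casum n al be f k w t) ((al * gamma + be) * Lam k * mix f).
Proof.
move=> al1 be1 mf f1 f2.
have := prod_cvg_sum Og (index_enum _) (fun s : 'I_K => (s <= k)%N)
  (fun s => @arm_sum_pcvg al be f s al1 be1 mf f1 f2).
rewrite -mulr_suml -mulr_sumr -/(Lam k); apply: L1_cvg0_dom.
by near=> n => w t; rewrite -mulr_sumr.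
Unshelve. all: end_near. Qed.

Definition pool_var := mix (fun x => x ^+ 2) - mix id ^+ 2.

Lemma arm_var_pcvg (M : nat -> nat) (L : R) (s1 s2 : forall n, T n -> Om n -> R) p1 p2 :
  0 < L -> (M n)%:R / n%:R @[n --> \oo] --> L ->
  pcvg (fun n w t => n%:R^-1 * s1 n w t) (L * p1) ->
  pcvg (fun n w t => n%:R^-1 * s2 n w t) (L * p2) ->
  pcvg (fun n w t => arm_var (M n)%:R (s1 n w t) (s2 n w t)) (p2 - p1 ^+ 2).
Proof.
move=> L0 ML h1 h2.
have iM : n%:R / (M n)%:R @[n --> \oo] --> L^-1.
  by under eq_fun do rewrite -invf_div; apply: cvgV => //; rewrite gt_eqF.
have iM0 : (M n)%:R^-1 @[n --> \oo] --> (0 : R).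
  have : n%:R / (M n)%:R * n%:R^-1 @[n --> \oo] --> (L^-1 * 0 : R).
    by apply: cvgM => //; exact: cvg_invn.
  rewrite mulr0; apply: cvg_trans; apply: near_eq_cvg; near=> n.
  have n0 : n%:R != 0 :> R by rewrite pnatr_eq0 -lt0n; near: n; exact: nbhs_infty_gt.
  by rewrite mulrAC divff// mul1r.
have c1 : (M n)%:R / ((M n)%:R - 1) @[n --> \oo] --> (1 : R).
  have : (1 - (M n)%:R^-1)^-1 @[n --> \oo] --> ((1 - 0)^-1 : R).
    by apply: cvgV; [rewrite subr0 oner_eq0|apply: cvgB => //; exact: cvg_cst].
  rewrite subr0 invr1; apply: cvg_trans; apply: near_eq_cvg; near=> n.
  have Mn : 0 < (M n)%:R / n%:R :> R by near: n; exact: (cvgr_gt _ ML).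
  have M0 : (M n)%:R != 0 :> R by apply: contraTneq Mn => ->; rewrite mul0r ltxx.
  by rewrite -[in RHS]invf_div mulrBl divff// mul1r.
have kE (s : forall n, T n -> Om n -> R) p : pcvg (fun n w t => n%:R^-1 * s n w t) (L * p) ->
    pcvg (fun n w t => s n w t / (M n)%:R) p.
  move=> h; have := prod_cvgM (prod_cvg_cst P Og iM) h; rewrite mulKf ?gt_eqF//.
  apply: L1_cvg0_dom; near=> n => w t.
  have n0 : n%:R != 0 :> R by rewrite pnatr_eq0 -lt0n; near: n; exact: nbhs_infty_gt.
  by rewrite mulrA [_ * n%:R^-1]mulrAC divff// mul1r [_^-1 * s n w t]mulrC.
have k1 := kE _ _ h1; have k2 := kE _ _ h2.
have := prod_cvgM (prod_cvg_cst P Og c1) (prod_cvgD k2 (prod_cvgZ Og (- 1) (prod_cvgM k1 k1))).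
rewrite mul1r mulN1r -expr2; apply: L1_cvg0_dom; near=> n => w t.
by rewrite /arm_var mulN1r -expr2.
Unshelve. all: end_near. Qed.

(** After permutation both arms look like samples of the mixture, so both variance estimates have
    the same limit, and their weights [(1 + gamma)^-1] and [gamma / (1 + gamma)] add up to 1. *)
Lemma perm_var_cvg k : pcvg (fun n w t => perm_var (X n) (Y n) gamma k w t) pool_var.
Proof.
have g1 : 0 < 1 + gamma by rewrite addr_gt0.
have n01 : `|0 : R| <= 1 by rewrite normr0.
have n11 : `|1 : R| <= 1 by rewrite normr1.
have msq : measurable_fun setT (fun x : R => x ^+ 2) by exact: measurable_funX.
have mid : measurable_fun setT (@id R) by [].
have mL : 0 < gamma * Lam k by rewrite mulr_gt0.
have mcvg : (cum (m n) k)%:R / n%:R @[n --> \oo] --> gamma * Lam k.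
  under eq_fun do rewrite (cumE (@mE _)) -mulrA.
  by apply: cvgMl_tmp; exact: Lam_cvg.
have A1 := cum_arm_sum_pcvg k n11 n01 mid int1 int2.
have A2 := cum_arm_sum_pcvg k n11 n01 msq sqr1 sqr2.
have B1 := cum_arm_sum_pcvg k n01 n11 mid int1 int2.
have B2 := cum_arm_sum_pcvg k n01 n11 msq sqr1 sqr2.
rewrite !mul1r !addr0 in A1 A2; rewrite !mul0r !add0r !mul1r in B1 B2.
have A := arm_var_pcvg mL mcvg A1 A2.
have B := arm_var_pcvg (Lam_gt0 k) (@Lam_cvg k) B1 B2.
have := prod_cvgD (prod_cvgZ Og (1 + gamma)^-1 A) (prod_cvgZ Og (gamma / (1 + gamma)) B).
rewrite -/pool_var (_ : _ + _ = pool_var)//; first by field; rewrite gt_eqF.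
Qed.

Hypothesis pool_var_gt0 : 0 < pool_var.

Definition scale (k : 'I_K) : R :=
  Num.sqrt (gamma / (1 + gamma)) * (Num.sqrt (Lam k))^-1 * (Num.sqrt pool_var)^-1.

Local Notation sqr_bound := (\int[F1]_x (x ^+ 2) + \int[F2]_x (x ^+ 2)).

Lemma contrast_tight s : \forall n \near \oo, L1_le (P n)
  (fun w t => contrast s id w t ^+ 2) (2 * (gamma^-1 + 1) * (lam s + 1) * sqr_bound).
Proof.
have f1 : 0 <= \int[F1]_x (x ^+ 2) by apply: Rintegral_ge0 => x _; exact: sqr_ge0.
have f2 : 0 <= \int[F2]_x (x ^+ 2) by apply: Rintegral_ge0 => x _; exact: sqr_ge0.
apply: contrast_sqr_le => //; first exact: addr_ge0.
  by rewrite (integral_EFin_Rintegral sqr1) lee_fin lerDl.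
by rewrite (integral_EFin_Rintegral sqr2) lee_fin lerDr.
Qed.

Definition lim_stat n (k : 'I_K) (w : T n) (t : Om n) : R :=
  scale k * \sum_(s < K | (s <= k)%N) contrast s id w t.

Local Notation stat n w t := (perm_stat (X n ^~ w) (Y n ^~ w) (fun k => (t : Om n) k)).

(** The coefficient [coef] tends to [scale k] and multiplies contrasts with bounded second moments,
    so [prod_cvg_tight] applies stage by stage. *)
Lemma perm_stat_cvg k : pcvg (fun n w t => stat n w t k - lim_stat k w t) 0.
Proof.
pose coef n w t : R := Num.sqrt (gamma / (1 + gamma)) *
  (Num.sqrt ((cum (l n) k)%:R / n%:R))^-1 * (Num.sqrt (@perm_var R K (m n) (l n) _ _ _ (X n) (Y n) gamma k w t))^-1.
have sc (a : R) : 0 < a -> {for a, continuous (fun x : R => (Num.sqrt x)^-1)}.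
  move=> a0; apply: cvgV; first by rewrite gt_eqF// sqrtr_gt0.
  exact: sqrt_continuous.
have C : pcvg coef (scale k).
  apply: prod_cvgM; last exact: (prod_cvg_comp Og (sc _ pool_var_gt0) (@perm_var_cvg k)).
  apply: prod_cvg_cst => //; apply: cvgMl_tmp.
  exact: (cvg_comp _ _ (@Lam_cvg k) (sc _ (Lam_gt0 k))).
have := prod_cvg_sum Og (index_enum _) (fun s : 'I_K => (s <= k)%N)
  (fun s => prod_cvg_tight (contrast_tight s) C).
rewrite big1//; apply: L1_cvg0_dom; near=> n => w t.
have n0 : 0 < n%:R :> R by rewrite ltr0n; near: n; exact: nbhs_infty_gt.
rewrite !subr0 [X in `|Num.min 1 `|X| | <= _](_ : _ = \sum_(s < K | (s <= k)%N) (coef n w t - scale k) * contrast s id w t)//.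
rewrite -mulr_sumr mulrBl /lim_stat; congr (_ - _).
rewrite (perm_statE _ _ gamma_gt0 (@mE n) (@l_gt0 n)) /coef /cum_arm_sum /contrast -mulr_sumr.
rewrite [Num.sqrt (_%:R / _)]sqrtrM// [Num.sqrt n%:R^-1]sqrtrV//.
set A := \sum_(_ < K | _) _; set B := (Num.sqrt (perm_var _ _ _ _ _ _))^-1.
by field; rewrite !gt_eqF ?sqrtr_gt0// cum_gt0.
Unshelve. all: end_near. Qed.

(** A bound for each fixed [w], by the observed sum of squares: with weights [1, 1] the arm sum does
    not depend on the permutation. This form is needed because tails are averaged over the
    permutations with the data held fixed. *)
Lemma contrast_avg_sqr n s (w : T n) : (0 < n)%N ->
  avg (fun t => contrast s id w t ^+ 2) <=
  avg (fun t => 2 / gamma * (n%:R^-1 * asum n 1 1 (fun x => x ^+ 2) s w t)).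
Proof.
move=> n_gt0; have n0 : 0 < n%:R :> R by rewrite ltr0n.
have l0 : 0 < (l n s)%:R :> R by rewrite ltr0n.
have g1 : 0 < 1 + gamma by rewrite addr_gt0.
pose z i := observation (X n) (Y n) (@stage_obs K (m n) (l n) s i) w.
have a0 : \sum_i (@arm_weight R K (m n) (l n) gamma^-1 (- 1) s i) = 0.
  by rewrite sum_arm_weight mE mulKf ?gt_eqF// mulN1r subrr.
have zE t : asum n 1 1 (fun x => x ^+ 2) s w t = \sum_i z i ^+ 2.
  rewrite arm_sumE /permsum [RHS](reindex_inj (@perm_inj _ ((t : Om n) s)))/=; apply: eq_bigr => i _.
  by rewrite /arm_weight; case: (fintype.split i) => _; rewrite mul1r.
under [leRHS]avg_ext do rewrite zE.
rewrite avg_cst//.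
have := avg_permsum_sqr (@stage_swap_inv K (m n) (l n) s) (Og n) (@stage_swap_perm K (m n) (l n) s) z a0.
rewrite sum_arm_weight_sqr mE natrD mE => H.
under avg_ext do rewrite /contrast exprMn exprVn sqr_sqrtr// arm_sumE.
rewrite avgZ [leRHS]mulrCA ler_pM2l ?invr_gt0//; apply: le_trans H _.
rewrite le_eqVlt; apply/orP; left; apply/eqP; field.
by rewrite !gt_eqF//= -{2}[(l n s)%:R]mul1r -mulrDl mulr_gt0// addrC.
Qed.

Lemma mix_sqr_ge0 : 0 <= mix (fun x => x ^+ 2).
Proof.
have f1 : 0 <= \int[F1]_x (x ^+ 2) by apply: Rintegral_ge0 => x _; exact: sqr_ge0.
have f2 : 0 <= \int[F2]_x (x ^+ 2) by apply: Rintegral_ge0 => x _; exact: sqr_ge0.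
by rewrite /mix divr_ge0// addr_ge0// ?mulr_ge0// ltW.
Qed.

(** If a coordinate exceeds [j], either it is at distance at least 1 from [lim_stat] and the second
    summand is 1, or the value [b] of [lim_stat] satisfies [|b| + 2 >= j.+1%:R], and
    [(|b| + 2) ^+ 2 <= 2 * b ^+ 2 + 8] makes the first summand at least 1. *)
Lemma box_tail_le n j (w : T n) (t : Om n) :
  \1_(@box_tail R K j) (perm_stat_vec (X n ^~ w) (Y n ^~ w) (fun k => t k)) <=
  \sum_(k < K) ((2 * lim_stat k w t ^+ 2 + 8) / j.+1%:R ^+ 2 +
    Num.min 1 `|stat n w t k - lim_stat k w t|) :> R.
Proof.
have sg0 k : 0 <= (2 * lim_stat k w t ^+ 2 + 8) / j.+1%:R ^+ 2.
  by rewrite divr_ge0 ?sqr_ge0// addr_ge0// mulr_ge0// sqr_ge0.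
have s0 k : 0 <= (2 * lim_stat k w t ^+ 2 + 8) / j.+1%:R ^+ 2 +
    Num.min 1 `|stat n w t k - lim_stat k w t| by rewrite addr_ge0// min1_ge0.
rewrite indicE; case: (boolP (_ \in _)) => [/set_mem[k]|_]; last by rewrite sumr_ge0.
rewrite mxE => jk; rewrite (bigD1 k)//= ler_wpDr ?sumr_ge0//.
set a := perm_stat _ _ _ k in jk *; set b := lim_stat k w t.
have [ab|ab] := leP 1 `|a - b|; first by rewrite ler_wpDl ?sg0// le_min lexx.
rewrite ler_wpDr ?min1_ge0// ler_pdivlMr ?exprn_gt0// mul1r.
have h : j.+1%:R <= `|b| + 2.
  have := ler_normD (a - b) b; rewrite subrK -[j.+1]addn1 natrD => h.
  by have := ltW jk; have := ltW ab; lra.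
apply: (@le_trans _ _ ((`|b| + 2) ^+ 2)); first by rewrite lerXn2r ?nnegrE ?addr_ge0.
by rewrite -[b ^+ 2]real_normK ?num_real//; have := sqr_ge0 (`|b| - 2); rewrite sqrrB sqrrD; lra.
Qed.

(** The deterministic part decays in [j], and one vanishing error [G] serves all [j], since the
    fluctuations enter with a factor [j.+1%:R ^- 2] of at most 1. The numbers [C / j.+1%:R ^+ 2]
    become the bounds [tl] of [rho_ball]. *)
Lemma perm_stat_tight : exists C (G : forall n, T n -> Om n -> R), [/\ 0 <= C, van G &
  \forall n \near \oo, forall (j : nat) w,
    avg (fun t : Om n => \1_(@box_tail R K j) (perm_stat_vec (X n ^~ w) (Y n ^~ w) (fun k => t k))) <=
    C / j.+1%:R ^+ 2 + avg (fun t => `|G n w t|)].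
Proof.
pose q := mix (fun x => x ^+ 2); have q0 : 0 <= q := mix_sqr_ge0.
pose A := \sum_(k < K) 2 * (scale k ^+ 2 * (K%:R * (2 / gamma))).
have A0 : 0 <= A.
  by apply: sumr_ge0 => k _; rewrite !mulr_ge0 ?sqr_ge0 ?invr_ge0// ltW.
pose H s n w t := n%:R^-1 * asum n 1 1 (fun x => x ^+ 2) s w t -
    (1 * gamma + 1) * ((l n s)%:R / n%:R) * q.
have H0 s : van (H s).
  have msq : measurable_fun setT (fun x : R => x ^+ 2) by exact: measurable_funX.
  by apply: arm_sum_cvg => //; rewrite normr1.
pose M n w t := \sum_(k < K) Num.min 1 `|stat n w t k - lim_stat k w t|.
pose G n w t := M n w t + A * \sum_(s < K) `|H s n w t|.
pose D := \sum_(s < K) (gamma + 1) * (lam s + 1) * q.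
exists (8 * K%:R + A * D), G; split.
- rewrite addr_ge0 ?mulr_ge0// sumr_ge0// => s _.
  by rewrite mulr_ge0// mulr_ge0 ?addr_ge0// ltW.
- apply: L1_cvg0D.
    apply: L1_cvg0_sum => // k; apply: L1_cvg0_dom (@perm_stat_cvg k).
    by near=> n => w t; rewrite subr0.
  apply: (L1_cvg0Z (x := fun=> A) (c := A)); first by near=> n; rewrite ger0_norm.
  apply: L1_cvg0_sum => // s; apply: L1_cvg0_dom (H0 s).
  by near=> n => w t; rewrite normr_id.
near=> n => j w.
have n_gt0 : (0 < n)%N by near: n; exact: nbhs_infty_gt.
have n0 : 0 < n%:R :> R by rewrite ltr0n.
have sb s : (l n s)%:R <= (lam s + 1) * n%:R :> R.
  by move: s; near: n; apply: filter_forall => s; exact: size_bound.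
have J1 : 1 <= j.+1%:R ^+ 2 :> R by rewrite exprn_ege1// ler1n.
have J0 : 0 < j.+1%:R ^+ 2 :> R by rewrite exprn_gt0.
pose U s := avg (fun t => `|H s n w t|).
have U0 s : 0 <= U s by apply: avg_ge0.
have E1 s : avg (fun t => contrast s id w t ^+ 2) <= 2 / gamma * (U s + (gamma + 1) * (lam s + 1) * q).
  apply: (le_trans (contrast_avg_sqr s w n_gt0)); rewrite avgZ; apply: ler_wpM2l.
    by rewrite divr_ge0// ltW.
  apply: (@le_trans _ _ (avg (fun t => `|H s n w t| + (gamma + 1) * (lam s + 1) * q))).
    apply: avg_le => t.
    have := ler_norm (H s n w t); rewrite {1}/H mul1r => h.
    have h2 : (gamma + 1) * ((l n s)%:R / n%:R) * q <= (gamma + 1) * (lam s + 1) * q.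
      apply: ler_wpM2r => //; apply: ler_wpM2l; first by rewrite addr_ge0// ltW.
      by rewrite ler_pdivrMr.
    by lra.
  by rewrite avgD avg_cst.
have E2 k : avg (fun t => lim_stat k w t ^+ 2) <=
    scale k ^+ 2 * (K%:R * (2 / gamma)) * (\sum_s U s + D).
  apply: (@le_trans _ _ (avg (fun t => scale k ^+ 2 * (K%:R * \sum_(s < K) contrast s id w t ^+ 2)))).
    apply: avg_le => t; rewrite /lim_stat exprMn; apply: ler_wpM2l; first exact: sqr_ge0.
    by have := sqr_sum_le (fun s : 'I_K => (s <= k)%N) (fun s => contrast s id w t); rewrite card_ord.
  rewrite avgZ avgZ avg_sum -mulrA; apply: ler_wpM2l; first exact: sqr_ge0.
  rewrite -mulrA; apply: ler_wpM2l => //.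
  by rewrite /D -big_split/= mulr_sumr; apply: ler_sum => s _; exact: E1.
apply: (@le_trans _ _ (avg (fun t => \sum_(k < K) ((2 * lim_stat k w t ^+ 2 + 8) / j.+1%:R ^+ 2 +
    Num.min 1 `|stat n w t k - lim_stat k w t|)))).
  by apply: avg_le => t; exact: box_tail_le.
have -> : avg (fun t => \sum_(k < K) ((2 * lim_stat k w t ^+ 2 + 8) / j.+1%:R ^+ 2 +
    Num.min 1 `|stat n w t k - lim_stat k w t|)) =
    (\sum_(k < K) (2 * avg (fun t => lim_stat k w t ^+ 2) + 8)) / j.+1%:R ^+ 2 + avg (M n w).
  rewrite avg_sum [avg (M n w)]avg_sum mulr_suml -big_split/=; apply: eq_bigr => k _.
  by rewrite avgD; congr (_ + _); under avg_ext do rewrite mulrC; rewrite avgZ mulrC avgD avg_cst// avgZ.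
have -> : avg (fun t => `|G n w t|) = avg (M n w) + A * \sum_s U s.
  have G0 t : `|G n w t| = M n w t + A * \sum_(s < K) `|H s n w t|.
    rewrite ger0_norm//; apply: addr_ge0; first by apply: sumr_ge0 => k _; exact: min1_ge0.
    by apply: mulr_ge0 => //; apply: sumr_ge0.
  rewrite (avg_ext G0) avgD avgZ; congr (_ + _ * _); exact: avg_sum.
set u := \sum_s U s; have u0 : 0 <= u by apply: sumr_ge0.
have E3 : \sum_(k < K) (2 * avg (fun t => lim_stat k w t ^+ 2) + 8) <= A * (u + D) + 8 * K%:R.
  rewrite big_split/= sumr_const card_ord mulr_natr lerD2r /A mulr_suml.
  by apply: ler_sum => k _; rewrite -mulrA ler_pM2l.
apply: (@le_trans _ _ ((A * (u + D) + 8 * K%:R) / j.+1%:R ^+ 2 + avg (M n w))).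
  by rewrite lerD2r ler_pM2r ?invr_gt0.
have E4 : A * u / j.+1%:R ^+ 2 <= A * u by rewrite ler_pdivrMr// ler_peMr// mulr_ge0.
move: (_ ^- 2) E4 => x E4.
by rewrite (_ : (A * (u + D) + 8 * K%:R) * x = A * u * x + (8 * K%:R + A * D) * x); [lra|ring].
Unshelve. all: end_near. Qed.

(** The coefficient of the contrast of stage [s] once the sums over [k] and over [s <= k] are
    exchanged in a linear form of the [lim_stat k]. *)
Definition phase_coef (u : 'I_K -> R) (s : 'I_K) : R := \sum_(k < K | (s <= k)%N) u k * scale k.

Lemma cos_stat_cvg u th : van (fun n w t => cos (\sum_k u k * stat n w t k + th) -
  cos (\sum_s phase_coef u s * contrast s id w t + th)).
Proof.
apply: L1_cvg0_cos => //.
have := prod_cvg_sum Og (index_enum _) xpredT (fun k => prod_cvgZ Og (u k) (@perm_stat_cvg k)).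
rewrite big1; last by move=> k _; rewrite mulr0.
apply: L1_cvg0_dom; near=> n => w t.
have E1 : \sum_s phase_coef u s * contrast s id w t = \sum_k u k * lim_stat k w t.
  under eq_bigr do rewrite /phase_coef mulr_suml.
  rewrite (exchange_big_dep xpredT)//=; apply: eq_bigr => k _.
  by rewrite /lim_stat mulrA -mulr_sumr.
rewrite (_ : _ + th - _ = \sum_k u k * (stat n w t k - lim_stat k w t))//.
rewrite E1 opprD addrACA subrr addr0 -sumrB.
by apply: eq_bigr => k _; rewrite mulrBr.
Unshelve. all: end_near. Qed.

Lemma cos_trunc_cvg (c : 'I_K -> R) th e : 0 < e ->
  \forall j \near \oo, \forall n \near \oo, L1_le (P n) (fun w (t : Om n) =>
    cos (\sum_s c s * contrast s id w t + th) -
    cos (\sum_s c s * contrast s (trunc j id) w t + th)) e.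
Proof.
move=> e0; pose B := \sum_s `|c s|.
have B0 : 0 <= B by apply: sumr_ge0.
have B1 : 0 < B + 1 by rewrite ltr_wpDl.
pose dl := e / (2 * (B + 1)); have dl0 : 0 < dl by rewrite divr_gt0// mulr_gt0.
pose A s := 2 * (gamma^-1 + 1) * (lam s + 1).
have A0 s : 0 < A s by rewrite !mulr_gt0// ?ltr_wpDl// invr_ge0 ltW.
pose AA := \sum_s A s + 1.
have AA0 : 0 < AA by rewrite ltr_wpDl// sumr_ge0// => s _; exact: ltW.
have AAs s : A s <= AA.
  rewrite /AA (bigD1 s)//= -addrA lerDl addr_ge0// sumr_ge0// => i _; exact: ltW.
(* With this [eta] the bound of [L1_le_sqr] for each stage is [A s * eta / dl + dl <= 2 * dl], and
   the weighted sum over the stages is at most [B * e / (B + 1)]. *)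
pose eta := dl ^+ 2 / AA; have eta0 : 0 < eta by rewrite divr_gt0// exprn_gt0.
near=> j.
have h1 : (\int[F1]_x ((x - trunc j id x) ^+ 2)%:E <= eta%:E)%E by near: j; exact: L2_trunc.
have h2 : (\int[F2]_x ((x - trunc j id x) ^+ 2)%:E <= eta%:E)%E by near: j; exact: L2_trunc.
have md : measurable_fun setT (fun x : R => x - trunc j id x).
  by apply: measurable_funB => //; exact: measurable_trunc.
near=> n.
have K1 s : L1_le (P n) (fun w t => contrast s (fun x => x - trunc j id x) w t ^+ 2) (A s * eta).
  by move: s; near: n; apply: filter_forall => s; exact: contrast_sqr_le (ltW eta0) h1 h2.
have K2 := L1_le_sum (Og n) (index_enum _) xpredT (fun s => L1_leZ (c s) (L1_le_sqr (Og n) dl0 (K1 s))).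
apply: (L1_le_mono _ _ K2).
  move=> w; apply: avg_le => t; apply: (le_trans (cos_lipschitz _ _)).
  rewrite (_ : _ + th - _ = \sum_s c s * contrast s (fun x => x - trunc j id x) w t)//.
  rewrite opprD addrACA subrr addr0 -sumrB; apply: eq_bigr => s _.
  by rewrite -mulrBr contrastB.
apply: (@le_trans _ _ (\sum_s `|c s| * (2 * dl))).
  apply: ler_sum => s _; apply: ler_wpM2l => //; rewrite mulr2n mulrDl mul1r lerD2r.
  rewrite ler_pdivrMr// -expr2 /eta mulrA ler_pdivrMr// mulrC ler_wpM2l ?sqr_ge0//.
have -> : 2 * dl = e / (B + 1) by rewrite /dl; field; rewrite gt_eqF.
rewrite -mulr_suml -/B mulrA ler_pdivrMr// mulrC.
by rewrite ler_wpM2l ?(ltW e0)// lerDl.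
Unshelve. all: end_near. Qed.

(** The weights are constant on each arm, so only pairs with one position in each arm contribute,
    and every such pair is counted in both orders. *)
Lemma sum_swapdiff_sqr n s al be (f : R -> R) (w : T n) (t : Om n) :
  \sum_i \sum_j swapdiff (fun t : Om n => t s) (@arm_weight R K (m n) (l n) al be s)
    (score n s f w) t i j ^+ 2 =
  2 * (al - be) ^+ 2 * ((l n s)%:R * asum n 1 0 (fun x => f x ^+ 2) s w t +
    (m n s)%:R * asum n 0 1 (fun x => f x ^+ 2) s w t -
    2 * asum n 1 0 f s w t * asum n 0 1 f s w t).
Proof.
pose x (i : 'I_(m n s)) := f (perm_treat (X n ^~ w) (Y n ^~ w) (fun k => t k) i).
pose y (i : 'I_(l n s)) := f (perm_ctrl (X n ^~ w) (Y n ^~ w) (fun k => t k) i).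
pose z (i : 'I_(m n s + l n s)) := f (observation (X n) (Y n) (stage_obs (t s i)) w).
have zl i : z (lshift _ i) = x i by rewrite /x /perm_treat stage_dataE.
have zr i : z (rshift _ i) = y i by rewrite /y /perm_ctrl stage_dataE.
have H a v : \sum_j ((a - @arm_weight R K (m n) (l n) al be s j) * (v - z j)) ^+ 2 =
    (a - al) ^+ 2 * \sum_j (v - x j) ^+ 2 + (a - be) ^+ 2 * \sum_j (v - y j) ^+ 2.
  rewrite (sum_arm (fun b j => ((a - b) * (v - z j)) ^+ 2)) !mulr_sumr.
  by congr (_ + _); apply: eq_bigr => j _; rewrite ?zl ?zr exprMn.
rewrite (sum_arm (fun b i => \sum_j ((b - arm_weight al be j) * (z i - z j)) ^+ 2)).
under eq_bigr => i _ do rewrite H zl subrr expr0n mul0r add0r.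
under [X in _ + X]eq_bigr => i _ do rewrite H zr subrr expr0n mul0r addr0.
rewrite -!mulr_sumr !sum_sqr_diff /arm_sum !mul1r !mul0r !addr0 !add0r -/x -/y.
by ring.
Qed.

Definition stage_var (f : R -> R) (s : 'I_K) : R :=
  (1 + gamma) / gamma * lam s * (mix (fun x => f x ^+ 2) - mix f ^+ 2).

Lemma contrast_permsum n s c f (w : T n) (t : Om n) :
  c * contrast s f w t = permsum (fun t : Om n => t s)
    (cweight n c s)
    (score n s f w) t.
Proof.
by rewrite -(@arm_sumE R K (m n) (l n)) /contrast /arm_sum; ring.
Qed.

Lemma contrast_swap n s s' i j f (w : T n) (t : Om n) : s != s' ->
  contrast s' f w (@stage_swap K (m n) (l n) s i j t) = contrast s' f w t.
Proof. by move=> ss'; rewrite /contrast !arm_sumE /permsum stage_swap_out. Qed.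

(** The product of the two arm sums is the only nonlinear term. The treatment sum divided by [l n s]
    is the number [q], bounded because [f] is, so the product is reduced to bounded multiples of the
    fluctuations [c1] and [t1]. *)
Lemma swapdiff_sqr_cvg (c : R) (f : R -> R) (b : R) s : measurable_fun setT f ->
  (forall x, `|f x| <= b) ->
  van (fun n w t => (4 * (m n s + l n s)%:R)^-1 * (\sum_i \sum_j
    swapdiff (fun t : Om n => t s)
    (cweight n c s)
    (score n s f w) t i j ^+ 2) -
    c ^+ 2 * stage_var f s).
Proof.
move=> mf fb.
have g1 : 0 < 1 + gamma by rewrite addr_gt0.
have b0 : 0 <= b by apply: le_trans (fb 0).
have mf2 : measurable_fun setT (fun x => f x ^+ 2) by exact: measurable_funX.
have f2b x : `|f x ^+ 2| <= b ^+ 2 by rewrite normrX lerXn2r ?nnegrE.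
have n01 : `|0 : R| <= 1 by rewrite normr0.
have n11 : `|1 : R| <= 1 by rewrite normr1.
pose p2 := mix (fun x => f x ^+ 2); pose p1 := mix f.
pose t2 n w t := n%:R^-1 * asum n 1 0 (fun x => f x ^+ 2) s w t - (1 * gamma + 0) * ((l n s)%:R / n%:R) * p2.
pose c2 n w t := n%:R^-1 * asum n 0 1 (fun x => f x ^+ 2) s w t - (0 * gamma + 1) * ((l n s)%:R / n%:R) * p2.
pose t1 n w t := n%:R^-1 * asum n 1 0 f s w t - (1 * gamma + 0) * ((l n s)%:R / n%:R) * p1.
pose c1 n w t := n%:R^-1 * asum n 0 1 f s w t - (0 * gamma + 1) * ((l n s)%:R / n%:R) * p1.
have Vt2 : van t2 by apply: arm_sum_cvg => //; exact: bounded_integrable f2b.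
have Vc2 : van c2 by apply: arm_sum_cvg => //; exact: bounded_integrable f2b.
have Vt1 : van t1 by apply: arm_sum_cvg => //; exact: bounded_integrable fb.
have Vc1 : van c1 by apply: arm_sum_cvg => //; exact: bounded_integrable fb.
pose kk := c ^+ 2 * (1 + gamma) / (2 * gamma ^+ 2).
pose r n := kk * 2 * gamma * (p2 - p1 ^+ 2) * ((l n s)%:R / n%:R - lam s).
have Vr : van (fun n _ _ => r n).
  apply: L1_cvg0_cst => //.
  have : r n @[n --> \oo] --> kk * 2 * gamma * (p2 - p1 ^+ 2) * (lam s - lam s).
    by apply: cvgMl_tmp; apply: cvgB; [exact: lamP|exact: cvg_cst].
  by rewrite subrr mulr0.
have Vn (F : forall n, T n -> Om n -> R) (x : R) : van F -> van (fun n w t => x * `|F n w t|).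
  move=> VF; apply: (L1_cvg0Z (x := fun=> x) (c := `|x|)); first by near=> n.
  by apply: L1_cvg0_dom VF; near=> n => w t; rewrite normr_id.
have VG := L1_cvg0D (L1_cvg0D (L1_cvg0D (Vn _ `|kk| Vt2) (Vn _ (`|kk| * gamma) Vc2))
  (L1_cvg0D (Vn _ (`|kk| * (2 * gamma * b)) Vc1) (Vn _ (`|kk| * (2 * `|p1|)) Vt1))) (Vn _ 1 Vr).
apply: L1_cvg0_dom VG; near=> n => w t; apply: le_trans (ler_norm _).
have n0 : 0 < n%:R :> R by rewrite ltr0n; near: n; exact: nbhs_infty_gt.
have l0 : 0 < (l n s)%:R :> R by rewrite ltr0n.
have sn : (Num.sqrt n%:R) ^+ 2 = n%:R :> R by rewrite sqr_sqrtr.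
pose q := asum n 1 0 f s w t / (l n s)%:R.
have qb : `|q| <= gamma * b.
  rewrite normrM normfV [X in _ / X]ger0_norm// ler_pdivrMr// mulrAC -mE.
  rewrite /arm_sum mul1r mul0r addr0; apply: (le_trans (ler_norm_sum _ _ _)).
  apply: (@le_trans _ _ (\sum_(i < m n s) b)); first by apply: ler_sum.
  by rewrite sumr_const card_ord mulr_natl.
rewrite sum_swapdiff_sqr natrD mE.
set A2 := asum n 1 0 _ s w t; set B2 := asum n 0 1 _ s w t.
set A1 := asum n 1 0 f s w t; set B1 := asum n 0 1 f s w t.
have -> : (4 * (gamma * (l n s)%:R + (l n s)%:R))^-1 *
    (2 * (c / Num.sqrt n%:R / gamma - - (c / Num.sqrt n%:R)) ^+ 2 *
      ((l n s)%:R * A2 + gamma * (l n s)%:R * B2 - 2 * A1 * B1)) - c ^+ 2 * stage_var f s =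
    kk * t2 n w t + kk * gamma * c2 n w t - kk * (2 * q) * c1 n w t - kk * (2 * p1) * t1 n w t + r n.
  have -> : (2 * (c / Num.sqrt n%:R / gamma - - (c / Num.sqrt n%:R)) ^+ 2) =
     2 * c ^+ 2 * ((1 + gamma) / gamma) ^+ 2 / (Num.sqrt n%:R) ^+ 2.
    by field; rewrite !gt_eqF// sqrtr_gt0.
  rewrite sn /stage_var -/p1 -/p2 /t2 /c2 /c1 /t1 /q /r /kk -/A1 -/A2 -/B1 -/B2.
  rewrite (_ : gamma * (l n s)%:R + (l n s)%:R = (1 + gamma) * (l n s)%:R); last by ring.
  by field; rewrite !gt_eqF.
rewrite mul1r; apply: (le_trans (ler_normD _ _)); rewrite lerD2r.
apply: (le_trans (ler_normB _ _)); rewrite addrA !normrM.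
rewrite [`|2|]ger0_norm//.
apply: lerD; last by rewrite -mulrA.
apply: (le_trans (ler_normB _ _)); apply: lerD.
  by apply: (le_trans (ler_normD _ _)); rewrite !normrM [`|gamma|]gtr0_norm.
by rewrite !normrM [`|2|]ger0_norm// ler_wpM2r// ler_wpM2l// -mulrA ler_wpM2l// -normrM.
Unshelve. all: end_near. Qed.

(** As [f] is bounded, each increment has the order of [n] to the power -1/2. There are [N ^ 2]
    pairs and one division by [N], and [N] is at most of order [n]; with cubed increments the total
    again has the order of [n] to the power -1/2. *)
Lemma swapdiff_cube_cvg (c : R) (f : R -> R) (b : R) s : (forall x, `|f x| <= b) ->
  van (fun n w t => (4 * (m n s + l n s)%:R)^-1 * (\sum_i \sum_j
    `|swapdiff (fun t : Om n => t s)
    (cweight n c s)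
    (score n s f w) t i j| ^+ 3)).
Proof.
move=> fb; have b0 : 0 <= b by apply: le_trans (fb 0).
have g1 : 0 < 1 + gamma by rewrite addr_gt0.
pose A := `|c| * (gamma^-1 + 1) * 2 * (2 * b).
have A0 : 0 <= A by rewrite !mulr_ge0// addr_ge0// invr_ge0 ltW.
pose r n : R := (1 + gamma) * (lam s + 1) * A ^+ 3 / 4 * Num.sqrt n%:R^-1.
have Vr : van (fun n _ _ => r n).
  apply: L1_cvg0_cst => //.
  have : r n @[n --> \oo] --> (1 + gamma) * (lam s + 1) * A ^+ 3 / 4 * Num.sqrt 0.
    apply: cvgMl_tmp; apply: (cvg_comp _ _ (@cvg_invn R)); exact: sqrt_continuous.
  by rewrite sqrtr0 mulr0.
apply: L1_cvg0_dom Vr; near=> n => w t.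
have n0 : 0 < n%:R :> R by rewrite ltr0n; near: n; exact: nbhs_infty_gt.
have s0 : 0 < Num.sqrt n%:R :> R by rewrite sqrtr_gt0.
have l0 : 0 < (l n s)%:R :> R by rewrite ltr0n.
have lb : (l n s)%:R <= (lam s + 1) * n%:R by near: n; exact: size_bound.
have NE : (m n s + l n s)%:R = (1 + gamma) * (l n s)%:R by rewrite natrD mE; ring.
set N := (m n s + l n s)%N.
have N0 : 0 < N%:R :> R by rewrite NE mulr_gt0.
pose D i j := swapdiff (fun t : Om n => t s)
    (cweight n c s)
    (score n s f w) t i j.
have Db i j : `|D i j| <= A / Num.sqrt n%:R.
  rewrite /D /swapdiff normrM.
  have wb i' : `|cweight n c s i'| <=
      `|c| / Num.sqrt n%:R * (gamma^-1 + 1).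
    have cs0 : 0 <= `|c| / Num.sqrt n%:R by rewrite divr_ge0// ltW.
    rewrite /arm_weight; case: (fintype.split i') => _.
      by rewrite !normrM !normfV [`|gamma|]gtr0_norm// [`|Num.sqrt _|]gtr0_norm// ler_wpM2l// lerDl.
    by rewrite normrN normrM normfV [`|Num.sqrt _|]gtr0_norm// ler_peMr// lerDr invr_ge0 ltW.
  rewrite (_ : A / _ = (`|c| / Num.sqrt n%:R * (gamma^-1 + 1) + `|c| / Num.sqrt n%:R * (gamma^-1 + 1)) * (b + b)); last first.
    by rewrite /A; field; rewrite !gt_eqF.
  by apply: ler_pM => //; apply: (le_trans (ler_normB _ _)); apply: lerD.
have SD : \sum_i \sum_j `|D i j| ^+ 3 <= N%:R * (N%:R * (A / Num.sqrt n%:R) ^+ 3).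
  apply: (@le_trans _ _ (\sum_(i < N) \sum_(j < N) (A / Num.sqrt n%:R) ^+ 3)).
    by apply: ler_sum => i _; apply: ler_sum => j _; rewrite lerXn2r ?nnegrE// divr_ge0// ltW.
  by rewrite !sumr_const card_ord !mulr_natl.
have S0 : 0 <= \sum_i \sum_j `|D i j| ^+ 3 by apply: sumr_ge0 => i _; apply: sumr_ge0 => j _; rewrite exprn_ge0.
have c40 : 0 <= (4 * N%:R)^-1 :> R by rewrite invr_ge0 mulr_ge0.
rewrite ger0_norm ?mulr_ge0//; apply: le_trans (ler_norm _).
apply: (le_trans (ler_wpM2l c40 SD)).
rewrite (_ : _^-1 * _ = (1 + gamma) * (l n s)%:R * A ^+ 3 / 4 / Num.sqrt n%:R ^+ 3); last first.
  by rewrite -/N NE; field; rewrite !gt_eqF.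
rewrite /r sqrtrV// [Num.sqrt _ ^+ 3](exprSr _ 2) sqr_sqrtr// invfM mulrA.
rewrite ler_wpM2r ?invr_ge0 ?(ltW s0)// ler_pdivrMr//.
rewrite [leRHS]mulrAC ler_wpM2r// [leRHS]mulrAC ler_wpM2r ?exprn_ge0//.
by rewrite -[leRHS]mulrA ler_wpM2l// ltW.
Unshelve. all: end_near. Qed.

Lemma contrast_clt1 (c : R) (f : R -> R) (b : R) s (th : forall n, T n -> Om n -> R) :
  0 <= stage_var f s -> measurable_fun setT f -> (forall x, `|f x| <= b) ->
  (forall n w i j t, th n w (@stage_swap K (m n) (l n) s i j t) = th n w t) ->
  van (fun n w _ => avg (fun t => cos (c * contrast s f w t + th n w t)) -
    expR (- (c ^+ 2 * stage_var f s / 2)) * avg (fun t => cos (th n w t))).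
Proof.
move=> v0 mf fb thI.
have V := L1_cvg0_avg Og (L1_cvg0D (L1_cvg0_norm (@swapdiff_sqr_cvg c f b s mf fb)) (@swapdiff_cube_cvg c f b s fb)).
apply: L1_cvg0_dom V.
near=> n => w t.
have N0 : (0 < m n s + l n s)%N by rewrite addn_gt0 l_gt0 orbT.
have a0 : \sum_i (cweight n c s i) = 0.
  by rewrite sum_arm_weight mE; move: (c / Num.sqrt n%:R) => x; field; rewrite gt_eqF.
have s0 : 0 <= c ^+ 2 * stage_var f s by rewrite mulr_ge0// sqr_ge0.
apply: le_trans (ler_norm _).
under avg_ext do rewrite contrast_permsum.
exact: (permsum_clt (@stage_swap_inv K (m n) (l n) s) (@stage_swap_perm K (m n) (l n) s) _ (thI n w) a0 s0 N0).
Unshelve. all: end_near. Qed.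

(** Distinctness of the stages makes the remaining sum [th'] invariant under swaps in stage [s], so
    that it can serve as the phase in [contrast_clt1]. *)
Lemma contrast_clt (c : 'I_K -> R) (f : R -> R) (b th : R) (r : seq 'I_K) :
  (forall s, 0 <= stage_var f s) -> measurable_fun setT f -> (forall x, `|f x| <= b) -> uniq r ->
  van (fun n w _ => avg (fun t : Om n => cos (\sum_(s <- r) c s * contrast s f w t + th)) -
    expR (- ((\sum_(s <- r) c s ^+ 2 * stage_var f s) / 2)) * cos th).
Proof.
move=> v0 mf fb; elim: r => [|s r IH] /=.
  move=> _; apply: L1_cvg0_dom (L1_cvg0_cst P Og (cvg_cst (0:R))).
  near=> n => w t; rewrite big_nil mul0r oppr0 expR0 mul1r.
  by under avg_ext do rewrite big_nil add0r; rewrite avg_cst// subrr.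
move=> /andP[sr ur].
pose th' n w t : R := \sum_(s' <- r) c s' * contrast s' f w (t : Om n) + th.
have th'I n w i j t : th' n w (@stage_swap K (m n) (l n) s i j t) = th' n w t.
  rewrite /th'; congr (_ + _); rewrite !big_seq; apply: eq_bigr => s' s'r.
  by rewrite contrast_swap//; apply: contraNneq sr => ->.
have V1 := contrast_clt1 (c s) (v0 s) mf fb th'I.
set a := expR (- (c s ^+ 2 * stage_var f s / 2)) in V1.
have V2 := L1_cvg0Z (x := fun=> a) (c := `|a|) _ (IH ur).
have V := L1_cvg0D V1 (V2 _); apply: L1_cvg0_dom (V _); last by near=> n.
near=> n => w t; rewrite big_cons mulrDl opprD expRD.
rewrite (avg_ext (G := fun t => cos (c s * contrast s f w t + th' n w t))); last first.
  by move=> t'; rewrite big_cons addrA.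
rewrite -[avg (fun t0 => cos (th' _ _ t0))]/(avg (fun t0 : Om n => cos (\sum_(s0 <- r) c s0 * contrast s0 f w t0 + th))).
by rewrite le_eqVlt; apply/orP; left; apply/eqP; congr (`|_|); rewrite -/a; ring.
Unshelve. all: end_near. Qed.

(** The difference equals the mixture mean of [(f x - mix f) ^+ 2]. *)
Lemma mix_var_ge0 (f : R -> R) (b : R) : measurable_fun setT f -> (forall x, `|f x| <= b) ->
  0 <= mix (fun x => f x ^+ 2) - mix f ^+ 2.
Proof.
move=> mf fb; have b0 : 0 <= b by apply: le_trans (fb 0).
have g1 : 0 < 1 + gamma by rewrite addr_gt0.
have mf2 : measurable_fun setT (fun x => f x ^+ 2) by exact: measurable_funX.
have f2b x : `|f x ^+ 2| <= b ^+ 2 by rewrite normrX lerXn2r ?nnegrE.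
pose a := mix f.
have E (F : probability R R) : \int[F]_x (f x - a) ^+ 2 =
    \int[F]_x (f x ^+ 2) - 2 * a * \int[F]_x f x + a ^+ 2.
  by apply: Rintegral_sqr_sub; [exact: bounded_integrable fb|exact: bounded_integrable f2b].
have f1 : 0 <= \int[F1]_x ((f x - a) ^+ 2) by apply: Rintegral_ge0 => x _; exact: sqr_ge0.
have f2 : 0 <= \int[F2]_x ((f x - a) ^+ 2) by apply: Rintegral_ge0 => x _; exact: sqr_ge0.
have : 0 <= (gamma * \int[F1]_x ((f x - a) ^+ 2) + \int[F2]_x ((f x - a) ^+ 2)) / (1 + gamma).
  by rewrite divr_ge0 ?(ltW g1)// addr_ge0// mulr_ge0// ltW.
congr (0 <= _); rewrite !E -/a.
have aE : gamma * \int[F1]_x f x + \int[F2]_x f x = a * (1 + gamma).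
  by rewrite /a /mix divfK// gt_eqF.
have -> : \int[F2]_x f x = a * (1 + gamma) - gamma * \int[F1]_x f x by rewrite -aE addrC addKr.
by rewrite /mix; field; rewrite gt_eqF.
Qed.

Lemma stage_var_cvg s : stage_var (trunc j id) s @[j --> \oo] --> stage_var id s.
Proof.
have M f_ f : \int[F1]_x f_ j x @[j --> \oo] --> \int[F1]_x f x ->
    \int[F2]_x f_ j x @[j --> \oo] --> \int[F2]_x f x ->
    mix (f_ j) @[j --> \oo] --> mix f.
  move=> h1 h2; apply: cvgMr_tmp; apply: cvgD => //; exact: cvgMl_tmp.
apply: cvgMl_tmp; apply: cvgB.
  by apply: (M (fun j x => trunc j id x ^+ 2)); exact: trunc_sqr_cvg.
have C : mix (trunc j id) @[j --> \oo] --> mix id.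
  by apply: (M (fun j => trunc j id)); exact: trunc_mean_cvg.
by under eq_fun do rewrite expr2; rewrite expr2; exact: cvgM.
Qed.

(** Four errors of [e / 4]: from the statistics to contrasts, from contrasts to truncated ones, the
    Gaussian approximation of the latter, and the change of variance caused by truncation. *)
Lemma stat_cf u th : van (fun n w _ => avg (fun t : Om n => cos (\sum_k u k * stat n w t k + th)) -
  expR (- ((\sum_s phase_coef u s ^+ 2 * stage_var id s) / 2)) * cos th).
Proof.
move=> e e0; pose c := phase_coef u.
have e40 : 0 < e / 4 by rewrite divr_gt0.
have Cj : expR (- ((\sum_s c s ^+ 2 * stage_var (trunc j id) s) / 2)) * cos th @[j --> \oo] -->
    expR (- ((\sum_s c s ^+ 2 * stage_var id s) / 2)) * cos th.
  apply: cvgMr_tmp; apply: continuous_cvg; first exact: continuous_expR.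
  apply: cvgN; apply: cvgMr_tmp; apply: cvg_seq_sum => s _; apply: cvgMl_tmp; exact: stage_var_cvg.
(* The truncation level is chosen before [n], because the Gaussian approximation holds for each
   fixed level, with no uniformity in [j]. *)
near \oo => j.
have mj := measurable_trunc j (@measurable_id _ R setT).
have vj s : 0 <= stage_var (trunc j id) s.
  apply: mulr_ge0; last exact: mix_var_ge0 (trunc_bound j id).
  by rewrite mulr_ge0// divr_ge0 ?addr_ge0// ltW.
have V1 := L1_cvg0_avg Og (cos_stat_cvg u th).
have V3 := contrast_clt c th vj mj (trunc_bound j id) (index_enum_uniq _).
have D4 : `|expR (- ((\sum_s c s ^+ 2 * stage_var (trunc j id) s) / 2)) * cos th -
    expR (- ((\sum_s c s ^+ 2 * stage_var id s) / 2)) * cos th| <= e / 4.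
  by rewrite distrC; near: j; move/cvgrPdist_le: Cj; exact.
have V2 : \forall n \near \oo, L1_le (P n) (fun w (t : Om n) =>
    cos (\sum_s c s * contrast s id w t + th) -
    cos (\sum_s c s * contrast s (trunc j id) w t + th)) (e / 4).
  by near: j; exact: cos_trunc_cvg.
apply: filterS (filterI (V1 _ e40) (filterI V2 (V3 _ e40))) => n [K1 [K2 K3]].
have K4 := L1_le_mono (fun w => lexx _) D4 (L1_le_cst (P n) (Og n) _).
have KK := L1_leD (L1_leD K1 K2) (L1_leD K3 K4).
apply: (L1_le_mono _ _ KK); last by lra.
(* Averaged over [t], the four differences telescope to [avg A - y], so the sum of the four L1
   bounds controls it. *)
have G (A B C : Om n -> R) (x y : R) :
    avg (fun t => avg (fun t' => A t' - B t') + (B t - C t) + (avg C - x + (x - y))) = avg A - y.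
  rewrite (avg_ext (G := fun t => (avg A - avg B + avg C - y) + (B t - C t))); last first.
    by move=> t; rewrite avgB; ring.
  by rewrite avgD [avg (fun t => B t - C t)]avgB (avg_cst _ (Og n)); ring.
move=> w; rewrite (avg_cst _ (Og n)) -(G _ (fun t => cos (\sum_s c s * contrast s id w t + th))
  (fun t => cos (\sum_s c s * contrast s (trunc j id) w t + th))
  (expR (- ((\sum_s c s ^+ 2 * stage_var (trunc j id) s) / 2)) * cos th)).
exact: norm_avg_le.
Unshelve. all: end_near. Qed.

(* The Gaussian limit is the sum over the stages s of independent standard
   normal multiples of these vectors. *)
Definition direction (s : 'I_K) : 'rV[R]_K :=
  \row_k (if (s <= k)%N then Num.sqrt (lam s) / Num.sqrt (Lam k) else 0).

Lemma dot_direction u s :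
  dot u (direction s) = Num.sqrt (lam s) * \sum_(k < K | (s <= k)%N) u 0 k / Num.sqrt (Lam k).
Proof.
rewrite /dot mulr_sumr [RHS]big_mkcond/=; apply: eq_bigr => k _.
by rewrite mxE; case: ifP => _; rewrite ?mulr0// mulrCA.
Qed.

(** Studentization at work: the factor [(1 + gamma) / gamma * pool_var] of the stage variance
    cancels against the square of [scale], and only the numbers [lam] remain. *)
Lemma phase_exponent (u : 'rV[R]_K) : \sum_s phase_coef (u 0) s ^+ 2 * stage_var id s =
  \sum_(e <- [seq direction s | s <- index_enum 'I_K]) dot u e ^+ 2.
Proof.
have g1 : 0 < 1 + gamma by rewrite addr_gt0.
rewrite big_map; apply: eq_bigr => s _; rewrite dot_direction.
set W := \sum_(k < K | _) _.
have -> : phase_coef (u 0) s = Num.sqrt (gamma / (1 + gamma)) / Num.sqrt pool_var * W.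
  by rewrite /phase_coef /W mulr_sumr; apply: eq_bigr => k _; rewrite /scale; ring.
rewrite !exprMn exprVn !sqr_sqrtr ?(ltW pool_var_gt0) ?divr_ge0 ?(ltW gamma_gt0) ?(ltW g1)//.
rewrite /stage_var -[mix (fun x => id x ^+ 2) - _]/pool_var.
by field; rewrite !gt_eqF.
Qed.

(** For [i <= j] the stages common to both sum to [Lam i], which leaves the square root of
    [Lam i / Lam j]; the factor [v] cancels in the quotient. *)
Lemma limit_cov_direction (Istar : 'I_K -> R) v i j : 0 < v -> (forall k, 0 < Istar k) ->
  (forall k, Lam k = v * Istar k) ->
  limit_cov Istar i j = \sum_s direction s 0 i * direction s 0 j.
Proof.
move=> v0 I0 LI; wlog ij : i j / (i <= j)%N.
  move=> H; have [ij|/ltnW ji] := leqP i j; first exact: H.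
  have := H j i ji; rewrite ![limit_cov _ _ _]mxE minC maxC => ->.
  by apply: eq_bigr => s _; rewrite mulrC.
rewrite mxE (min_l (ij : (i <= j)%O)) (max_r (ij : (i <= j)%O)).
rewrite (eq_bigr (fun s : 'I_K => if (s <= i)%N then lam s / (Num.sqrt (Lam i) * Num.sqrt (Lam j)) else 0)); last first.
  move=> s _; rewrite !mxE; case: ifP => si; last by rewrite mul0r.
  by rewrite (leq_trans si ij) mulf_div -expr2 sqr_sqrtr.
rewrite -big_mkcond/= -mulr_suml -/(Lam i) -{1}(sqr_sqrtr (ltW (Lam_gt0 i))).
rewrite !LI [Num.sqrt (Istar i / _)]sqrtrM ?(ltW (I0 i))// sqrtrV ?(ltW (I0 j))//.
rewrite ![Num.sqrt (v * _)]sqrtrM ?(ltW v0)//.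
by field; rewrite !gt_eqF ?sqrtr_gt0.
Qed.

Lemma limit_cov_form (Istar : 'I_K -> R) v u : 0 < v -> (forall k, 0 < Istar k) ->
  (forall k, Lam k = v * Istar k) ->
  (u *m limit_cov Istar *m u^T) 0 0 =
  \sum_(e <- [seq direction s | s <- index_enum 'I_K]) dot u e ^+ 2.
Proof.
move=> v0 I0 LI; rewrite big_map mxE.
have E j : (u *m limit_cov Istar) 0 j * u^T j 0 =
    \sum_s \sum_i u 0 i * (direction s 0 i * direction s 0 j) * u 0 j.
  rewrite [(u *m _) 0 j]mxE [u^T j 0]mxE mulr_suml exchange_big/=; apply: eq_bigr => i _.
  by rewrite (limit_cov_direction _ _ v0 I0 LI) mulr_sumr mulr_suml.
rewrite (eq_bigr _ (fun j _ => E j)).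
rewrite exchange_big/=; apply: eq_bigr => s _.
rewrite /dot expr2 mulr_sumr; apply: eq_bigr => j _; rewrite mulr_suml; apply: eq_bigr => i _.
by ring.
Qed.

End permutation_asymptotics.

(** * Convergence in probability of the conditional law *)

Section outer_vanishing.
Variables (R : realType) (d : nat -> measure_display) (T : forall n, measurableType (d n)).
Variable P : forall n, probability (T n) R.
Implicit Types A B : forall n, set (T n).

Definition outer_vanish A := forall e : R, 0 < e ->
  \forall n \near \oo, (mu_ext (P n) (A n) <= e%:E)%E.

Lemma outer_vanishS A B : (forall n, A n `<=` B n) -> outer_vanish B -> outer_vanish A.
Proof.
by move=> AB B0 e /B0; apply: filterS => n; apply: le_trans; apply: le_mu_ext; exact: AB.
Qed.

Lemma outer_vanishU A B : outer_vanish A -> outer_vanish B -> outer_vanish (fun n => A n `|` B n).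
Proof.
move=> A0 B0 e e0; have e2 : 0 < e / 2 by rewrite divr_gt0.
apply: filterS (filterI (A0 _ e2) (B0 _ e2)) => n [h1 h2].
apply: le_trans (outer_measureU2 (mu_ext (P n)) (A n) (B n)) _.
by rewrite [e]splitr EFinD leeD.
Qed.

Lemma outer_vanish_exists (r : nat) (A : nat -> forall n, set (T n)) :
  (forall i, (i < r)%N -> outer_vanish (A i)) ->
  outer_vanish (fun n => [set w | exists2 i, (i < r)%N & A i n w]).
Proof.
elim: r => [_|r IH H].
  move=> e e0; apply: nearW => n; rewrite (_ : [set w | _] = set0); last first.
    by apply/seteqP; split => // w [].
  by rewrite mu_ext0// lee_fin ltW.
apply: (@outer_vanishS _ (fun n => [set w | exists2 i, (i < r)%N & A i n w] `|` A r n)).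
  move=> n w [i]; rewrite ltnS leq_eqVlt => /predU1P[-> Aw|ir Aw]; first by right.
  by left; exists i.
by apply: outer_vanishU; [apply: IH => i ir; apply: H; exact: ltnW|exact: H].
Qed.

Lemma outer_vanish_cvg A : outer_vanish A -> mu_ext (P n) (A n) @[n --> \oo] --> 0%E.
Proof.
move=> A0.
have A1 n : (0 <= mu_ext (P n) (A n))%E by exact: mu_ext_ge0.
have fn : \forall n \near \oo, mu_ext (P n) (A n) \is a fin_num.
  apply: filterS (A0 1 ltr01) => n h; rewrite ge0_fin_numE//.
  by apply: le_lt_trans h _; rewrite ltry.
apply/fine_cvgP; split => //; apply/cvgr0Pnorm_le => e e0.
apply: filterS (filterI fn (A0 _ e0)) => n [f1 h].
by rewrite /= ger0_norm ?fine_ge0// -lee_fin fineK.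
Qed.

End outer_vanishing.

(** The mixture variance is the weighted mean of the two variances plus a nonnegative term
    proportional to the squared difference of the means. Positivity comes from the former, which
    carries other weights than the hypothesis does. *)
Lemma pool_var_gt0 (R : realType) (gamma : R) (F1 F2 : probability R R) : 0 < gamma ->
  F1.-integrable setT (EFin \o id) -> F2.-integrable setT (EFin \o id) ->
  F1.-integrable setT (EFin \o (fun x => x ^+ 2)) -> F2.-integrable setT (EFin \o (fun x => x ^+ 2)) ->
  0 < (\int[F1]_x (x - \int[F1]_x x) ^+ 2) / gamma + \int[F2]_x (x - \int[F2]_x x) ^+ 2 ->
  0 < pool_var gamma F1 F2.
Proof.
move=> g0 i1 i2 q1 q2; have g1 : 0 < 1 + gamma by rewrite addr_gt0.
have E (F : probability R R) : F.-integrable setT (EFin \o id) ->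
    F.-integrable setT (EFin \o (fun x => x ^+ 2)) ->
    \int[F]_x (x - \int[F]_x x) ^+ 2 = \int[F]_x (x ^+ 2) - (\int[F]_x x) ^+ 2.
  by move=> i q; rewrite (Rintegral_sqr_sub (f := id) _ i q); ring.
have s1 : 0 <= \int[F1]_x (x - \int[F1]_x x) ^+ 2 by apply: Rintegral_ge0 => x _; exact: sqr_ge0.
have s2 : 0 <= \int[F2]_x (x - \int[F2]_x x) ^+ 2 by apply: Rintegral_ge0 => x _; exact: sqr_ge0.
rewrite /pool_var /mix; rewrite (E _ i1 q1) in s1 *; rewrite (E _ i2 q2) in s2 *.
rewrite -[\int[F1]_x id x]/(\int[F1]_x x) -[\int[F2]_x id x]/(\int[F2]_x x).
move: (\int[F1]_x x) (\int[F2]_x x) (\int[F1]_x (x ^+ 2)) (\int[F2]_x (x ^+ 2)) s1 s2 => a b p q s1 s2 v0.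
rewrite (_ : _ - _ = (gamma * ((p - a ^+ 2) / gamma + (q - b ^+ 2)) + (1 - gamma) * (q - b ^+ 2) +
   (gamma ^+ 2 - gamma) * ((p - a ^+ 2) / gamma)) / (1 + gamma) + gamma * ((a - b) / (1 + gamma)) ^+ 2); last first.
  by field; rewrite !gt_eqF.
apply: ltr_wpDr; first by rewrite mulr_ge0 ?sqr_ge0 ?(ltW g0).
apply: divr_gt0 => //.
rewrite (_ : _ + _ + _ = gamma ^+ 2 * ((p - a ^+ 2) / gamma) + (q - b ^+ 2)); last by ring.
have u0 : 0 <= (p - a ^+ 2) / gamma by rewrite divr_ge0// ltW.
have G2 : 0 < gamma ^+ 2 by rewrite exprn_gt0.
have [qb|qb] := ltP 0 (q - b ^+ 2); first by rewrite ltr_wpDl// mulr_ge0// ltW.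
rewrite ltr_wpDr// mulr_gt0//; lra.
Qed.

Section conditional.
Variables (R : realType) (K : nat) (m l : nat -> 'I_K -> nat).
Variables (d : nat -> measure_display) (T : forall n, measurableType (d n)).
Variables (P : forall n, probability (T n) R) (X Y : forall n, nat -> {RV (P n) >-> R}).
Variables (tau : forall n (k : 'I_K), T n -> 'S_(m n k + l n k)).
Hypothesis htau_meas : forall n k s, measurable (@tau n k @^-1` [set s]).
Hypothesis htau_unif : forall n k s,
  P n (@tau n k @^-1` [set s]) = (((m n k + l n k)`!)%:R^-1)%:E.
Hypothesis hindep : forall n, mutually_independent (P n) (experiment_events (X n) (Y n) (@tau n)).
Variable kappa : forall n, T n -> probability (borel_rV R K) R.
Hypothesis hkappa : forall n, is_conditional_law (P n)
  (@data_sigma (T n) R (total_size (m n)) (total_size (l n)) (X n) (Y n))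
  (fun w => perm_stat_vec (X n ^~ w) (Y n ^~ w) (fun k => @tau n k w)) (@kappa n).

Lemma conditional_vanish (h : borel_rV R K -> R) (C c eps : R)
    (G : forall n, T n -> Om (m n) (l n) -> R) :
  measurable_fun setT h -> (forall x, `|h x| <= C) -> L1_cvg0 P G ->
  (\forall n \near \oo, forall w, avg (fun t : Om (m n) (l n) =>
     h (perm_stat_vec (X n ^~ w) (Y n ^~ w) (fun k => t k))) <= c + avg (fun t => `|G n w t|)) ->
  0 < eps -> outer_vanish P (fun n => [set w | c + eps <= \int[kappa w]_x h x]).
Proof.
move=> mh hC G0 hG eps0 e e0.
(* The factor [4 / eps] in [conditional_bound] turns this value into [e]. *)
have b0 : 0 < eps * e / 4 by rewrite divr_gt0// mulr_gt0.
apply: filterS (filterI hG (G0 _ b0)) => n [h1 [g [mg Gg gb]]].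
have g0 w : 0 <= g w by apply: le_trans (Gg w); exact: avg_ge0.
have hg w : avg (fun t : Om (m n) (l n) => h (St (X n) (Y n) t w)) <= c + g w.
  by apply: (le_trans (h1 w)); rewrite lerD2l.
apply: le_trans (conditional_bound (@htau_meas n) (@htau_unif n) (@hindep n) (@hkappa n) mh hC eps0 mg g0 gb hg) _.
by rewrite lee_fin (_ : 4 * (eps * e / 4) / eps = e)//; field; rewrite gt_eqF.
Qed.

End conditional.

Lemma phase_dot (R : realType) (K : nat) (q : nat * {ffun 'I_K -> int} * int) (x : 'rV[R]_K) :
  phase q x = dot (\row_k ((q.1.2 k)%:~R / q.1.1%:R)) x + q.2%:~R * (pi / 2).
Proof.
rewrite /phase /dot mulr_suml; congr (_ + _); apply: eq_bigr => k _.
by rewrite mxE mulrAC.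
Qed.

Theorem theorem1 (R : realType) (K : nat) (hK : (0 < K)%N)
    (* stage sample sizes (treatment m, control l), depending on n *)
    (m l : nat -> 'I_K -> nat) (gamma : R) (hgamma : 0 < gamma)
    (hratio : forall n k, (m n k)%:R / (l n k)%:R = gamma)
    (* outcome distributions, with finite means and variances *)
    (F1 F2 : probability R R)
    (hmean1 : F1.-integrable setT (fun x => x%:E))
    (hmean2 : F2.-integrable setT (fun x => x%:E))
    (hvar1 : ('V_F1[@idfun R] < +oo)%E)
    (hvar2 : ('V_F2[@idfun R] < +oo)%E)
    (* data and random permutations of the n-th experiment *)
    (d : nat -> measure_display) (T : forall n, measurableType (d n))
    (P : forall n, probability (T n) R)
    (X Y : forall n, nat -> {RV (P n) >-> R})
    (tau : forall n (k : 'I_K), T n -> 'S_(m n k + l n k))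
    (hX : forall n i (B : set R), (i < total_size (m n))%N -> measurable B ->
       P n (X n i @^-1` B) = F1 B)
    (hY : forall n j (B : set R), (j < total_size (l n))%N -> measurable B ->
       P n (Y n j @^-1` B) = F2 B)
    (htau_meas : forall n k s, measurable (tau n k @^-1` [set s]))
    (htau_unif : forall n k s,
       P n (tau n k @^-1` [set s]) = (((m n k + l n k)`!)%:R^-1)%:E)
    (hindep : forall n, mutually_independent (P n)
       (experiment_events (X n) (Y n) (tau n)))
    (* information limits *)
    (Istar : 'I_K -> R) (hIstar : forall k, 0 < Istar k)
    (hinfo_hat : forall k, cvg_in_prob P
       (fun n w => info_hat (m n) (l n) (X n ^~ w) (Y n ^~ w) k / n%:R)
       (Istar k))
    (hinfo : forall k,
       (n%:R * fine 'V_(P n)[fun w : T n =>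
            mean_diff (m n) (l n) (X n ^~ w) (Y n ^~ w) k])^-1
         @[n --> \oo] --> Istar k)
    (* conditional law of the permuted statistics given the data *)
    (kappa : forall n, T n -> probability (borel_rV R K) R)
    (hkappa : forall n, is_conditional_law (P n)
       (@data_sigma (T n) R (total_size (m n)) (total_size (l n)) (X n) (Y n))
       (fun w => perm_stat_vec (X n ^~ w) (Y n ^~ w) (fun k => tau n k w))
       (kappa n))
    (* any metric for weak convergence on R^K *)
    (rho : probability (borel_rV R K) R -> probability (borel_rV R K) R -> R)
    (hrho : metrizes_weak_convergence rho) :
  exists N : probability (borel_rV R K) R,
    is_multivariate_normal 0 (limit_cov Istar) N /\
    cvg_in_prob P (fun n w => rho (kappa n w) N) 0.

Proof.
have sqr (F : probability R R) : F.-integrable setT (fun x : R => x%:E) -> ('V_F[@idfun R] < +oo)%E ->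
    F.-integrable setT (EFin \o (fun x : R => x ^+ 2)).
  move=> hm hv; have := integrable_centered_sqr hm hv 0.
  by rewrite /comp; under eq_fun do rewrite subr0.
have sqr1 := sqr F1 hmean1 hvar1; have sqr2 := sqr F2 hmean2 hvar2.
have mE := stage_ratio hgamma hratio; have l0 := stage_gt0 hgamma hratio.
set s1 := \int[F1]_x (x - \int[F1]_x x) ^+ 2; set s2 := \int[F2]_x (x - \int[F2]_x x) ^+ 2.
have s1_ge0 : 0 <= s1 by apply: Rintegral_ge0 => x _; exact: sqr_ge0.
have s2_ge0 : 0 <= s2 by apply: Rintegral_ge0 => x _; exact: sqr_ge0.
have info k : (n%:R * (s1 / (cum (m n) k)%:R + s2 / (cum (l n) k)%:R))^-1 @[n --> \oo] --> Istar k.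
  have E n : fine 'V_(P n)[fun w : T n => mean_diff (m n) (l n) (X n ^~ w) (Y n ^~ w) k] =
      s1 / (cum (m n) k)%:R + s2 / (cum (l n) k)%:R.
    have c0 := cum_gt0 R (l0 n) k.
    apply: (variance_mean_diff (@hX n) (@hY n) (@hindep n) hmean1 hmean2 hvar1 hvar2).
      by rewrite -(ltr0n R) (cumE (mE n)) mulr_gt0.
    by rewrite -(ltr0n R).
  by under eq_fun do rewrite -E; exact: hinfo.
have v0 := var_rate_gt0 hgamma hratio hK s1_ge0 s2_ge0 hIstar info.
have [lam [lam0 lamP lamE]] := stage_size_cvg hgamma hratio hK s1_ge0 s2_ge0 hIstar info.
have Lam0 k : 0 < Lam lam k by rewrite /Lam lamE mulr_gt0.
have V0 := pool_var_gt0 hgamma hmean1 hmean2 sqr1 sqr2 v0.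
have [N HN] := gaussian_vector_exists [seq direction lam s | s <- index_enum 'I_K].
exists N; split.
  apply: (gaussian_vector_normal HN) => u.
  exact: (limit_cov_form lam0 Lam0 u v0 hIstar lamE).
have [C [G [C0 G0 tight]]] := perm_stat_tight hgamma mE l0 hmean1 hmean2 sqr1 sqr2
  hX hY hindep lam0 lamP Lam0 V0.
pose tl (j : nat) : R := C / j.+1%:R ^+ 2.
have tl0 e : 0 < e -> exists j, tl j <= e.
  move=> e0; exists (Num.truncn (C / e)); set j := Num.truncn _.
  have j1 : 1 <= j.+1%:R :> R by rewrite ler1n.
  have H : C <= e * j.+1%:R by rewrite mulrC -ler_pdivrMr// ltW// truncnS_gt.
  rewrite /tl ler_pdivrMr ?exprn_gt0// (le_trans H)// ler_wpM2l ?(ltW e0)//.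
  by rewrite expr2 ler_peMr.
move=> eps eps0; have [r ball] := rho_ball hrho N tl0 eps0.
pose dl : R := r.+1%:R^-1; have dl0 : 0 < dl by rewrite invr_gt0.
pose h i (x : borel_rV R K) := cos (phase (phase_of K i) x).
pose D i := \int[N]_x h i x.
have mh i : measurable_fun setT (h i) by apply: continuous_measurable_rV; exact: continuous_cos_phase.
have hb i x : `|h i x| <= 1 by rewrite ler_norml cos_geN1 cos_le1.
pose F i n w (t : Om (m n) (l n)) := avg (fun t : Om (m n) (l n) =>
  h i (perm_stat_vec (X n ^~ w) (Y n ^~ w) (fun k => t k))) - D i.
have F0 i : L1_cvg0 P (F i).
  pose u : 'rV[R]_K := \row_k (((phase_of K i).1.2 k)%:~R / (phase_of K i).1.1%:R).
  pose th : R := (phase_of K i).2%:~R * (pi / 2).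
  have V := stat_cf hgamma mE l0 hmean1 hmean2 sqr1 sqr2 hX hY hindep lam0 lamP Lam0 V0 (u 0) th.
  have DE : D i = expR (- ((\sum_s phase_coef gamma F1 F2 lam (u 0) s ^+ 2 *
      stage_var gamma F1 F2 lam id s) / 2)) * cos th.
    rewrite /D /h (phase_exponent hgamma lam0 V0) -mulNr -HN.
    by apply: eq_Rintegral => x _; rewrite phase_dot.
  apply: L1_cvg0_dom V; near=> n => w t.
  rewrite /F DE (avg_ext (G := fun t : Om (m n) (l n) => cos (\sum_k u 0 k *
    perm_stat (X n ^~ w) (Y n ^~ w) (fun k => t k) k + th)))// => t'.
  rewrite /h phase_dot /dot; congr (cos (_ + _)); apply: eq_bigr => k _.
  by rewrite [perm_stat_vec _ _ _ _ _]mxE.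
(* [conditional_vanish] gives one-sided bounds, so a two-sided deviation is the union of two events,
   the second one for the opposite of [h i]. *)
pose A i n := [set w | D i + dl <= \int[kappa n w]_x h i x] `|`
              [set w | - D i + dl <= \int[kappa n w]_x (- h i x)].
have aF i n w : avg (fun t => `|F i n w t|) = `|avg (fun t : Om (m n) (l n) =>
    h i (perm_stat_vec (X n ^~ w) (Y n ^~ w) (fun k => t k))) - D i|.
  by rewrite /F (avg_cst _ (Om_gt0 (m n) (l n))).
have A0 i : outer_vanish P (A i).
  apply: outer_vanishU.
    apply: (conditional_vanish htau_meas htau_unif hindep hkappa (mh i) (hb i) (F0 i)) => //.
    near=> n => w; rewrite aF -lerBlDl; exact: ler_norm.
  apply: (conditional_vanish htau_meas htau_unif hindep hkappa (h := fun x => - h i x) (C := 1) _ _ (F0 i)) => //.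
  - exact: measurableT_comp.
  - by move=> x; rewrite normrN.
  near=> n => w; rewrite aF avgN -lerBlDl opprK addrC -normrN opprB; exact: ler_norm.
pose B j n := [set w | tl j + dl <= \int[kappa n w]_x (\1_(@box_tail R K j) x : R)].
have B0 j : outer_vanish P (B j).
  apply: (conditional_vanish htau_meas htau_unif hindep hkappa (C := 1) _ _ G0) => //.
  - exact: measurable_indic (measurable_box_tail j).
  - by move=> x; rewrite indicE; case: (_ \in _); rewrite ?normr1// normr0.
  by apply: filterS tight => n H w; exact: H.
apply: outer_vanish_cvg.
(* The exceptional set is a finite union, since [rho_ball] asks for [r] cosines and [r] tails only;
   outside it [kappa n w] lies in the ball. *)
apply: (@outer_vanishS _ _ _ _ _ (fun n => [set w | exists2 i, (i < r)%N & A i n w] `|`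
  [set w | exists2 j, (j < r)%N & B j n w])); last first.
  by apply: outer_vanishU; apply: outer_vanish_exists.
move=> n w /= H; apply: contrapT => nu.
(* Nonnegativity follows from the other axioms: [0 = rho mu mu <= rho mu N + rho N mu], and the two
   summands are equal. *)
have rho0 mu : 0 <= rho mu N.
  have [rho1 rho2 rho3 _] := hrho.
  have := rho3 mu N mu; rewrite [rho N mu]rho2 (rho1 mu mu).2// => h0; lra.
move: H; rewrite subr0 ger0_norm// leNgt => /negP; apply; apply: ball => [i ir|j jr].
  have N1 : \int[kappa n w]_x h i x < D i + dl.
    by rewrite ltNge; apply/negP => k; apply: nu; left; exists i => //; left.
  have N2 : \int[kappa n w]_x (- h i x) < - D i + dl.
    by rewrite ltNge; apply/negP => k; apply: nu; left; exists i => //; right.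
  have E : \int[kappa n w]_x (- h i x) = - \int[kappa n w]_x h i x.
    transitivity (\int[kappa n w]_x (- 1 * h i x)).
      by apply: eq_Rintegral => x _; rewrite mulN1r.
    by rewrite (RintegralZl (- 1) measurableT (integrable_cos_phase _ _)) mulN1r.
  rewrite E in N2; rewrite -/(D i) ler_norml -/dl; apply/andP; split; lra.
have N1 : \int[kappa n w]_x (\1_(@box_tail R K j) x : R) < tl j + dl.
  by rewrite ltNge; apply/negP => k; apply: nu; right; exists j.
rewrite (_ : fine _ = \int[kappa n w]_x (\1_(@box_tail R K j) x : R)); first exact: ltW.
by rewrite /Rintegral integral_indic ?setIT//; exact: measurable_box_tail.
Unshelve. all: end_near. Qed.
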